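(* Let $\nu\ge 1$, $\rho_1>\rho>0$, and let $F$ be a $\mathbb{C}^\nu$-valued function of $(\varepsilon,z,f)$, holomorphic in (a neighbourhood of) the closed polydisc $\bar D_\rho\times\bar D_{\rho_1}\times\bar D_\rho^{\,\nu}$, with $F(\varepsilon,0,0)=0$ for all $\varepsilon\in\bar D_\rho$. Let $\gamma>0$ and assume that the matrix $A_{0,1}(0)=F_f(0,0,0)$ is invertible, with eigenvalues $\lambda_1,\dots,\lambda_\nu$ satisfying $|\arg\lambda_j|>\gamma/2$ for $j=1,\dots,\nu$ (with $\arg\lambda_j\in(-\pi,\pi]$). Let $0<E\le\rho$ and $0<\sigma\le\rho_1$ be such that the system $$\varepsilon z f'(\varepsilon,z)=F(\varepsilon,z,f(\varepsilon,z)),\qquad f'=\partial f/\partial z,$$ has a unique solution $f:S(0,\gamma;E)\times D_\sigma\to \bar D_\rho^{\,\nu}$ that is holomorphic with $f(\varepsilon,0)=0$ for all $\varepsilon$, and such that, as $\varepsilon\to0$ in $S(0,\gamma;E)$, $f(\varepsilon,z)$ converges for $z\in D_\sigma$ to the unique holomorphic solution $f^*(z)$ of $F(0,z,f^*(z))=0$ in $D_\sigma$ with $f^*(0)=0$. Put $$\phi_i(\varepsilon,z)=\frac{1}{i!}\frac{\partial^i f}{\partial\varepsilon^i}(\varepsilon,z),\qquad i\ge0 .$$ Then there exist $0<\sigma_1\le\sigma$, $0<E_1\le E$ and positive constants $C$ and $\mu$ such that $$\|\phi_i(\varepsilon,z)\|\le C\,i!\,\mu^i$$ holds for all $i\ge0$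 and every point $(\varepsilon,z)\in S(0,\gamma;E_1)\times\bar D_{\sigma_1}$.
   Context: Notation: $D_r=\{z\in\mathbb{C}:|z|<r\}$, $\bar D_r$ is its closure, $F_f$ is the Jacobian matrix of $F$ with respect to $f\in\mathbb{C}^\nu$, and $\|\cdot\|$ is the Euclidean norm on $\mathbb{C}^\nu$. For $\gamma,E>0$, $S(0,\gamma;E)=\{\varepsilon\in\mathbb{C}:0<|\varepsilon|<E,\ |\arg\varepsilon|<\gamma/2\}$ is the open sector bisected by the positive real axis, of opening $\gamma$ and radius $E$. *)

(* Defs.v *)
From HB Require Import structures.
From mathcomp Require Import all_boot all_order all_algebra.
From mathcomp Require Import all_classical all_reals all_analysis.
From mathcomp Require Import complex.

Set Implicit Arguments.
Unset Strict Implicit.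
Unset Printing Implicit Defensive.

Import Order.TTheory GRing.Theory Num.Theory.
Import numFieldNormedType.Exports.

Local Open Scope classical_set_scope.
Local Open Scope ring_scope.

(* R[i] itself carries no canonical topology.  Packed as a numClosedFieldType
   it is a normed module over itself, so that [differentiable], [derive1n] and
   [jacobian] below are complex differentiability, complex derivatives and the
   complex Jacobian. *)
Definition Cx (R : realType) : numClosedFieldType := R[i].

Section ComplexDomains.
Variable R : realType.

(* R-valued modulus; the library norm [`|z|] takes its values in R[i]. *)
Definition modulus (z : Cx R) : R := Normc.normc z.

Lemma normE_modulus (z : Cx R) : `|z| = (modulus z)%:C%C.
Proof. by rewrite normc_def /modulus; case: z. Qed.

(* Principal argument, in ]-pi, pi]; only meaningful for z != 0. *)
Definition Arg (z : Cx R) : R :=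
  if 0 <= complex.Im z then acos (complex.Re z / modulus z)
  else - acos (complex.Re z / modulus z).

Definition disc (r : R) : set (Cx R) := [set z | modulus z < r].

Definition cdisc (r : R) : set (Cx R) := [set z | modulus z <= r].

Definition cpolydisc (nu : nat) (r : R) : set 'rV[Cx R]_nu :=
  [set v | forall j, cdisc r (v ord0 j)].

Definition sector (gamma E : R) : set (Cx R) :=
  [set e | [/\ 0 < modulus e, modulus e < E & `|Arg e| < gamma / 2]].

(* The norm that the library puts on row vectors is the sup norm. *)
Definition euclidean_norm (nu : nat) (v : 'rV[Cx R]_nu) : R :=
  Num.sqrt (\sum_(j < nu) modulus (v ord0 j) ^+ 2).

End ComplexDomains.

Section Holomorphy.
Variables (R : realType) (V W : normedModType (Cx R)).

(* For open U. *)
Definition holomorphic (U : set V) (g : V -> W) : Prop :=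
  forall x, U x -> differentiable g x.

Definition holomorphic_near (K : set V) (g : V -> W) : Prop :=
  exists U : set V, [/\ open U, K `<=` U & holomorphic U g].

End Holomorphy.

Section SingularSystem.
Variables (R : realType) (nu : nat).
Local Notation C := (Cx R).
Variable F : C * C * 'rV[C]_nu -> 'rV[C]_nu.

(* Entry (i, j) is the derivative of F_i with respect to f_j; the library's
   [jacobian] acts on row vectors from the right, whence the transpose. *)
Definition jacobian_f (e z : C) (y : 'rV[C]_nu) : 'M[C]_nu :=
  (jacobian (fun w => F (e, z, w)) y)^T.

Definition is_solution (rho gamma E sigma : R) (f : C * C -> 'rV[C]_nu) : Prop :=
  [/\ holomorphic (sector gamma E `*` disc sigma) f,
      forall e z, sector gamma E e -> disc sigma z ->
        cpolydisc rho (f (e, z)),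
      forall e, sector gamma E e -> f (e, 0) = 0 &
      forall e z, sector gamma E e -> disc sigma z ->
        (e * z) *: derive1 (fun w => f (e, w)) z = F (e, z, f (e, z))].

(* F is only meaningful on (a neighbourhood of) the closed polydisc, so the
   values of a solution of F(0, z, g(z)) = 0 are required to lie in it. *)
Definition is_reduced_solution (rho sigma : R) (g : C -> 'rV[C]_nu) : Prop :=
  [/\ holomorphic (disc sigma) g,
      forall z, disc sigma z -> cpolydisc rho (g z),
      g 0 = 0 &
      forall z, disc sigma z -> F (0, z, g z) = 0].

End SingularSystem.

Definition phi (R : realType) (nu : nat) (f : Cx R * Cx R -> 'rV[Cx R]_nu)
    (i : nat) (e z : Cx R) : 'rV[Cx R]_nu :=
  (i`!%:R)^-1 *: derive1n i (fun e' => f (e', z)) e.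

(* Main.v *)
(* Write f(e, z) = sum_n a_n(e) z^n.  The equation becomes the recursion
   (n e - J(e)) a_n = [z^n] G(e, z, sum_(k < n) a_k z^k), where J(e) = F_f(e, 0, 0)
   and G = F - J f has no linear term in f at z = 0.  By the hypothesis on the
   eigenvalues the resolvent of J(0) is bounded on the whole infinite sector, and
   hence on a c-neighbourhood of it, for J(e) with e small.  Since n e and n e0
   differ by at most c when |e - e0| < c / n, the recursion defines a_n on the
   disc of radius c / n around every point e0 of the sector.  There
   |a_n| <= del / r^n: the map u |-> sum_n z^n (n e - J(e))^-1 [z^n] G(e, z, u)
   preserves a small ball for the norm (sum_n |n a_n r^n|^2)^(1/2), the L^2 norm
   of z u' on the circle |z| = r, which dominates the sup norm of u.
   Cauchy's inequalities in e then give |a_n^(i) / i!| <= del r^-n (2 n / c)^i, and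
   n^i <= i! 2^(n + i) yields the factor i! after summation over n.

   Contour integrals are replaced by averages over the 2^m-th roots of unity:
   these converge to the Cauchy formula by Goursat's subdivision argument. *)
Require Import Defs.
From HB Require Import structures.
From mathcomp Require Import all_boot all_order all_algebra.
From mathcomp Require Import all_classical all_reals all_analysis.
From mathcomp Require Import perm.
From mathcomp Require Import complex.
From mathcomp Require Import ring lra.

Set Implicit Arguments.
Unset Strict Implicit.
Unset Printing Implicit Defensive.

Import Order.TTheory GRing.Theory Num.Theory.
Import numFieldNormedType.Exports.

Local Open Scope classical_set_scope.
Local Open Scope ring_scope.

(** * Modulus and complex derivatives *)

(** The factor n e gives no decay, since e may be small compared with 1 / n: all that is available
    is a bound on the inverse of n e - J(e) uniform in n. These inverses act as a multiplier on
    Taylor coefficients, and a bounded multiplier preserves L^2 norms on a circle but not sup norms;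
    hence a Hilbert norm. The weight n lets it control the sup norm, because the sum of n^-2 is
    finite, and since G has no linear term in f at z = 0, a ball of small radius del is mapped into
    itself once r is much smaller than del. Invariance of the ball suffices: the coefficient of
    order n + 1 of G depends only on the coefficients of u up to order n, so the bound propagates by
    induction on the truncation degree, and no fixed point has to be constructed.

    At points of the sector the a_n are the Taylor coefficients of f, because every n e - J(e) with
    n > 0 is invertible there. Around such a point f is holomorphic on a disc whose radius depends
    on the point and must not enter the final bound; it only multiplies a remainder that tends to
    0. *)

Section Modulus.
Variable R : realType.
Local Notation C := (Cx R).
Local Notation mod := (@modulus R).
Implicit Types z w : C.

Lemma modulus_ge0 z : 0 <= mod z.
Proof. by rewrite -lecR -normE_modulus normr_ge0. Qed.

Lemma modulus0 : mod 0 = 0.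
Proof. exact: Normc.normc0. Qed.

Lemma modulus1 : mod 1 = 1.
Proof. exact: Normc.normc1. Qed.

Lemma modulusM z w : mod (z * w) = mod z * mod w.
Proof. exact: Normc.normcM. Qed.

Lemma modulusV z : mod z^-1 = (mod z)^-1.
Proof. exact: Normc.normcV. Qed.

Lemma modulusX z n : mod (z ^+ n) = mod z ^+ n.
Proof.
by elim: n => [|n IH]; rewrite ?expr0 ?modulus1// !exprS modulusM IH.
Qed.

Lemma modulusN z : mod (- z) = mod z.
Proof. by apply: complexI; rewrite -!normE_modulus normrN. Qed.

Lemma modulusD z w : mod (z + w) <= mod z + mod w.
Proof. exact: le_normcD. Qed.

Lemma modulusBC z w : mod (z - w) = mod (w - z).
Proof. by rewrite -modulusN opprB. Qed.

Lemma modulusB z w : mod (z - w) <= mod z + mod w.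
Proof. by rewrite (le_trans (modulusD _ _))// modulusN. Qed.

Lemma modulusDB z w : mod z - mod w <= mod (z - w).
Proof. by rewrite lerBlDr (le_trans _ (modulusD _ _))// subrK. Qed.

Lemma modulus_eq0 z : (mod z == 0) = (z == 0).
Proof. by apply/eqP/eqP => [/Normc.eq0_normc //|->]; exact: modulus0. Qed.

Lemma modulus_gt0 z : (0 < mod z) = (z != 0).
Proof. by rewrite lt0r modulus_eq0 modulus_ge0 andbT. Qed.

Lemma modulusR (x : R) : mod (x%:C)%C = `|x|.
Proof. by rewrite /modulus /= expr0n addr0 sqrtr_sqr. Qed.

Lemma modulus_nat n : mod n%:R = n%:R.
Proof.
have -> : n%:R = ((n%:R : R)%:C)%C :> C by rewrite rmorph_nat.
by rewrite modulusR ger0_norm.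
Qed.

Lemma modulus_conj z : mod (z^*)%C = mod z.
Proof. by case: z => a b; rewrite /modulus /= sqrrN. Qed.

Lemma ler_modulus_sum (I : Type) (r : seq I) (P : pred I) (F : I -> C) :
  mod (\sum_(i <- r | P i) F i) <= \sum_(i <- r | P i) mod (F i).
Proof.
elim/big_rec2: _ => [|i x y _ IH]; first by rewrite modulus0.
by apply: le_trans (modulusD _ _) _; rewrite lerD2l.
Qed.

Lemma Re_modulus z : `|complex.Re z| <= mod z.
Proof.
by have := normc_ge_Re z; rewrite normE_modulus lecR.
Qed.

Lemma Im_modulus z : `|complex.Im z| <= mod z.
Proof.
have := Re_modulus (z * 'i%C); rewrite ReiNIm normrN modulusM.
have -> : mod 'i%C = 1 by rewrite /modulus /= expr0n add0r expr1n sqrtr1.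
by rewrite mulr1.
Qed.

Lemma modulus_le_ReIm z : mod z <= `|complex.Re z| + `|complex.Im z|.
Proof.
rewrite [in X in X <= _](complexE z); apply: le_trans (modulusD _ _) _.
rewrite modulusM !modulusR.
have -> : mod 'i%C = 1 by rewrite /modulus /= expr0n add0r expr1n sqrtr1.
by rewrite mul1r.
Qed.

Lemma sqr_modulus z : mod z ^+ 2 = complex.Re z ^+ 2 + complex.Im z ^+ 2.
Proof.
case: z => a b; rewrite /modulus /= sqr_sqrtr // addr_ge0 // sqr_ge0 //.
Qed.

Lemma mulCJ z : z * (z^*)%C = ((mod z ^+ 2)%:C)%C.
Proof. by rewrite -sqr_normc normE_modulus rmorphXn. Qed.

Lemma modulus_ball z w (e : R) : ball z (e%:C)%C w <-> mod (z - w) < e.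
Proof.
by rewrite -ball_normE /ball_ /= normE_modulus ltcR.
Qed.

(** Positive elements of R[i] are real, so the R[i]-valued radii of the topology can be traded for
    real ones. *)
Lemma posC (e : C) : 0 < e -> exists2 e' : R, 0 < e' & e = (e'%:C)%C.
Proof.
move=> e0; exists (complex.Re e).
  by move: e0; rewrite ltcE /= => /andP[].
by case: e e0 => a b; rewrite ltcE /= => /andP[/eqP -> _].
Qed.

Lemma nbhsC_P z (A : set C) :
  nbhs z A <-> exists2 d : R, 0 < d & forall w, mod (w - z) < d -> A w.
Proof.
split=> [/nbhs_ballP[e e0 eA]|[d d0 dA]].
  have [d d0 de] := posC e0; exists d => // w wd.
  by apply: eA; rewrite de modulus_ball modulusBC.
apply/nbhs_ballP; exists (d%:C)%C; first by rewrite /= ltcR.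
by move=> w /modulus_ball wd; apply: dA; rewrite modulusBC.
Qed.

Lemma cvgC_P (T : Type) (F : set_system T) {FF : Filter F} (u : T -> C) (l : C) :
  u @ F --> l <->
  forall e : R, 0 < e -> \forall t \near F, mod (u t - l) <= e.
Proof.
split=> [/cvgrPdist_le H e e0|H].
  have /H : 0 < (e%:C)%C :> C by rewrite ltcR.
  by apply: filterS => t; rewrite normE_modulus lecR modulusBC.
apply/cvgrPdist_le => e /posC[d d0 ->].
by apply: filterS (H _ d0) => t; rewrite normE_modulus lecR modulusBC.
Qed.

Lemma contC_P (g : C -> C) (x : C) : {for x, continuous g} <->
  forall e : R, 0 < e -> exists2 d : R, 0 < d &
    forall y, mod (y - x) < d -> mod (g y - g x) <= e.
Proof.
have P := @cvgC_P _ (nbhs x) _ g (g x).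
split=> [/P H e /H /nbhsC_P[d d0 dA]|H]; first by exists d.
by apply/P => e /H dA; apply/nbhsC_P.
Qed.

Lemma cvg_modulus_le (T : Type) (F : set_system T) {FF : ProperFilter F}
    (u : T -> C) (l : C) (B : R) :
  u @ F --> l -> (\forall t \near F, mod (u t) <= B) -> mod l <= B.
Proof.
move=> /cvgC_P ul uB; rewrite leNgt; apply/negP => Bl.
have e0 : 0 < (mod l - B) / 2 by lra.
have /filter_ex[t [Ht Bt]] : \forall t \near F, mod (u t - l) <= (mod l - B) / 2 /\ mod (u t) <= B.
  by apply: filterS2 (ul _ e0) uB.
by have := modulusDB l (u t); rewrite modulusBC; lra.
Qed.

(** Completeness is inherited from R through the real and imaginary parts. *)
Lemma cauchyC (u : nat -> C) :
  (forall e : R, 0 < e -> exists N, forall m n, (N <= m)%N -> (N <= n)%N ->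
    mod (u m - u n) <= e) -> cvgn u.
Proof.
move=> H.
have aux (p : C -> R) : (forall a b, p (a - b) = p a - p b) ->
    (forall z, `|p z| <= mod z) -> cvgn (p \o u).
  move=> pB pm; apply/cauchy_cvgP/cauchy_exP => e e0.
  have [|N HN] := H (e / 2); first by move: e0; rewrite /=; lra.
  exists (p (u N)); exists N => // n /= Nn; rewrite -ball_normE /ball_ /= -pB.
  by move: e0 (HN _ _ (leqnn N) Nn) (pm (u N - u n)); rewrite /=; lra.
have /cvg_ex[a Ha] : cvgn (@complex.Re R \o u).
  apply: aux; [by move=> [? ?] [? ?]|exact: Re_modulus].
have /cvg_ex[b Hb] : cvgn (@complex.Im R \o u).
  apply: aux; [by move=> [? ?] [? ?]|exact: Im_modulus].
apply/cvg_ex; exists (a +i* b)%C; apply/cvgC_P => e e0.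
have e20 : 0 < e / 2 by lra.
move/cvgrPdist_le : Ha => /(_ _ e20) Ha.
move/cvgrPdist_le : Hb => /(_ _ e20) Hb.
apply: filterS2 Ha Hb => n /= Ha Hb.
apply: le_trans (modulus_le_ReIm _) _.
by move: Ha Hb; case: (u n) => c d /=; rewrite distrC (distrC b); lra.
Qed.

(** Differentiability without a quotient: h = 0 needs no exclusion, and the estimate is directly
    usable with real constants. *)
Definition has_deriv (g : C -> C) (x l : C) :=
  forall e : R, 0 < e -> exists2 d : R, 0 < d &
    forall h, mod h < d -> mod (g (x + h) - g x - h * l) <= e * mod h.

Lemma has_derivP (g : C -> C) (x l : C) :
  is_derive x 1 g l <-> has_deriv g x l.
Proof.
have E h k : h \is a GRing.unit ->
    mod (h^-1 *: ((g \o shift x) (h *: 1) - g x) - k) * mod h =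
    mod (g (x + h) - g x - h * k).
  move=> h0; rewrite -modulusM /=; congr (mod _).
  rewrite /GRing.scale /= mulr1 (addrC h) mulrBl (mulrC _ h) mulrA divrr // mul1r.
  by rewrite (mulrC k).
split=> [[dg <-] e e0|H].
  move: dg => /cvg_ex /= [l' Hl'].
  have -> : 'D_1 g x = l' by apply/cvg_lim.
  have : nbhs (0 : C) (fun h : C => h != 0 ->
      mod (h^-1 *: ((g \o shift x) (h *: 1) - g x) - l') <= e).
    by move/cvgC_P : Hl' => /(_ e e0).
  move=> /nbhsC_P[d d0 dA].
  exists d => // h hd; have [->|h0] := eqVneq h 0.
    by rewrite addr0 subrr mul0r subrr modulus0 mulr0.
  rewrite -E ?unitfE// ler_wpM2r ?modulus_ge0//.
  by apply: dA => //; rewrite subr0.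
suff Hl : (fun h => h^-1 *: ((g \o shift x) (h *: 1) - g x)) @ 0^' --> l.
  by apply: DeriveDef; [apply/cvg_ex; exists l|apply/cvg_lim].
apply/cvgC_P => e e0; have [d d0 dA] := H e e0.
apply/nbhsC_P; exists d => // h; rewrite subr0 => hd h0.
have := dA h hd; rewrite -E ?unitfE// ler_pM2r//.
by rewrite modulus_gt0.
Qed.

Lemma derivable_has (g : C -> C) x : derivable g x 1 <-> exists l, has_deriv g x l.
Proof.
split=> [dg|[l /has_derivP[]//]]; exists ('D_1 g x).
by apply/has_derivP; exact/derivableP.
Qed.

Lemma derive1_has (g : C -> C) x : derivable g x 1 -> has_deriv g x (derive1 g x).
Proof. by move=> dg; apply/has_derivP; rewrite derive1E; exact/derivableP. Qed.

Lemma derivable_cont (g : C -> C) x : derivable g x 1 -> {for x, continuous g}.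
Proof. by move=> /derivable1_diffP/differentiable_continuous. Qed.

End Modulus.

(** * Goursat's lemma *)

Section Goursat.
Variable R : realType.
Local Notation C := (Cx R).
Local Notation mod := (@modulus R).

Definition mid (a b : C) : C := (a + b) / 2.

Lemma mid_dist (a b c : C) : mod (mid a b - c) <= (mod (a - c) + mod (b - c)) / 2.
Proof.
have -> : mid a b - c = ((a - c) + (b - c)) / 2 by rewrite /mid; field.
by rewrite modulusM modulusV modulus_nat ler_wpM2r// modulusD.
Qed.

Lemma midC (a b : C) : mid a b = mid b a.
Proof. by rewrite /mid addrC. Qed.

Lemma mid_subl (a b : C) : mod (mid a b - a) = mod (b - a) / 2.
Proof.
have -> : mid a b - a = (b - a) / 2 by rewrite /mid; field.
by rewrite modulusM modulusV modulus_nat.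
Qed.

(* Trapezoidal sum for the integral of [g] along the segment [a, b], cut into
   [2 ^ k] equal pieces. *)
Fixpoint trap (g : C -> C) (k : nat) (a b : C) : C :=
  if k is k'.+1 then trap g k' a (mid a b) + trap g k' (mid a b) b
  else (b - a) * mid (g a) (g b).

Lemma trapN g k a b : trap g k b a = - trap g k a b.
Proof.
elim: k a b => [|k IH] a b /=; first by rewrite midC -mulNr opprB.
by rewrite (midC b a) (IH _ b) (IH a) opprD addrC.
Qed.

Lemma trapB g h k a b :
  trap (fun z => g z - h z) k a b = trap g k a b - trap h k a b.
Proof.
elim: k a b => [|k IH] a b /=; first by rewrite /mid; field.
by rewrite !IH; ring.
Qed.

(** The trapezoidal rule is exact on affine functions. The right-hand side is a difference of values
    of a primitive, so it cancels around a closed triangle. *)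
Lemma trap_affine (p q : C) k a b :
  trap (fun z => p + q * z) k a b = p * (b - a) + q * ((b ^+ 2 - a ^+ 2) / 2).
Proof.
elim: k a b => [|k IH] a b /=; first by rewrite /mid; field.
by rewrite !IH /mid; field.
Qed.

(** Stability under midpoints is all the convexity that dyadic subdivision uses. *)
Definition midconvex (P : C -> Prop) := forall a b, P a -> P b -> P (mid a b).

Lemma trap_bound (P : C -> Prop) g (M : R) k a b : midconvex P -> P a -> P b ->
  (forall z, P z -> mod (g z) <= M) -> mod (trap g k a b) <= mod (b - a) * M.
Proof.
move=> Pc + + gM; elim: k a b => [|k IH] a b Pa Pb /=.
  rewrite modulusM ler_wpM2l ?modulus_ge0// -[mid _ _]subr0.
  apply: le_trans (mid_dist _ _ _) _.
  by rewrite !subr0; have := gM a Pa; have := gM b Pb; lra.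
have Pm := Pc a b Pa Pb; apply: le_trans (modulusD _ _) _.
apply: le_trans (lerD (IH _ _ Pa Pm) (IH _ _ Pm Pb)) _.
by rewrite mid_subl (modulusBC b (mid a b)) (midC a) mid_subl (modulusBC a b); lra.
Qed.

Lemma midconvex_ball (p : C) (d : R) : midconvex (fun z => mod (z - p) <= d).
Proof. by move=> a b Pa Pb; have := mid_dist a b p; lra. Qed.

Lemma midconvexI P Q : midconvex P -> midconvex Q ->
  midconvex (fun z => P z /\ Q z).
Proof. by move=> Pc Qc a b [Pa Qa] [Pb Qb]; split; [exact: Pc|exact: Qc]. Qed.

Definition tri := (C * C * C)%type.

Definition dtrap g k (t : tri) : C :=
  trap g k t.1.1 t.1.2 + trap g k t.1.2 t.2 + trap g k t.2 t.1.1.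

Definition child (t : tri) : seq tri :=
  let: (a, b, c) := t in
  [:: (a, mid a b, mid c a); (mid a b, b, mid b c); (mid b c, c, mid c a);
      (mid a b, mid b c, mid c a)].

(** Each inner edge is run through twice in opposite directions and cancels; each outer edge is cut
    at its midpoint, which accounts for the drop from [k.+1] to [k]. *)
Lemma dtrapS g k t : dtrap g k.+1 t = \sum_(s <- child t) dtrap g k s.
Proof.
case: t => [[a b] c]; rewrite /= !big_cons big_nil /dtrap /=.
rewrite (trapN _ _ (mid a b) (mid c a)) (trapN _ _ (mid a b) (mid b c)).
by rewrite (trapN _ _ (mid b c) (mid c a)); ring.
Qed.

Definition tri_in (P : C -> Prop) (t : tri) := [/\ P t.1.1, P t.1.2 & P t.2].

Definition tri_diam (d : R) (t : tri) :=
  [/\ mod (t.1.2 - t.1.1) <= d, mod (t.2 - t.1.2) <= d & mod (t.1.1 - t.2) <= d].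

Definition bad g (eta : R) (t : tri) :=
  forall K, exists2 k, (K <= k)%N & eta < mod (dtrap g k t).

(** If all four children were eventually bounded by [eta / 4], their sum would eventually be bounded
    by [eta]. *)
Lemma bad_child g eta t : bad g eta t ->
  exists2 s, s \in child t & bad g (eta / 4) s.
Proof.
move=> tbad; apply: contrapT => H.
have {}H s : s \in child t ->
    exists K, forall k, (K <= k)%N -> mod (dtrap g k s) <= eta / 4.
  move=> st; apply: contrapT => H'; apply: H; exists s => // K.
  apply: contrapT => H''; apply: H'; exists K => k Kk; rewrite leNgt.
  by apply/negP => lt; apply: H''; exists k.
have [K HK] : exists K, forall s, s \in child t ->
    forall k, (K <= k)%N -> mod (dtrap g k s) <= eta / 4.
  elim: (child t) H => [|s l IH] H; first by exists 0%N.
  have [|K1 H1] := IH; first by move=> s' s'l; apply: H; rewrite inE s'l orbT.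
  have [K2 H2] := H s (mem_head _ _); exists (maxn K1 K2) => s'.
  rewrite inE => /orP[/eqP -> k|/H1 H3 k]; rewrite geq_max => /andP[k1 k2].
    exact: H2.
  exact: H3.
have [[//|k]] := tbad K.+1; rewrite ltnS => Kk; rewrite dtrapS ltNge => /negP; apply.
apply: le_trans (ler_modulus_sum _ _ _) _.
have -> : eta = \sum_(s <- child t) eta / 4.
  by case: t {tbad H HK} => [[a b] c]; rewrite /= !big_cons big_nil; lra.
by rewrite big_seq [leRHS]big_seq; apply: ler_sum => s st; exact: HK.
Qed.

Lemma child_in P t s : midconvex P -> tri_in P t -> s \in child t -> tri_in P s.
Proof.
case: t => [[a b] c] Pc [/= Pa Pb Pd].
by rewrite !inE => /or4P[] /eqP ->; split => //=; exact: Pc.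
Qed.

Lemma child_diam d t s : tri_diam d t -> s \in child t ->
  tri_diam (d / 2) s /\ mod (s.1.1 - t.1.1) <= d.
Proof.
case: t => [[a b] c] [/= ab bc ca].
have d0 : 0 <= d by apply: le_trans ab; exact: modulus_ge0.
have H x y u : mod (x - y) <= d -> u = (x - y) / 2 -> mod u <= d / 2.
  by move=> xy ->; rewrite modulusM modulusV modulus_nat; lra.
have [ba cb ac] : [/\ mod (a - b) <= d, mod (b - c) <= d & mod (c - a) <= d].
  by rewrite (modulusBC a b) (modulusBC b c) (modulusBC c a).
have := mid_dist b c a => bca.
by rewrite !inE => /or4P[] /eqP -> /=; split;
  rewrite ?subrr ?modulus0 ?mid_subl//; try lra; split => /=;
  first [apply: (H _ _ _ ab); rewrite /mid; field
        |apply: (H _ _ _ ba); rewrite /mid; field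
        |apply: (H _ _ _ bc); rewrite /mid; field
        |apply: (H _ _ _ cb); rewrite /mid; field
        |apply: (H _ _ _ ca); rewrite /mid; field
        |apply: (H _ _ _ ac); rewrite /mid; field].
Qed.

(** Goursat's argument with the sequence of trapezoidal sums in place of the integral. A bad
    triangle produces nested bad triangles of diameter d / 2^n shrinking to a point p. Near p, g
    differs from its affine part, whose sum around a triangle vanishes, by little compared with the
    diameter, and the sum is then too small for badness. *)
Lemma goursat (P : C -> Prop) (g : C -> C) (t : tri) : midconvex P ->
  (forall u l, u @ \oo --> l -> (forall n, P (u n)) -> P l) ->
  (forall z, P z -> derivable g z 1) -> tri_in P t ->
  dtrap g k t @[k --> \oo] --> (0 : C).
Proof.
move=> Pc Pcl Pg Pt; apply/cvgC_P => eta eta0.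
suff : ~ bad g eta t.
  move=> nbad; apply: contrapT => H; apply: nbad => K; apply: contrapT => H'.
  apply: H; exists K => // k /= Kk; rewrite subr0 leNgt; apply/negP => lt.
  by apply: H'; exists k.
move=> tbad.
pose d := mod (t.1.2 - t.1.1) + mod (t.2 - t.1.2) + mod (t.1.1 - t.2) + 1.
have [g1 g2 g3] : [/\ 0 <= mod (t.1.2 - t.1.1), 0 <= mod (t.2 - t.1.2) &
    0 <= mod (t.1.1 - t.2)] by split; exact: modulus_ge0.
have d0 : 0 < d by rewrite /d; lra.
have td : tri_diam d t by rewrite /d; split; lra.
(* The threshold travels with the triangle, so that the choice function is total; on a pair that is
   not bad its value is irrelevant. *)
have /choice[nxt Hnxt] : forall sn : tri * R, exists s, bad g sn.2 sn.1 ->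
    s \in child sn.1 /\ bad g (sn.2 / 4) s.
  move=> [s e]; have [/bad_child[s' ? ?]|nb] := pselect (bad g e s).
    by exists s'.
  by exists s.
pose fix T n := if n is n'.+1 then nxt (T n', eta / 4 ^+ n') else t.
have Tbad n : bad g (eta / 4 ^+ n) (T n).
  elim: n => [|n IH]; first by rewrite expr0 divr1.
  have [_] := Hnxt (_, _) IH; suff -> : eta / 4 ^+ n.+1 = eta / 4 ^+ n / 4 by [].
  by rewrite exprSr invfM mulrA.
have Tch n : T n.+1 \in child (T n) by have [] := Hnxt (_, _) (Tbad n).
have TP n : tri_in P (T n) by elim: n => [//|n IH]; exact: child_in (Tch n).
have Td n : tri_diam (d / 2 ^+ n) (T n).
  elim: n => [|n IH]; first by rewrite expr0 divr1.
  have [] := child_diam IH (Tch n).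
  suff -> : d / 2 ^+ n.+1 = d / 2 ^+ n / 2 by [].
  by rewrite exprSr invfM mulrA.
pose a n := (T n).1.1.
have aS n : mod (a n.+1 - a n) <= d / 2 ^+ n.
  by have [] := child_diam (Td n) (Tch n).
(* The partial geometric sum is kept in closed form so that the induction on k closes. *)
have aD n k : mod (a (n + k)%N - a n) <= 2 * (d / 2 ^+ n) * (1 - (2 ^+ k)^-1).
  elim: k => [|k IH]; first by rewrite addn0 subrr modulus0 expr0 invr1; lra.
  have -> : a (n + k.+1)%N - a n = (a (n + k).+1 - a (n + k)%N) + (a (n + k)%N - a n).
    by rewrite addnS; ring.
  apply: le_trans (modulusD _ _) _; apply: le_trans (lerD (aS _) IH) _.
  rewrite exprD exprS !invfM; set x := (2 ^+ n)^-1; set y := (2 ^+ k)^-1.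
  lra.
have x0 n : 0 < (2 ^+ n)^-1 :> R by rewrite invr_gt0 exprn_gt0.
have aD' n k : (n <= k)%N -> mod (a k - a n) <= 2 * (d / 2 ^+ n).
  move=> /subnKC <-; apply: le_trans (aD _ _) _.
  have : 0 < d * (2 ^+ n)^-1 * (2 ^+ (k - n))^-1 by rewrite !mulr_gt0.
  by lra.
have small e : 0 < e -> exists n, 4 * (d / 2 ^+ n) < e.
  move=> e0; have : (2 ^- n : R) @[n --> \oo] --> 0.
    by under eq_fun do rewrite -exprVn; apply: cvg_expr; rewrite ger0_norm; lra.
  have e1 : 0 < e / (8 * d) by rewrite divr_gt0; lra.
  move=> /cvgrPdist_le /(_ _ e1)[N _ HN]; exists N.
  have := HN N (leqnn N); rewrite /= sub0r normrN ger0_norm; last exact: ltW.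
  by rewrite ler_pdivlMr; [move=> H; nra|lra].
have /cvg_ex[p ap] : cvgn a.
  apply: cauchyC => e e0; have [n Hn] := small _ e0; exists n => k l nk nl.
  have -> : a k - a l = (a k - a n) - (a l - a n) by ring.
  apply: le_trans (modulusB _ _) _.
  by have := aD' _ _ nk; have := aD' _ _ nl; lra.
have pP : P p by apply: Pcl ap _ => n; have [] := TP n.
have pa n : mod (p - a n) <= 2 * (d / 2 ^+ n).
  apply: (@cvg_modulus_le _ _ \oo _ (fun k => a k - a n)).
    by apply: cvgB ap _; exact: cvg_cst.
  by exists n => // k /= nk; exact: aD'.
have [l Hl] := (derivable_has _ _).1 (Pg _ pP).
(* With dn = d / 2^n, three edges of length at most dn and an error e * 3 dn on each give 9 e dn^2,
   and 9 / 10 of eta / 4^n is below the threshold. *)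
pose e := eta / (10 * d ^+ 2).
have e0 : 0 < e by rewrite /e divr_gt0// mulr_gt0// exprn_gt0.
have [del del0 Hdel] := Hl e e0; have [n Hn] := small _ del0.
pose dn := d / 2 ^+ n; have dn0 : 0 < dn by rewrite /dn mulr_gt0.
have [k _] := Tbad n 0%N; rewrite ltNge => /negP; apply.
have [[P1 P2 P3] [D1 D2 D3]] := (TP n, Td n).
pose Q z := mod (z - p) <= 3 * dn.
have Qc : midconvex Q by exact: midconvex_ball.
have Q1 : Q (T n).1.1 by have := pa n; rewrite /Q /a modulusBC -/dn; lra.
have Qd z : mod (z - a n) <= dn -> Q z.
  move=> zn; rewrite /Q; have -> : z - p = (z - a n) - (p - a n) by ring.
  by apply: le_trans (modulusB _ _) _; have := pa n; rewrite -/dn; lra.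
have Q2 : Q (T n).1.2 by exact: Qd.
have Q3 : Q (T n).2 by apply: Qd; rewrite modulusBC.
pose h z := (g p - p * l) + l * z.
have Qe z : Q z -> mod (g z - h z) <= e * (3 * dn).
  rewrite /Q => Qz; have zd : mod (z - p) < del by move: Hn; rewrite -/dn; lra.
  have := Hdel _ zd; have -> : p + (z - p) = z by ring.
  have -> : g z - g p - (z - p) * l = g z - h z by rewrite /h; ring.
  by move=> H; apply: le_trans H _; rewrite ler_wpM2l// ltW.
(* The affine part [h] contributes nothing around the triangle. *)
have -> : dtrap g k (T n) = dtrap (fun z => g z - h z) k (T n).
  by rewrite /dtrap !trapB /h !trap_affine; field.
rewrite /dtrap; apply: le_trans (modulusD _ _) _.
apply: le_trans (lerD (modulusD _ _) (lexx _)) _.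
have B1 := trap_bound k Qc Q1 Q2 Qe; have B2 := trap_bound k Qc Q2 Q3 Qe.
have B3 := trap_bound k Qc Q3 Q1 Qe.
have E3 : 0 <= e * (3 * dn) by apply: mulr_ge0; [exact: ltW|rewrite mulr_ge0 ?ltW].
have C1 := ler_wpM2r E3 D1; have C2 := ler_wpM2r E3 D2.
have C3 := ler_wpM2r E3 D3.
apply: (@le_trans _ _ (9 * (e * dn ^+ 2))).
  by move: B1 B2 B3 C1 C2 C3; rewrite -/dn; lra.
have -> : e * dn ^+ 2 = eta / 10 / 4 ^+ n.
  have -> : 4 ^+ n = (2 ^+ n) ^+ 2 :> R.
    by rewrite -exprM mulnC exprM; congr (_ ^+ n); ring.
  by rewrite /e /dn; field; rewrite ?expf_neq0 ?lt0r_neq0.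
have : 0 < eta / 4 ^+ n by apply: divr_gt0.
by lra.
Qed.

End Goursat.

(** * Averages over roots of unity *)

Section Circle.
Variable R : realType.
Local Notation C := (Cx R).
Local Notation mod := (@modulus R).

Definition psqrt (z : C) : C :=
  let s := sqrtC z in if 0 <= complex.Re s then s else - s.

Lemma psqrtK z : psqrt z ^+ 2 = z.
Proof. by rewrite /psqrt; case: ifP => _; rewrite ?sqrrN sqrtCK. Qed.

Lemma Re_psqrt z : 0 <= complex.Re (psqrt z).
Proof.
rewrite /psqrt; case: ifP => // /negbT; rewrite -ltNge.
by case: (sqrtC z) => a b /= /ltW; rewrite oppr_ge0.
Qed.

(* Primitive roots of unity chosen so that each is the square of the next, with
   nonnegative real part, which makes them converge to [1]. *)
Fixpoint dyroot (m : nat) : C :=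
  if m is m'.+1 then psqrt (dyroot m') else -1.

Lemma dyrootX m : dyroot m ^+ (2 ^ m) = -1.
Proof.
by elim: m => [|m IH] /=; rewrite ?expr1// expnS exprM psqrtK.
Qed.

(** The order divides 2^(m+1) but not 2^m, since the power 2^m is -1. *)
Lemma dyroot_prim m : (2 ^ m.+1).-primitive_root (dyroot m).
Proof.
have H1 : dyroot m ^+ (2 ^ m.+1) = 1 by rewrite expnSr exprM dyrootX sqrrN expr1n.
have [|k kp kd] := prim_order_exists _ H1; first by rewrite expn_gt0.
have : ~~ (k %| 2 ^ m)%N.
  apply/negP => kd'; have := dyrootX m; move/eqP: (prim_expr_mod kp (2 ^ m)).
  rewrite (eqP kd') expr0 => /eqP <- /eqP.
  by rewrite -subr_eq0 opprK (pnatr_eq0 _ 2).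
have [j jm Ek] : exists2 j, (j <= m.+1)%N & k = (2 ^ j)%N.
  by move/dvdn_pfactor : kd => /(_ isT)[j jm ->]; exists j.
move: kp; rewrite Ek; move: jm; rewrite leq_eqVlt => /orP[/eqP -> //|].
by rewrite ltnS => jm; rewrite dvdn_exp2l.
Qed.

Lemma dyroot_mod m : mod (dyroot m) = 1.
Proof.
have /eqP := congr1 mod (prim_expr_order (dyroot_prim m)).
rewrite modulusX modulus1 pexpr_eq1 ?modulus_ge0 ?expn_gt0//.
  by move=> /eqP.
Qed.

Lemma dyrootX_mod m k : mod (dyroot m ^+ k) = 1.
Proof. by rewrite modulusX dyroot_mod expr1n. Qed.

(** Write w for the next root: w^2 - 1 = (w - 1)(w + 1), and |w + 1|^2 = 2 + 2 Re w is at least 2.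
    Hence the squared distance to 1 is at least halved at each level, from 4 at the start. *)
Lemma dyroot_dist m : mod (dyroot m - 1) ^+ 2 <= 4 / 2 ^+ m.
Proof.
elim: m => [|m IH].
  have -> : dyroot 0 - 1 = - 2%:R by rewrite /=; ring.
  by rewrite expr0 divr1 modulusN modulus_nat; lra.
have E : mod (dyroot m - 1) = mod (dyroot m.+1 - 1) * mod (dyroot m.+1 + 1).
  by rewrite -modulusM -[dyroot m]psqrtK /=; congr (mod _); ring.
have : 2 <= mod (dyroot m.+1 + 1) ^+ 2.
  have := Re_psqrt (dyroot m); rewrite -/(dyroot m.+1) => H0.
  have := sqr_modulus (dyroot m.+1); rewrite dyroot_mod sqr_modulus.
  by case: (dyroot m.+1) H0 => x y /=; nra.
move: IH; rewrite E [2 ^+ m.+1]exprSr invfM mulrA exprMn.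
set u := mod _ ^+ 2; set v := mod _ ^+ 2; have v0 : 0 <= v by exact: sqr_ge0.
by nra.
Qed.

Lemma dyroot_cvg (e : R) : 0 < e -> \forall m \near \oo, mod (dyroot m - 1) <= e.
Proof.
move=> e0; have : (4 / 2 ^+ m : R) @[m --> \oo] --> (4 * 0 : R).
  apply: cvgM; first exact: cvg_cst.
  under eq_fun do rewrite -exprVn.
  by apply: cvg_expr; rewrite ger0_norm; lra.
have e2 : 0 < e ^+ 2 by rewrite exprn_gt0.
move=> /cvgrPdist_le /(_ _ e2); rewrite mulr0; apply: filterS => m /=.
rewrite sub0r normrN ger0_norm ?divr_ge0 ?exprn_ge0// => H.
rewrite -(@ler_pXn2r _ 2)// ?nnegrE ?modulus_ge0 ?(ltW e0)//.
exact: le_trans (dyroot_dist m) _.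
Qed.

Definition dysize m := (2 ^ m.+1)%N.

Lemma dysize_gt m : (m < dysize m)%N.
Proof. by rewrite /dysize (leq_trans (ltn_expl m (ltnSn 1)))// leq_exp2l. Qed.

Lemma dysize_gt0 m : (0 < dysize m)%N.
Proof. by rewrite expn_gt0. Qed.

(** Discrete stand-in for the mean of h over the unit circle, that is for the contour integral of
    h(u) / u divided by 2 pi i. *)
Definition avg m (h : C -> C) : C :=
  (dysize m)%:R^-1 * \sum_(k < dysize m) h (dyroot m ^+ k).

Lemma avgD m h1 h2 : avg m (fun u => h1 u + h2 u) = avg m h1 + avg m h2.
Proof. by rewrite /avg big_split mulrDr. Qed.

Lemma avgB m h1 h2 : avg m (fun u => h1 u - h2 u) = avg m h1 - avg m h2.
Proof. by rewrite /avg sumrB mulrBr. Qed.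

Lemma avgZ m c h : avg m (fun u => c * h u) = c * avg m h.
Proof. by rewrite /avg -mulr_sumr mulrCA. Qed.

Lemma avg_sum m n (h : 'I_n -> C -> C) :
  avg m (fun u => \sum_(i < n) h i u) = \sum_(i < n) avg m (h i).
Proof. by rewrite /avg exchange_big /= mulr_sumr. Qed.

Lemma avg_ext m h1 h2 : (forall u, mod u = 1 -> h1 u = h2 u) -> avg m h1 = avg m h2.
Proof.
by move=> H; rewrite /avg; congr (_ * _); apply: eq_bigr => k _; rewrite H// dyrootX_mod.
Qed.

Lemma dysize_neq0 m : (dysize m)%:R != 0 :> C.
Proof. by rewrite pnatr_eq0 -lt0n dysize_gt0. Qed.

Lemma avg_cst m c : avg m (fun=> c) = c.
Proof.
by rewrite /avg sumr_const card_ord -[c *+ _]mulr_natl mulKf ?dysize_neq0.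
Qed.

Lemma avg_le m h (B : R) : (forall u, mod u = 1 -> mod (h u) <= B) ->
  mod (avg m h) <= B.
Proof.
move=> H; rewrite modulusM modulusV modulus_nat.
rewrite ler_pdivrMl ?ltr0n ?dysize_gt0//.
apply: le_trans (ler_modulus_sum _ _ _) _.
have -> : (dysize m)%:R * B = \sum_(i < dysize m) B by rewrite sumr_const card_ord mulr_natl.
by apply: ler_sum => i _; apply: H; exact: dyrootX_mod.
Qed.

Lemma sum_root_eq0 n (y : C) : y ^+ n = 1 -> y != 1 -> \sum_(k < n) y ^+ k = 0.
Proof.
move=> yn y1; have := subrX1 y n; rewrite yn subrr => /esym/eqP.
by rewrite mulf_eq0 subr_eq0 (negbTE y1) => /eqP.
Qed.

Lemma avg_exp m j : (0 < j < dysize m)%N -> avg m (fun u => u ^+ j) = 0.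
Proof.
move=> /andP[j0 jN]; rewrite /avg.
under eq_bigr do rewrite exprAC.
rewrite sum_root_eq0 ?mulr0//.
  by rewrite exprAC (prim_expr_order (dyroot_prim m)) expr1n.
by rewrite -(prim_order_dvd (dyroot_prim m)) gtnNdvd.
Qed.

Lemma avg_expV m j : (0 < j < dysize m)%N -> avg m (fun u => u ^- j) = 0.
Proof.
move=> /andP[j0 jN]; rewrite /avg.
under eq_bigr do rewrite exprAC -exprVn.
rewrite sum_root_eq0 ?mulr0//.
  by rewrite exprVn exprAC (prim_expr_order (dyroot_prim m)) expr1n invr1.
by rewrite invr_eq1 -(prim_order_dvd (dyroot_prim m)) gtnNdvd.
Qed.

Lemma geom_rem (y : C) L : y != 1 ->
  (1 - y)^-1 = \sum_(j < L) y ^+ j + y ^+ L / (1 - y).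
Proof.
move=> y1; have y1' : 1 - y != 0 by rewrite subr_eq0 eq_sym.
have -> : \sum_(j < L) y ^+ j = (1 - y ^+ L) / (1 - y).
  by rewrite -[1 - y ^+ L]opprB subrX1 -opprB; field.
by field.
Qed.

Lemma modulus_1B (y : C) : 1 - mod y <= mod (1 - y).
Proof. by have := modulusDB 1 y; rewrite modulus1. Qed.

(** Cauchy's formula for the constant 1. In the geometric expansion the powers u^-j with 0 < j <= m
    average to exactly 0, because m is below the number of nodes; only a remainder of order
    |x|^(m+1) survives. *)
Lemma avg_geom (x : C) : mod x < 1 ->
  avg m (fun u => (1 - x / u)^-1) @[m --> \oo] --> (1 : C).
Proof.
move=> x1; apply/cvgC_P => e e0.
have x0 := modulus_ge0 x.
have B0 : 0 < e * (1 - mod x) by rewrite mulr_gt0// subr_gt0.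
have : (mod x ^+ m) @[m --> \oo] --> (0 : R) by apply: cvg_expr; rewrite ger0_norm.
move=> /cvgrPdist_le /(_ _ B0); apply: filterS => m /=.
rewrite sub0r normrN ger0_norm ?exprn_ge0// => Hm.
have E u : mod u = 1 -> (1 - x / u)^-1 - 1 =
    \sum_(j < m) x ^+ j.+1 * u ^- j.+1 + x ^+ m.+1 * (u ^- m.+1 * (1 - x / u)^-1).
  move=> u1; have u0 : u != 0 by rewrite -modulus_gt0 u1.
  have xu1 : x / u != 1.
    by apply/eqP => /(congr1 mod); rewrite modulusM modulusV u1 invr1 modulus1; lra.
  rewrite {1}(geom_rem m.+1 xu1) big_ord_recl expr0 -!addrA addrC -!addrA addNr addr0.
  rewrite expr_div_n mulrA; congr (_ + _); apply: eq_bigr => j _.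
  by rewrite -expr_div_n.
have -> : avg m (fun u => (1 - x / u)^-1) - 1 =
    avg m (fun u => (1 - x / u)^-1 - 1) by rewrite avgB avg_cst.
rewrite (avg_ext _ E) avgD avg_sum big1 ?add0r; last first.
  move=> j _; rewrite avgZ avg_expV ?mulr0//=.
  by rewrite (leq_ltn_trans _ (dysize_gt m)).
rewrite avgZ modulusM modulusX exprS.
apply: (@le_trans _ _ (mod x * mod x ^+ m * (1 - mod x)^-1)).
  apply: ler_wpM2l; first by rewrite mulr_ge0// exprn_ge0.
  apply: avg_le => u u1; rewrite modulusM modulusV modulusX u1 expr1n invr1 mul1r.
  rewrite modulusV lef_pV2 ?posrE ?subr_gt0//; last first.
    apply: lt_le_trans (modulus_1B _).
    by rewrite modulusM modulusV u1 invr1 mulr1 subr_gt0.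
  apply: le_trans _ (modulus_1B _).
  by rewrite modulusM modulusV u1 invr1 mulr1.
rewrite ler_pdivrMr ?subr_gt0//; apply: le_trans _ Hm.
by rewrite ler_piMl// ?exprn_ge0// ltW.
Qed.

Lemma closedC_P (A : set C) :
  (forall z, ~ A z -> exists2 d : R, 0 < d & forall w, mod (w - z) < d -> ~ A w) ->
  closed A.
Proof.
move=> H; rewrite -openC openE => z /H[d d0 Hd].
by apply/nbhsC_P; exists d.
Qed.

Lemma compact_cdisc (r : R) : compact (@cdisc R r).
Proof.
pose sq : set C := (fun p : R * R => (p.1 +i* p.2)%C : C) @` (`[- r, r] `*` `[- r, r]).
have sqc : compact sq.
  apply: continuous_compact; last by apply: compact_setX; exact: segment_compact.
  apply: continuous_subspaceT => -[x y]; apply/cvgC_P => e e0.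
  have e2 : 0 < e / 2 by lra.
  have [X Y] : (\forall p \near (x, y), `|x - p.1| <= e / 2) /\
      (\forall p \near (x, y), `|y - p.2| <= e / 2).
    split.
      have /cvgrPdist_le /(_ _ e2) : fst p @[p --> (x, y)] --> x by exact: cvg_fst.
      by [].
    have /cvgrPdist_le /(_ _ e2) : snd p @[p --> (x, y)] --> y by exact: cvg_snd.
    by [].
  apply: filterS2 X Y => -[p1 p2] X Y.
  apply: (le_trans (modulus_le_ReIm _)); move: X Y => /=.
  by rewrite distrC (distrC y); lra.
have -> : cdisc r = sq `&` @cdisc R r.
  apply/seteqP; split => [z zr|z []//]; split => //.
  have [zR zI] := (Re_modulus z, Im_modulus z).
  move: zr; rewrite /cdisc /= => zr.
  exists (complex.Re z, complex.Im z); last by case: (z).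
  by split => /=; rewrite in_itv /= -ler_norml; lra.
apply: compact_closedI => //; apply: closedC_P => z /= /negP; rewrite -ltNge => rz.
exists (mod z - r) => [|w wz]; first by rewrite subr_gt0.
by apply/negP; rewrite -ltNge; have := modulusDB z w; rewrite modulusBC; lra.
Qed.

(** Only [z] has to lie in [K]. This matters because [K] will be a disc with a hole, and chords
    between its points may leave it. *)
Lemma uniform_cont (K : set C) (q : C -> C) (e : R) : compact K ->
  (forall z, K z -> {for z, continuous q}) -> 0 < e ->
  exists2 d : R, 0 < d & forall z w, K z -> mod (w - z) < d -> mod (q w - q z) <= e.
Proof.
move=> /compact_near_coveringP Kc qc e0.
have e2 : 0 < e / 2 by lra.
(* A near covering along radii tending to 0 from the right replaces a Lebesgue number. *)
have := Kc R (0^'+) (fun d z => forall w, mod (w - z) < d -> mod (q w - q z) <= e)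
  (at_right_proper_filter 0).
case=> [z Kz|d /= d0 Hd].
  have [d d0 Hd] := (contC_P _ _).1 (qc z Kz) _ e2.
  exists ([set w | mod (w - z) < d / 2], [set x : R | x <= d / 2]) => /=.
    split; first by apply/nbhsC_P; exists (d / 2) => //; lra.
    by apply: nbhs_right_le; lra.
  move=> [z' x] /= [z'z xd] w wz'.
  have H1 := Hd z'; have H2 := Hd w.
  have -> : q w - q z' = (q w - q z) - (q z' - q z) by ring.
  apply: le_trans (modulusB _ _) _.
  have : mod (w - z) < d.
    have -> : w - z = (w - z') + (z' - z) by ring.
    by apply: le_lt_trans (modulusD _ _) _; lra.
  by move=> /H2; have : mod (z' - z) < d by [lra]; move=> /H1; lra.
exists (d / 2); first by lra.
move=> z w Kz wz; apply: (Hd (d / 2)) => //; last by lra.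
rewrite /ball /= sub0r normrN gtr0_norm; lra.
Qed.

End Circle.

(** * Cauchy's formula *)

Section Cauchy.
Variable R : realType.
Local Notation C := (Cx R).
Local Notation mod := (@modulus R).

Lemma ReM_conj_le (z w : C) : `|complex.Re (z * (w^*)%C)| <= mod z * mod w.
Proof. by rewrite -(modulus_conj w) -modulusM; exact: Re_modulus. Qed.

Lemma ReM_conj_self (w : C) : complex.Re (w * (w^*)%C) = mod w ^+ 2.
Proof. by rewrite mulCJ. Qed.

Lemma cvgC_sum (T : Type) (F : set_system T) {FF : Filter F} n
    (h : 'I_n -> T -> C) (l : 'I_n -> C) : (forall i, h i @ F --> l i) ->
  (fun x => \sum_(i < n) h i x) @ F --> \sum_(i < n) l i.
Proof.
elim: n h l => [|n IH] h l hl.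
  rewrite big_ord0; under eq_fun do rewrite big_ord0; exact: cvg_cst.
rewrite big_ord_recl; under eq_fun do rewrite big_ord_recl.
by apply: cvgD => //; exact: IH.
Qed.

(** Part of a disc cut off by a half-plane with normal direction w. It is convex and, for c > 0 and
    w nonzero, keeps away from a, so that Goursat's lemma applies there to g(z) / (z - a). *)
Definition slab (rho c : R) (a w : C) (z : C) : Prop :=
  mod z <= rho /\ c <= complex.Re ((z - a) * (w^*)%C).

Lemma slab_midconvex rho c a w : midconvex (slab rho c a w).
Proof.
apply: midconvexI.
  by move=> x y; have := @midconvex_ball R 0 rho x y; rewrite !subr0.
move=> x y xc yc; have -> : (mid x y - a) * (w^*)%C =
   mid ((x - a) * (w^*)%C) ((y - a) * (w^*)%C) by rewrite /mid; field.
set u := (x - a) * _ in xc *; set v := (y - a) * _ in yc *.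
have -> : complex.Re (mid u v) = (complex.Re u + complex.Re v) / 2.
  have -> : mid u v = (u + v) * ((2^-1 : R)%:C)%C.
    by rewrite /mid fmorphV rmorph_nat.
  by case: u {xc} => p q; case: v {yc} => p' q' /=; lra.
lra.
Qed.

Lemma slab_closed rho c a w (u : nat -> C) l :
  u @ \oo --> l -> (forall n, slab rho c a w (u n)) -> slab rho c a w l.
Proof.
move=> ul Hu; split.
  by apply: cvg_modulus_le ul _; near=> n; have [] := Hu n.
rewrite leNgt; apply/negP => lc.
set Rl := complex.Re _ in lc.
have w0 := modulus_ge0 w.
have e0 : 0 < (c - Rl) / (2 * (mod w + 1)) by rewrite divr_gt0//; lra.
move/cvgC_P : ul => /(_ _ e0)/filter_ex[n Hn].
have [_ cu] := Hu n; have := ReM_conj_le (u n - l) w.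
have -> : complex.Re ((u n - l) * (w^*)%C) =
    complex.Re ((u n - a) * (w^*)%C) - Rl.
  rewrite /Rl; have -> : (u n - l) * (w^*)%C =
    (u n - a) * (w^*)%C - (l - a) * (w^*)%C by ring.
  by case: (_ * _) => ? ?; case: (_ * _).
move: Hn; rewrite ler_pdivlMr; last by lra.
set m := mod _ => Hn; have m0 : 0 <= m by exact: modulus_ge0.
by rewrite ger0_norm; nra.
Unshelve. all: by end_near. Qed.

Lemma slab_dist rho c a w z : 0 < mod w -> slab rho c a w z -> c / mod w <= mod (z - a).
Proof.
move=> w0 [_ cz]; rewrite ler_pdivrMr//; apply: le_trans cz _.
by apply: le_trans (ReM_conj_le _ _); exact: ler_norm.
Qed.

Section CauchyFormula.
Variables (g : C -> C) (rho : R) (a : C).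
Hypotheses (rho0 : 0 < rho) (arho : mod a < rho).
Hypothesis (dg : forall z, mod z <= rho -> derivable g z 1).

Let q (z : C) : C := g z / (z - a).
Let dq z : mod z <= rho -> z != a -> derivable q z 1.
Proof.
move=> zr za; apply: derivableM; first exact: dg.
apply: derivableV; first by rewrite subr_eq0.
by apply: derivableB; [exact: derivable_id|exact: derivable_cst].
Qed.

Let rhoC : C := (rho%:C)%C.

Let rhoCmod (u : C) : mod u = 1 -> mod (rhoC * u) = rho.
Proof. by move=> u1; rewrite modulusM u1 mulr1 modulusR gtr0_norm. Qed.

Let gapP : exists2 D, 0 < D & forall u, mod u = 1 -> D <= mod (rhoC * u - a).
Proof.
exists (rho - mod a); first by rewrite subr_gt0.
by move=> u u1; apply: le_trans (modulusDB _ _); rewrite rhoCmod.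
Qed.

(** The polygon with vertices z_k on the circle is contracted towards a by the factor tau. Each
    quadrilateral z_k, z_(k+1), p_(k+1), p_k lies in a slab and splits into two triangles, to which
    Goursat's lemma applies; the edges from z_k to p_k cancel around the circle. What remains is to
    compare trapezoidal sums with the averages, by uniform continuity. *)
Lemma cauchy_homotopy (tau eta : R) : 0 < tau -> tau < 1 -> 0 < eta ->
  \forall m \near \oo,
  mod (avg m (fun u => g (rhoC * u) * (rhoC * u) / (rhoC * u - a)) -
       avg m (fun u => g (a + (tau%:C)%C * (rhoC * u - a)) * (rhoC * u) / (rhoC * u - a)))
  <= eta * (2 * rho).
Proof.
move=> tau0 tau1 eta0; have [D D0 wmod] := gapP.
(* The slab number k has threshold tau |w_k|^2 / 2, hence keeps at distance tau |w_k| / 2 >= tau D /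
   2 from a. *)
pose d := tau * D / 2; have d0 : 0 < d by rewrite /d divr_gt0// mulr_gt0.
pose K := [set z : C | mod z <= rho /\ d <= mod (z - a)].
have Kc : compact K.
  have -> : K = @cdisc R rho `&` [set z | d <= mod (z - a)] by [].
  apply: compact_closedI; first exact: compact_cdisc.
  apply: closedC_P => z /= /negP; rewrite -ltNge => zd.
  exists (d - mod (z - a)) => [|w wz]; first by lra.
  apply/negP; rewrite -ltNge; have -> : w - a = (w - z) + (z - a) by ring.
  by apply: le_lt_trans (modulusD _ _) _; lra.
have qc z : K z -> {for z, continuous q}.
  move=> [zr za]; apply: derivable_cont; apply: dq => //.
  by rewrite -subr_eq0 -modulus_gt0; lra.
have [del del0 Hdel] := uniform_cont Kc qc eta0.
(* The step from z_k to z_(k+1) has length rho |r - 1|. Below D / 2 the next vertex stays in the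
   slab of the previous one; below del / 2 uniform continuity applies along it. *)
have r0 : 0 < Num.min (D / 2) (del / 2) / rho.
  by rewrite divr_gt0// lt_min; apply/andP; split; lra.
apply: filterS (dyroot_cvg r0) => m; rewrite ler_pdivlMr// le_min => /andP[rD rdel].
set r := dyroot R m in rD rdel *; set N := dysize m.
have r1 : 0 < mod (r - 1).
  rewrite modulus_gt0 subr_eq0; apply/eqP => r1; have := dyrootX R m.
  by rewrite -/r r1 expr1n => /eqP; rewrite -subr_eq0 opprK (pnatr_eq0 _ 2).
pose z k := rhoC * r ^+ k; pose w k := z k - a.
pose p k := a + (tau%:C)%C * w k.
have zm k : mod (z k) = rho by rewrite rhoCmod// dyrootX_mod.
have zD k : D <= mod (w k) by rewrite wmod// dyrootX_mod.
have zS k : z k.+1 - z k = z k * (r - 1) by rewrite /z exprSr; ring.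
have zSm k : mod (z k.+1 - z k) = rho * mod (r - 1) by rewrite zS modulusM zm.
have pm k : mod (p k) <= rho.
  have -> : p k = ((1 - tau)%:C)%C * a + (tau%:C)%C * z k.
    by rewrite /p /w rmorphB rmorph1; ring.
  apply: le_trans (modulusD _ _) _.
  rewrite (modulusM _ (z k)) (modulusM _ a) zm !modulusR !gtr0_norm ?subr_gt0//.
  by have : (1 - tau) * mod a <= (1 - tau) * rho by [apply: ler_wpM2l; [lra|exact: ltW]]; lra.
pose c k := tau * mod (w k) ^+ 2 / 2.
have ReL (x y : C) : complex.Re (x + y) = complex.Re x + complex.Re y.
  by case: x => ? ?; case: y.
have ReT (x y : C) : complex.Re ((tau%:C)%C * x * y) = tau * complex.Re (x * y).
  by case: x => ? ?; case: y => ? ? /=; ring.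
have cS k : mod (w k) ^+ 2 / 2 <= complex.Re (w k.+1 * ((w k)^*)%C).
  have -> : w k.+1 = (z k.+1 - z k) + w k by rewrite /w; ring.
  rewrite mulrDl ReL ReM_conj_self.
  have := ReM_conj_le (z k.+1 - z k) (w k); rewrite zSm mulrC ler_norml => /andP[+ _].
  by have := zD k; set x := mod (w k) => xD; nra.
have S1 k : slab rho (c k) a (w k) (z k).
  split; first by rewrite zm.
  rewrite -/(w k) ReM_conj_self /c; have : 0 <= mod (w k) ^+ 2 by exact: sqr_ge0.
  by nra.
have S2 k : slab rho (c k) a (w k) (z k.+1).
  split; first by rewrite zm.
  rewrite -/(w k.+1); apply: le_trans (cS k).
  by rewrite /c; have : 0 <= mod (w k) ^+ 2 by [exact: sqr_ge0]; nra.
have S3 k : slab rho (c k) a (w k) (p k).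
  split=> //; have -> : p k - a = (tau%:C)%C * w k by rewrite /p; ring.
  rewrite ReT ReM_conj_self /c; have : 0 <= mod (w k) ^+ 2 by exact: sqr_ge0.
  by nra.
have S4 k : slab rho (c k) a (w k) (p k.+1).
  split=> //; have -> : p k.+1 - a = (tau%:C)%C * w k.+1 by rewrite /p; ring.
  by rewrite ReT /c; have := cS k; nra.
have slabK k x : slab rho (c k) a (w k) x -> K x.
  move=> Sx; split; first by case: Sx.
  have w0 : 0 < mod (w k) by exact: lt_le_trans (zD k).
  apply: le_trans (slab_dist w0 Sx).
  rewrite ler_pdivlMr// /c /d.
  have : 0 <= tau * (mod (w k) * (mod (w k) - D)).
    apply: mulr_ge0; first exact: ltW.
    by apply: mulr_ge0; [exact: ltW|rewrite subr_ge0; exact: zD].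
  by lra.
have slabq k x : slab rho (c k) a (w k) x -> derivable q x 1.
  move=> /slabK[xr xd]; apply: dq => //.
  by rewrite -subr_eq0 -modulus_gt0; lra.
pose S l := \sum_(k < N) (trap q l (z k) (z k.+1) - trap q l (p k) (p k.+1)).
have zN : z N = z 0%N.
  by rewrite /z (prim_expr_order (dyroot_prim R m)) expr0.
have Scvg : S l @[l --> \oo] --> (0 : C).
  (* The missing sides of the quadrilaterals and their diagonals are inserted: the former telescope
     to 0 since z_N = z_0, the latter occur with both signs. *)
  have -> : S = fun l => \sum_(k < N) (dtrap q l (z k, z k.+1, p k) +
      dtrap q l (p k, z k.+1, p k.+1)).
    apply/funext => l; have : \sum_(k < N) (trap q l (z k.+1) (p k.+1) -
        trap q l (z k) (p k)) = 0.
      by rewrite -(big_mkord xpredT (fun k => trap q l (z k.+1) (p k.+1) -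
        trap q l (z k) (p k))) telescope_sumr// /p /w zN subrr.
    move=> E; rewrite -[LHS]addr0 -[X in _ + X]E /S -big_split; apply: eq_bigr => k _.
    rewrite /dtrap /= (trapN _ _ (z k.+1) (p k)) (trapN _ _ (p k) (z k)).
    by rewrite (trapN _ _ (p k) (p k.+1)); ring.
  rewrite [X in _ --> X](_ : 0 = \sum_(k < N) (0 + 0)); last first.
    by rewrite addr0 sumr_const mul0rn.
  apply: cvgC_sum => k; apply: cvgD.
    by apply: (@goursat _ (slab rho (c k) a (w k)));
     [exact: slab_midconvex|exact: slab_closed|exact: slabq|split].
  by apply: (@goursat _ (slab rho (c k) a (w k)));
     [exact: slab_midconvex|exact: slab_closed|exact: slabq|split].
pose T := \sum_(k < N) (q (z k) * (z k.+1 - z k) - q (p k) * (p k.+1 - p k)).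
(* The trapezoidal sum of the constant q(x) is exactly q(x) (y - x), so only the oscillation of q
   along the segment counts. *)
have trapq l x y : K x -> mod (y - x) < del ->
    mod (q x * (y - x) - trap q l x y) <= mod (y - x) * eta.
  move=> Kx xy; have -> : q x * (y - x) - trap q l x y =
      - trap (fun v => q v - (q x + 0 * v)) l x y.
    by rewrite trapB trap_affine; ring.
  rewrite modulusN; apply: (@trap_bound _ (fun v => mod (v - x) <= mod (y - x))) => //.
  - exact: midconvex_ball.
  - by rewrite subrr modulus0 modulus_ge0.
  by move=> v vx; rewrite mul0r addr0; apply: Hdel => //; exact: le_lt_trans xy.
have pS k : p k.+1 - p k = (tau%:C)%C * (z k.+1 - z k) by rewrite /p /w; ring.
have pSm k : mod (p k.+1 - p k) <= rho * mod (r - 1).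
  rewrite pS modulusM zSm modulusR gtr0_norm//.
  by rewrite ler_piMl ?mulr_ge0 ?modulus_ge0// ltW.
have Tb : mod T <= N%:R * (rho * mod (r - 1) * eta * 2).
  apply: (@cvg_modulus_le _ _ \oo _ (fun l => T - S l)).
    by have := cvgB (cvg_cst T) Scvg; rewrite subr0; apply.
  apply: nearW => l; rewrite /T /S -sumrB.
  apply: le_trans (ler_modulus_sum _ _ _) _.
  have -> : N%:R * (rho * mod (r - 1) * eta * 2) = \sum_(k < N) (rho * mod (r - 1) * eta * 2).
    by rewrite sumr_const card_ord mulr_natl.
  apply: ler_sum => k _.
  have -> : forall x y x' y' : C, x - y - (x' - y') = (x - x') - (y - y').
    by move=> ? ? ? ?; ring.
  apply: le_trans (modulusB _ _) _.
  have B1 : mod (z k.+1 - z k) < del by rewrite zSm; lra.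
  have B2 : mod (p k.+1 - p k) < del by have := pSm k; lra.
  have := trapq l _ _ (slabK _ _ (S1 k)) B1.
  have := trapq l _ _ (slabK _ _ (S3 k)) B2.
  have := ler_wpM2r (ltW eta0) (pSm k); rewrite zSm; lra.
(* All steps are z_k times the same factor r - 1, which turns the Riemann sum into an average. On
   the contracted polygon tau cancels between the step and p_k - a, so both averages have the same
   kernel. *)
have TE : T = (r - 1) * \sum_(k < N) (g (z k) * (z k) / (z k - a) -
    g (p k) * (z k) / (z k - a)).
  rewrite /T mulr_sumr; apply: eq_bigr => k _.
  rewrite pS zS /q; have -> : p k - a = (tau%:C)%C * w k by rewrite /p; ring.
  rewrite -/(w k); field.
  by rewrite -!modulus_gt0 modulusR gtr0_norm// tau0 (lt_le_trans _ (zD k)).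
rewrite -avgB modulusM modulusV modulus_nat ler_pdivrMl ?ltr0n ?dysize_gt0//.
rewrite -(ler_pM2l r1) -modulusM.
apply: (@le_trans _ _ (mod T)); first by rewrite TE.
by apply: le_trans Tb _; rewrite -/N; lra.
Qed.

(** After contraction by a small tau, g is within e D / (4 rho) of g(a) on the whole contour, by
    continuity at a, and the average of the remaining kernel tends to 1 by [avg_geom]. *)
Lemma cauchy_formula :
  avg m (fun u => g (rhoC * u) * (rhoC * u) / (rhoC * u - a)) @[m --> \oo] --> g a.
Proof.
apply/cvgC_P => e e0; have [D D0 wmod] := gapP.
have e4 : 0 < e * D / (4 * rho) by rewrite divr_gt0 ?mulr_gt0.
have [del del0 Hdel] := (contC_P _ _).1 (derivable_cont (dg (ltW arho))) _ e4.
have [tau [tau0 tau1 taud]] : exists tau, [/\ 0 < tau, tau < 1 & tau * (2 * rho) < del].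
  exists (Num.min (1 / 2) (del / (4 * rho))); split.
  - by rewrite lt_min; apply/andP; split; [lra|rewrite divr_gt0 ?mulr_gt0].
  - by rewrite gt_min; apply/orP; left; lra.
  set t := Num.min _ _; have : t <= del / (4 * rho) by rewrite /t ge_min lexx orbT.
  by move: t => t; rewrite ler_pdivlMr ?mulr_gt0//; lra.
have eta0 : 0 < e / (8 * rho) by rewrite divr_gt0 ?mulr_gt0.
have x1 : mod (a / rhoC) < 1.
  by rewrite modulusM modulusV modulusR gtr0_norm// ltr_pdivrMr// mul1r.
have ee : 0 < e / (4 * (mod (g a) + 1)).
  by rewrite divr_gt0// mulr_gt0// ltr_wpDl// modulus_ge0.
move/cvgC_P : (avg_geom x1) => /(_ _ ee); apply: filterS2 (cauchy_homotopy tau0 tau1 eta0).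
move=> m H1 H2.
set A1 := avg m _ in H1 *; set A2 := avg m _ in H1.
have rhon0 : rhoC != 0 by rewrite -modulus_gt0 modulusR gtr0_norm.
have geomE : avg m (fun u => (1 - a / rhoC / u)^-1) =
    avg m (fun u => (rhoC * u) / (rhoC * u - a)).
  apply: avg_ext => u u1; have u0 : u != 0 by rewrite -modulus_gt0 u1.
  have wn0 : rhoC * u - a != 0 by rewrite -modulus_gt0 (lt_le_trans _ (wmod _ u1)).
  by field; rewrite u0 rhon0 wn0.
rewrite geomE in H2; set A3 := avg m _ in H2.
have -> : A1 - g a = (A1 - A2) + ((A2 - g a * A3) + g a * (A3 - 1)) by ring.
apply: le_trans (modulusD _ _) _; apply: le_trans (lerD H1 (modulusD _ _)) _.
have B2 : mod (A2 - g a * A3) <= e / 4.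
  rewrite /A2 /A3 -avgZ -avgB; apply: avg_le => u u1.
  have w0 := wmod _ u1; rewrite [g a * _]mulrA -2!mulrBl 2!modulusM modulusV rhoCmod//.
  rewrite ler_pdivrMr ?(lt_le_trans D0)//.
  have : mod (g (a + (tau%:C)%C * (rhoC * u - a)) - g a) <= e * D / (4 * rho).
    apply: Hdel; rewrite addrAC subrr add0r modulusM modulusR gtr0_norm//.
    apply: le_lt_trans taud; apply: ler_wpM2l; first exact: ltW.
    apply: le_trans (modulusB _ _) _; rewrite rhoCmod//.
    by move: arho; lra.
  rewrite ler_pdivlMr ?mulr_gt0// => H; have := ler_wpM2l (ltW e0) w0; lra.
have B3 : mod (g a * (A3 - 1)) <= e / 4.
  rewrite modulusM; move: H2; rewrite ler_pdivlMr; last first.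
    by rewrite mulr_gt0// ltr_wpDl// modulus_ge0.
  have := modulus_ge0 (A3 - 1); have := modulus_ge0 (g a).
  by set x := mod (g a); set y := mod _; lra.
have -> : e / (8 * rho) * (2 * rho) = e / 4 by field; rewrite lt0r_neq0.
lra.
Qed.

End CauchyFormula.
End Cauchy.

(** * Power series and Taylor coefficients *)

Section PowerSeries.
Variable R : realType.
Local Notation C := (Cx R).
Local Notation mod := (@modulus R).

Definition psum (c : nat -> C) N (w : C) : C := \sum_(n < N) c n * w ^+ n.

(* [c] are the Taylor coefficients of [g] at [x], with Cauchy's inequalities for the
   bound [M] on the disc of radius [rho]. *)
Definition PS (g : C -> C) (x : C) (rho M : R) (c : nat -> C) : Prop :=
  (forall n, mod (c n) <= M / rho ^+ n) /\
  forall w N, mod w < rho ->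
    mod (g (x + w) - psum c N w) * (1 - mod w / rho) <= M * (mod w / rho) ^+ N.

Lemma PS_ge0 g x rho M c : PS g x rho M c -> 0 <= M.
Proof.
by move=> [/(_ 0%N) + _]; rewrite expr0 divr1; apply: le_trans; exact: modulus_ge0.
Qed.

Lemma ratio_ge0 (rho : R) (w : C) : 0 < rho -> 0 <= mod w / rho.
Proof. by move=> r0; apply: divr_ge0; [exact: modulus_ge0|exact: ltW]. Qed.

Lemma ratio_lt1 (rho : R) (w : C) : 0 < rho -> mod w < rho -> mod w / rho < 1.
Proof. by move=> r0 wr; rewrite ltr_pdivrMr// mul1r. Qed.

Lemma psumS c N w : psum c N.+1 w = psum c N w + c N * w ^+ N.
Proof. exact: big_ord_recr. Qed.

(** Induction on n: once the lower coefficients converge, h_m(x + w) minus its terms of order below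
    n converges for fixed w, and divided by w^n it is the n-th coefficient up to an error O(|w|)
    uniform in m. *)
Lemma vitali_cauchy x (rho M : R) (h : nat -> C -> C) (c : nat -> nat -> C)
    (g : C -> C) : 0 < rho -> (forall m, PS (h m) x rho M (c m)) ->
  (forall w, mod w < rho -> h m (x + w) @[m --> \oo] --> g (x + w)) ->
  forall n, cvgn (fun m => c m n).
Proof.
move=> rho0 hPS hg n; have M0 := PS_ge0 (hPS 0%N).
elim/ltn_ind: n => n IH; apply: cauchyC => e e0.
have rn0 : 0 < rho ^+ n by rewrite exprn_gt0.
(* With |w| = t rho, the two remainders cost 4 M t^(n+1), which is at most half of e t^n rho^n; the
   convergence of X takes the other half. *)
have [t [t0 t1 tb]] : exists t, [/\ 0 < t, t <= 1 / 2 & 8 * M * t <= e * rho ^+ n].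
  have b0 : 0 < e * rho ^+ n / (8 * (M + 1)).
    apply: divr_gt0; first exact: mulr_gt0.
    lra.
  exists (Num.min (1 / 2) (e * rho ^+ n / (8 * (M + 1)))); split.
  - by rewrite lt_min; apply/andP; split => //; lra.
  - by rewrite ge_min lexx.
  set t := Num.min _ _.
  have t0 : 0 <= t by rewrite le_min; apply/andP; split; [lra|exact: ltW].
  have : t <= e * rho ^+ n / (8 * (M + 1)) by rewrite ge_min lexx orbT.
  by rewrite ler_pdivlMr; [move: t t0 => t t0; lra|lra].
pose w : C := ((t * rho)%:C)%C.
have wm : mod w = t * rho by rewrite modulusR gtr0_norm// mulr_gt0.
have wr : mod w < rho by rewrite wm; nra.
have wt : mod w / rho = t by rewrite wm mulfK// lt0r_neq0.
have tn0 : 0 < t ^+ n by rewrite exprn_gt0.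
pose X m := h m (x + w) - psum (c m) n w.
have [L XL] : exists L : C, X m @[m --> \oo] --> L.
  exists (g (x + w) - \sum_(j < n) lim (c m j @[m --> \oo]) * w ^+ j).
  apply: cvgB; first exact: hg.
  apply: cvgC_sum => j; apply: cvgM; last exact: cvg_cst.
  exact: IH (ltn_ord j).
have Xc m : mod (w ^+ n * c m n - X m) <= 2 * M * t ^+ n.+1.
  have [_ /(_ w n.+1 wr)] := hPS m; rewrite wt psumS.
  have -> : w ^+ n * c m n - X m = - (h m (x + w) - (psum (c m) n w + c m n * w ^+ n)).
    by rewrite /X; ring.
  by rewrite modulusN; have := modulus_ge0 (h m (x + w) - (psum (c m) n w + c m n * w ^+ n)); nra.
have d0 : 0 < e * t ^+ n * rho ^+ n / 4.
  by apply: divr_gt0 => //; apply: mulr_gt0 => //; exact: mulr_gt0.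
move/cvgC_P : XL => /(_ _ d0)[N _ HN]; exists N => k l Nk Nl.
have wn0 : 0 < mod w ^+ n by rewrite wm exprn_gt0// mulr_gt0.
rewrite -(ler_pM2l wn0) -modulusX -modulusM.
have -> : w ^+ n * (c k n - c l n) = ((w ^+ n * c k n - X k) - (w ^+ n * c l n - X l))
   + ((X k - L) - (X l - L)) by ring.
apply: le_trans (modulusD _ _) _.
apply: le_trans (lerD (modulusB _ _) (modulusB _ _)) _.
have := HN k Nk; have := HN l Nl; have := Xc k; have := Xc l => /=.
rewrite modulusX wm exprMn exprS.
have : 0 <= t ^+ n * (e * rho ^+ n - 8 * M * t).
  by apply: mulr_ge0; [exact: ltW|rewrite subr_ge0].
lra.
Qed.

(** The coefficients converge, and both inequalities in [PS] are closed conditions uniform in m, so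
    the pointwise limit has an expansion with the same constants. *)
Lemma vitali x (rho M : R) (h : nat -> C -> C) (c : nat -> nat -> C) (g : C -> C) :
  0 < rho -> (forall m, PS (h m) x rho M (c m)) ->
  (forall w, mod w < rho -> h m (x + w) @[m --> \oo] --> g (x + w)) ->
  exists2 c', PS g x rho M c' & forall n, c m n @[m --> \oo] --> c' n.
Proof.
move=> rho0 hPS hg; have cc := vitali_cauchy rho0 hPS hg.
exists (fun n => lim (c m n @[m --> \oo])) => [|n]; last exact: cc.
split=> [n|w N wr].
  by apply: cvg_modulus_le (cc n) _; apply: nearW => m; have [] := hPS m.
have q1 : 0 < 1 - mod w / rho by rewrite subr_gt0; exact: ratio_lt1.
rewrite -ler_pdivlMr//.
apply: (@cvg_modulus_le _ _ \oo _ (fun m => h m (x + w) - psum (c m) N w)).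
  apply: cvgB; first exact: hg.
  by apply: cvgC_sum => j; apply: cvgM; [exact: cc|exact: cvg_cst].
by apply: nearW => m; rewrite ler_pdivlMr//; have [_] := hPS m; apply.
Qed.

(** The discrete Cauchy integrals h_m expand exactly in a geometric series and satisfy [PS] for
    every m. They converge to g by [cauchy_formula], and [vitali] transfers the expansion to g. *)
Lemma taylor_PS (g : C -> C) x (rho M : R) : 0 < rho ->
  (forall z, mod (z - x) <= rho -> derivable g z 1) ->
  (forall z, mod (z - x) = rho -> mod (g z) <= M) ->
  exists2 c, PS g x rho M c & forall n,
    avg m (fun u => g (x + (rho%:C)%C * u) * ((rho%:C)%C * u) ^- n) @[m --> \oo] --> c n.
Proof.
move=> rho0 dg gM; set rhoC := (rho%:C)%C.
have rm u : mod u = 1 -> mod (rhoC * u) = rho.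
  by move=> u1; rewrite modulusM u1 mulr1 modulusR gtr0_norm.
have gM' u : mod u = 1 -> mod (g (x + rhoC * u)) <= M.
  by move=> u1; apply: gM; rewrite addrAC subrr add0r rm.
have M0 : 0 <= M by apply: le_trans (gM' 1 (modulus1 R)); exact: modulus_ge0.
pose h m y := avg m (fun u => g (x + rhoC * u) * (rhoC * u) / (rhoC * u - (y - x))).
pose c m n := avg m (fun u => g (x + rhoC * u) * (rhoC * u) ^- n).
have hPS m : PS (h m) x rho M (c m).
  split=> [n|w N wr].
    apply: avg_le => u u1; rewrite modulusM modulusV modulusX rm//.
    by apply: ler_wpM2r (gM' _ u1); rewrite invr_ge0 exprn_ge0// ltW.
  have q1 : 0 < 1 - mod w / rho by rewrite subr_gt0; exact: ratio_lt1.
  rewrite -ler_pdivlMr//.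
  have -> : h m (x + w) - psum (c m) N w = avg m (fun u =>
      g (x + rhoC * u) * ((w / (rhoC * u)) ^+ N / (1 - w / (rhoC * u)))).
    have -> : psum (c m) N w = avg m (fun u =>
        \sum_(n < N) w ^+ n * (g (x + rhoC * u) * (rhoC * u) ^- n)).
      by rewrite avg_sum; apply: eq_bigr => n _; rewrite avgZ mulrC.
    rewrite /h -avgB; apply: avg_ext => u u1.
    have z0 : rhoC * u != 0 by rewrite -modulus_gt0 rm.
    have zw : rhoC * u - w != 0.
      rewrite -modulus_gt0; apply: lt_le_trans (modulusDB _ _).
      by rewrite rm// subr_gt0.
    have y1 : w / (rhoC * u) != 1.
      apply/eqP => /(congr1 (fun v => v * (rhoC * u))).
      by rewrite mul1r divfK// => E; move/eqP: zw; apply; rewrite -E subrr.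
    have -> : x + w - x = w by ring.
    have -> : g (x + rhoC * u) * (rhoC * u) / (rhoC * u - w) =
        g (x + rhoC * u) * (1 - w / (rhoC * u))^-1.
      by move: zw z0; set z := rhoC * u => zw z0; field; rewrite zw z0.
    rewrite {1}(geom_rem N y1) mulrDr addrAC mulr_sumr -sumrB big1 ?add0r// => n _.
    by rewrite expr_div_n mulrCA subrr.
  apply: avg_le => u u1; rewrite modulusM -mulrA; apply: ler_pM; rewrite ?modulus_ge0 ?gM'//.
  rewrite modulusM modulusX modulusM !modulusV rm//.
  apply: ler_wpM2l; first by rewrite exprn_ge0// ratio_ge0.
  have B : 1 - mod w / rho <= mod (1 - w / (rhoC * u)).
    by apply: le_trans (modulus_1B _); rewrite modulusM modulusV rm.
  by rewrite lef_pV2 ?posrE//; exact: lt_le_trans B.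
apply: (vitali rho0 hPS) => w wr.
have := @cauchy_formula _ (fun z => g (x + z)) rho w rho0 wr.
rewrite /h; have -> : x + w - x = w by ring.
apply=> z zr; apply/derivable_has.
have /dg/derivable_has[l Hl] : mod (x + z - x) <= rho.
  by rewrite addrAC subrr add0r.
exists l => e e0; have [d d0 Hd] := Hl e e0; exists d => // k kd.
by rewrite addrA; exact: Hd.
Qed.

Lemma PS_center g x rho M c : 0 < rho -> PS g x rho M c -> g x = c 0%N.
Proof.
move=> rho0 [_ /(_ 0 1%N)]; rewrite modulus0 mul0r subr0 mulr1 expr1 mulr0 addr0.
move=> /(_ rho0); rewrite /psum big_ord1 expr0 mulr1 => H.
have : mod (g x - c 0%N) == 0 by rewrite eq_le H modulus_ge0.
by rewrite modulus_eq0 subr_eq0 => /eqP.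
Qed.

Lemma PS_has_deriv g x rho M c : 0 < rho -> PS g x rho M c -> has_deriv g x (c 1%N).
Proof.
move=> rho0 gPS e e0; have M0 := PS_ge0 gPS.
have d0 : 0 < Num.min (rho / 2) (e * rho ^+ 2 / (2 * (M + 1))).
  rewrite lt_min; apply/andP; split; first lra.
  by apply: divr_gt0; [apply: mulr_gt0; rewrite ?exprn_gt0|lra].
exists (Num.min (rho / 2) (e * rho ^+ 2 / (2 * (M + 1)))) => // w.
rewrite lt_min => /andP[w1 w2].
have wr : mod w < rho by lra.
have [_ /(_ w 2%N wr)] := gPS.
rewrite /psum big_ord_recl big_ord1 /= expr0 mulr1 -(PS_center rho0 gPS) expr1.
rewrite opprD addrA (mulrC (c 1%N)); set A := mod (_ - _) => HA.
have A0 : 0 <= A by exact: modulus_ge0.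
have wq : mod w / rho <= 1 / 2 by rewrite ler_pdivrMr//; lra.
have w0 := modulus_ge0 w.
move: w2; rewrite ltr_pdivlMr; last by lra.
move=> w2; have A1 : A <= 2 * (M * (mod w / rho) ^+ 2) by nra.
apply: le_trans A1 _; rewrite expr_div_n.
have r2 : 0 < rho ^+ 2 by rewrite exprn_gt0.
rewrite mulrA mulrA ler_pdivrMr// expr2 mulrA mulrAC [leRHS]mulrAC.
apply: ler_wpM2r => //; nra.
Qed.

End PowerSeries.

(** * Termwise differentiation and the calculus of Taylor coefficients *)

Section Coef.
Variable R : realType.
Local Notation C := (Cx R).
Local Notation mod := (@modulus R).

Lemma geom_le (q : R) N : 0 <= q -> q < 1 -> (1 - q) * \sum_(n < N) q ^+ n <= 1.
Proof.
move=> q0 q1; have := subrX1 q N; have : 0 <= q ^+ N by exact: exprn_ge0.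
by set S := \sum_(_ < _) _; nra.
Qed.

Lemma psum_tail (c : nat -> C) (rho M : R) (w : C) N k : 0 < rho -> 0 <= M ->
  (forall n, mod (c n) <= M / rho ^+ n) -> mod w < rho ->
  mod (psum c (N + k)%N w - psum c N w) * (1 - mod w / rho) <= M * (mod w / rho) ^+ N.
Proof.
move=> rho0 M0 cM wr.
have q0 := ratio_ge0 w rho0; have q1 := ratio_lt1 rho0 wr.
rewrite /psum big_split_ord /= addrAC subrr add0r.
set q := mod w / rho in q0 q1 *.
apply: (@le_trans _ _ ((\sum_(i < k) M * q ^+ N * q ^+ i) * (1 - q))).
  apply: ler_wpM2r; first by rewrite subr_ge0 ltW.
  apply: le_trans (ler_modulus_sum _ _ _) _; apply: ler_sum => i _.
  rewrite modulusM modulusX -mulrA -exprD /q expr_div_n mulrCA mulrC.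
  by apply: ler_wpM2l => //; rewrite exprn_ge0// modulus_ge0.
rewrite -mulr_sumr -mulrA ler_piMr ?mulr_ge0 ?exprn_ge0// mulrC.
exact: geom_le.
Qed.

Lemma PS_of_cvg (g : C -> C) x (rho M : R) (c : nat -> C) : 0 < rho -> 0 <= M ->
  (forall n, mod (c n) <= M / rho ^+ n) ->
  (forall w, mod w < rho -> psum c N w @[N --> \oo] --> g (x + w)) ->
  PS g x rho M c.
Proof.
move=> rho0 M0 cM cg; split=> // w N wr.
have q1 : 0 < 1 - mod w / rho by rewrite subr_gt0; exact: ratio_lt1.
rewrite -ler_pdivlMr//.
apply: (@cvg_modulus_le _ _ \oo _ (fun L => psum c L w - psum c N w)).
  by have := cvgB (cg w wr) (cvg_cst (psum c N w)); apply.
exists N => // L /= NL; rewrite ler_pdivlMr// -(subnKC NL).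
exact: psum_tail.
Qed.

Lemma PS_cvg (g : C -> C) x (rho M : R) (c : nat -> C) w : 0 < rho ->
  PS g x rho M c -> mod w < rho -> psum c N w @[N --> \oo] --> g (x + w).
Proof.
move=> rho0 gPS wr; have [_ H] := gPS; apply/cvgC_P => e e0.
have M0 := PS_ge0 gPS.
have q0 := ratio_ge0 w rho0; have q1 := ratio_lt1 rho0 wr.
have : ((mod w / rho) ^+ n) @[n --> \oo] --> (0 : R).
  by apply: cvg_expr; rewrite ger0_norm.
have d0 : 0 < e * (1 - mod w / rho) / (M + 1).
  by apply: divr_gt0; [apply: mulr_gt0; rewrite ?subr_gt0|lra].
move=> /cvgrPdist_le /(_ _ d0); apply: filterS => N /=.
rewrite sub0r normrN ger0_norm ?exprn_ge0//.
rewrite ler_pdivlMr; last by lra.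
have := H w N wr; rewrite modulusBC.
set A := mod _; set q := mod w / rho in q0 q1 *.
have qN : 0 <= q ^+ N by exact: exprn_ge0.
have q2 : 0 < 1 - q by rewrite subr_gt0.
by move=> H1 H2; rewrite -(ler_pM2r q2); nra.
Qed.

(** One term of the binomial expansion. It trades a factor n + 1 for an increase of the radius from
    a to a + B. *)
Lemma bernoulli (a B : R) n : 0 <= a -> 0 <= B ->
  n.+1%:R * (a ^+ n * B) <= (a + B) ^+ n.+1.
Proof.
move=> a0 B0; elim: n => [|n IH].
  by rewrite !expr1 expr0; lra.
have an : 0 <= a ^+ n by exact: exprn_ge0.
have anB : a ^+ n.+1 <= (a + B) ^+ n.+1 by apply: lerXn2r; rewrite ?nnegrE; lra.
have := ler_wpM2l a0 IH; have := ler_wpM2l B0 anB.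
rewrite [(a + B) ^+ n.+2]exprS [a ^+ n.+1]exprS -[n.+2%:R]natr1; lra.
Qed.

(** The error at n + 2 is (w + h) times the error at n + 1, plus (n + 1) h^2 w^n. Since |h| <= B /
    2, the first term leaves a margin B / 2 in the factor |w| + B, and [bernoulli] fits the second
    into it. *)
Lemma monomial_diff (w h : C) (B : R) n : 0 < B -> mod h <= B / 2 ->
  mod ((w + h) ^+ n - w ^+ n - h * (n%:R * w ^+ n.-1)) <=
  2 * (mod h / B) ^+ 2 * (mod w + B) ^+ n.
Proof.
move=> B0 hB; have h0 := modulus_ge0 h; have w0 := modulus_ge0 w.
elim: n => [|n IH].
  rewrite !expr0 mul0r mulr0 subrr subr0 modulus0 mulr1 mulr_ge0//.
  exact: sqr_ge0.
case: n IH => [|n] IH.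
  rewrite !expr1 expr0 !mulr1 [w + h]addrC addrK subrr modulus0.
  by apply: mulr_ge0; [apply: mulr_ge0 => //; exact: sqr_ge0|lra].
have -> : (w + h) ^+ n.+2 - w ^+ n.+2 - h * (n.+2%:R * w ^+ n.+2.-1) =
  (w + h) * ((w + h) ^+ n.+1 - w ^+ n.+1 - h * (n.+1%:R * w ^+ n.+1.-1)) +
  n.+1%:R * (h ^+ 2 * w ^+ n).
  by rewrite /= -[n.+2%:R]natr1 !exprS; ring.
apply: le_trans (modulusD _ _) _; rewrite 3!modulusM modulus_nat !modulusX.
have b := bernoulli n w0 (ltW B0).
have wh := modulusD w h.
set E := mod (_ - _) in IH *; have E0 : 0 <= E by exact: modulus_ge0.
set a := mod w in w0 b wh IH *; set k := mod h in h0 hB wh IH *.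
have P0 : 0 <= (a + B) ^+ n.+1 by apply: exprn_ge0; lra.
have T1 : mod (w + h) * E <= (a + B / 2) * (2 * (k / B) ^+ 2 * (a + B) ^+ n.+1).
  by apply: ler_pM => //; [exact: modulus_ge0|lra].
apply: le_trans (lerD T1 (lexx _)) _.
have kB : k ^+ 2 = (k / B) ^+ 2 * B ^+ 2 by rewrite -exprMn divfK// lt0r_neq0.
rewrite kB; set K := (k / B) ^+ 2; have K0 : 0 <= K by exact: sqr_ge0.
have := ler_wpM2l (mulr_ge0 K0 (ltW B0)) b.
by rewrite [(a + B) ^+ n.+2]exprS; lra.
Qed.

Definition dcoef (c : nat -> C) (n : nat) : C := n.+1%:R * c n.+1.

Lemma psum_deriv (c : nat -> C) N (w : C) :
  \sum_(n < N.+1) c n * (n%:R * w ^+ n.-1) = psum (dcoef c) N w.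
Proof.
rewrite big_ord_recl mul0r mulr0 add0r; apply: eq_bigr => n _.
by rewrite /dcoef /= mulrA; congr (_ * _); rewrite mulrC.
Qed.

(** The bound is uniform in N, so that N can tend to infinity with h fixed. *)
Lemma psum_diff (c : nat -> C) (rho rho1 M : R) (w h : C) N : 0 < rho ->
  mod w < rho1 -> rho1 < rho -> 0 <= M ->
  (forall n, mod (c n) <= M / rho ^+ n) -> mod h <= (rho1 - mod w) / 2 ->
  mod (psum c N.+1 (w + h) - psum c N.+1 w - h * psum (dcoef c) N w) * (1 - rho1 / rho)
  <= 2 * M * (mod h / (rho1 - mod w)) ^+ 2.
Proof.
move=> rho0 w1 r1 M0 cM hb; have w0 := modulus_ge0 w.
have B0 : 0 < rho1 - mod w by rewrite subr_gt0.
rewrite -psum_deriv /psum mulr_sumr -!sumrB.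
have q0 : 0 <= rho1 / rho by apply: divr_ge0; lra.
have q1 : rho1 / rho < 1 by rewrite ltr_pdivrMr// mul1r.
set K := (mod h / _) ^+ 2; have K0 : 0 <= K by exact: sqr_ge0.
apply: (@le_trans _ _ ((\sum_(n < N.+1) 2 * M * K * (rho1 / rho) ^+ n) * (1 - rho1 / rho))).
  apply: ler_wpM2r; first by rewrite subr_ge0 ltW.
  apply: le_trans (ler_modulus_sum _ _ _) _; apply: ler_sum => n _.
  rewrite mulrCA -!mulrBr modulusM.
  apply: le_trans (ler_pM (modulus_ge0 _) (modulus_ge0 _) (cM n)
    (monomial_diff w n B0 hb)) _.
  rewrite -/K addrC subrK expr_div_n.
  set x := (rho ^+ n)^-1; set y := rho1 ^+ n.
  by rewrite le_eqVlt; apply/orP; left; apply/eqP; ring.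
rewrite -mulr_sumr -[leLHS]mulrA; apply: ler_piMr; first by apply: mulr_ge0 => //; exact: mulr_ge0.
by rewrite mulrC; exact: geom_le.
Qed.

(** One small increment h = t is fixed before N. The error e t splits into four quarters:
    differentiability of g, convergence of the partial sums at w and at w + h, and the second-order
    remainder of the partial sums. *)
Lemma PS_deriv_cvg g x (rho M : R) c w l : 0 < rho -> PS g x rho M c ->
  mod w < rho -> has_deriv g (x + w) l ->
  psum (dcoef c) N w @[N --> \oo] --> l.
Proof.
move=> rho0 gPS wr Hl; have [cM _] := gPS; have M0 := PS_ge0 gPS.
have w0 := modulus_ge0 w.
pose rho1 := (rho + mod w) / 2.
have [r1 r2] : mod w < rho1 /\ rho1 < rho by rewrite /rho1; split; lra.
clearbody rho1; set B := rho1 - mod w; have B0 : 0 < B by rewrite subr_gt0.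
have q1 : 0 < 1 - rho1 / rho by rewrite subr_gt0 ltr_pdivrMr// mul1r.
set q' := 1 - rho1 / rho in q1.
apply/cvgC_P => e e0; have e4 : 0 < e / 4 by lra.
have [d d0 Hd] := Hl _ e4.
have b0 : 0 < e * q' * B ^+ 2 / (8 * (M + 1)).
  by apply: divr_gt0; [rewrite !mulr_gt0 ?exprn_gt0|lra].
have [t [t0 td tB tr te]] : exists t : R, [/\ 0 < t, t < d, t <= B / 2, t < rho - mod w &
    8 * M * t <= e * q' * B ^+ 2].
  have [m [m0 m1 m2 m3 m4]] : exists m : R, [/\ 0 < m, m <= d, m <= B / 2, m <= rho - mod w &
      m <= e * q' * B ^+ 2 / (8 * (M + 1))].
    exists (Num.min (Num.min d (B / 2)) (Num.min (rho - mod w)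
       (e * q' * B ^+ 2 / (8 * (M + 1))))); split.
    - by rewrite !lt_min; apply/andP; split; apply/andP; split => //; lra.
    - by rewrite !ge_min lexx.
    - by rewrite !ge_min lexx orbT.
    - by rewrite !ge_min lexx !orbT.
    - by rewrite !ge_min lexx !orbT.
  exists (m / 2); split; try lra.
  by move: m4; rewrite ler_pdivlMr; nra.
pose h : C := (t%:C)%C.
have hm : mod h = t by rewrite modulusR gtr0_norm.
have whr : mod (w + h) < rho by apply: le_lt_trans (modulusD _ _) _; rewrite hm; lra.
have Hh := Hd h; rewrite hm in Hh; move/(_ td) : Hh => Hh.
have et : 0 < e * t / 4 by rewrite divr_gt0// mulr_gt0.
have /cvgC_P /(_ _ et)[N1 _ HN1] := PS_cvg rho0 gPS wr.
have /cvgC_P /(_ _ et)[N2 _ HN2] := PS_cvg rho0 gPS whr.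
exists (maxn N1 N2) => // N /=; rewrite geq_max => /andP[N1N N2N].
have A1 := HN1 N.+1 (leqW N1N); have A2 := HN2 N.+1 (leqW N2N).
have hB : mod h <= (rho1 - mod w) / 2 by rewrite hm.
have := psum_diff N rho0 r1 r2 M0 cM hB; rewrite hm -/q' -/B.
set D := psum c N.+1 (w + h) - _ - _ => HD.
rewrite /= in A1 A2.
rewrite -(ler_pM2l t0) -[in X in X <= _]hm -modulusM.
have -> : h * (psum (dcoef c) N w - l) =
  (g (x + w + h) - g (x + w) - h * l) + (psum c N.+1 (w + h) - g (x + (w + h)))
  - (psum c N.+1 w - g (x + w)) - D.
  by rewrite /D (addrA x w h); ring.
apply: le_trans (modulusB _ _) _; apply: le_trans (lerD (modulusB _ _) (lexx _)) _.
apply: le_trans (lerD (lerD (modulusD _ _) (lexx _)) (lexx _)) _.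
have D1 : mod D <= t * e / 4.
  rewrite -(ler_pM2r q1); apply: le_trans HD _.
  rewrite expr_div_n mulrA ler_pdivrMr ?exprn_gt0//.
  by have := ler_wpM2l (ltW t0) te; lra.
lra.
Qed.


Definition hol (g : C -> C) (x : C) (rho : R) :=
  forall z, mod (z - x) < rho -> derivable g z 1.

Lemma hol_sub g x rho y r : hol g x rho -> mod (y - x) + r <= rho -> hol g y r.
Proof.
move=> H yr z zy; apply: H; have -> : z - x = (z - y) + (y - x) by ring.
by apply: le_lt_trans (modulusD _ _) _; lra.
Qed.

Lemma hol_PS g x (rho : R) : 0 < rho -> hol g x rho ->
  exists r M c, [/\ 0 < r, r < rho & PS g x r M c].
Proof.
move=> rho0 Hg.
have /Hg/derivable_cont/contC_P/(_ _ ltr01)[d d0 Hd] : mod (x - x) < rho.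
  by rewrite subrr modulus0.
pose r := Num.min (rho / 2) (d / 2).
have r0 : 0 < r by rewrite lt_min; apply/andP; split; lra.
have r1 : r <= rho / 2 by rewrite ge_min lexx.
have r2 : r <= d / 2 by rewrite ge_min lexx orbT.
clearbody r.
have [||c gPS _] := @taylor_PS _ g x r (mod (g x) + 1) r0.
- by move=> z zr; apply: Hg; lra.
- move=> z zr; have /Hd : mod (z - x) < d by lra.
  by have := modulusDB (g z) (g x); lra.
by exists r, (mod (g x) + 1), c; split => //; lra.
Qed.

Lemma dcoef_bound (c : nat -> C) (rho r M : R) : 0 < r -> r < rho -> 0 <= M ->
  (forall n, mod (c n) <= M / rho ^+ n) ->
  forall n, mod (dcoef c n) <= M / (rho - r) / r ^+ n.
Proof.
move=> r0 rr M0 cM n; have rho0 : 0 < rho by lra.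
rewrite /dcoef modulusM modulus_nat.
apply: le_trans (ler_wpM2l _ (cM n.+1)) _ => //.
have b : n.+1%:R * (r ^+ n * (rho - r)) <= rho ^+ n.+1.
  have /= := @bernoulli r (rho - r) n (ltW r0).
  by rewrite (addrC r) subrK; apply; lra.
have p1 : 0 < rho ^+ n.+1 by rewrite exprn_gt0.
have p2 : 0 < r ^+ n by rewrite exprn_gt0.
have p3 : 0 < rho - r by lra.
rewrite ler_pdivlMr// ler_pdivlMr//.
have -> : n.+1%:R * (M / rho ^+ n.+1) * r ^+ n * (rho - r) =
  (n.+1%:R * (r ^+ n * (rho - r))) * M / rho ^+ n.+1 by ring.
by rewrite ler_pdivrMr// mulrC; exact: ler_wpM2l.
Qed.

Lemma PS_derive1 g x (rho r M : R) c : 0 < r -> r < rho -> hol g x rho ->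
  PS g x rho M c -> exists M', PS (derive1 g) x r M' (dcoef c).
Proof.
move=> r0 rr Hg gPS; have M0 := PS_ge0 gPS; have [cM _] := gPS.
have rho0 : 0 < rho by lra.
exists (M / (rho - r)); apply: PS_of_cvg => //.
- by apply: divr_ge0 => //; lra.
- exact: dcoef_bound.
move=> w wr; apply: (PS_deriv_cvg rho0 gPS); first by lra.
apply: derive1_has; apply: Hg; rewrite addrAC subrr add0r; lra.
Qed.

Lemma hol_derive1 g x (rho : R) : hol g x rho -> hol (derive1 g) x rho.
Proof.
move=> Hg y yr.
have y0 : 0 < rho - mod (y - x) by rewrite subr_gt0.
have Hgy : hol g y (rho - mod (y - x)) by apply: (hol_sub Hg); lra.
have [r [M [c [r0 r1 gPS]]]] := hol_PS y0 Hgy.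
have Hgr : hol g y r by apply: (hol_sub Hgy); rewrite subrr modulus0; lra.
have [||M' dPS] := @PS_derive1 g y r (r / 2) M c _ _ Hgr gPS; [lra|lra|].
by apply/derivable_has; exists (dcoef c 1); apply: PS_has_deriv dPS; lra.
Qed.

Lemma hol_derive1n n g x (rho : R) : hol g x rho -> hol (derive1n n g) x rho.
Proof. by elim: n => [//|n IH] Hg; apply: hol_derive1; exact: IH. Qed.

(** Defined by derivatives rather than through an expansion, so that it is total and agrees with the
    coordinates of [phi]. *)
Definition tcoef n (g : C -> C) (x : C) : C := (n`!%:R)^-1 * derive1n n g x.

(** Each derivative halves the radius of the expansion, which is harmless because only the value at
    the centre is wanted. *)
Lemma PS_derive1n n g x (rho M : R) c : 0 < rho -> hol g x rho ->
  PS g x rho M c -> derive1n n g x = n`!%:R * c n.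
Proof.
elim: n g rho M c => [|n IH] g rho M c rho0 Hg gPS.
  by rewrite derive1n0 mul1r; exact: PS_center gPS.
have [||M' dPS] := @PS_derive1 g x rho (rho / 2) M c _ _ Hg gPS; [lra|lra|].
rewrite derive1Sn (IH _ (rho / 2) M' (dcoef c)) //; first last.
- by apply: (@hol_sub _ x rho); [exact: hol_derive1|rewrite subrr modulus0; lra].
- lra.
by rewrite /dcoef factS natrM mulrA (mulrC n`!%:R).
Qed.

Lemma PS_coef n g x (rho M : R) c : 0 < rho -> hol g x rho ->
  PS g x rho M c -> tcoef n g x = c n.
Proof.
move=> rho0 Hg gPS; by rewrite /tcoef (PS_derive1n n rho0 Hg gPS) mulKf// pnatr_eq0 -lt0n fact_gt0.
Qed.

Lemma taylor (g : C -> C) x (rho M : R) : 0 < rho ->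
  (forall z, mod (z - x) <= rho -> derivable g z 1) ->
  (forall z, mod (z - x) = rho -> mod (g z) <= M) ->
  PS g x rho M (fun n => tcoef n g x) /\
  forall n, avg m (fun u => g (x + (rho%:C)%C * u) * ((rho%:C)%C * u) ^- n)
    @[m --> \oo] --> tcoef n g x.
Proof.
move=> rho0 dg gM; have [c gPS Hc] := taylor_PS rho0 dg gM.
have E : (fun n => tcoef n g x) = c.
  apply/funext => n; apply: (PS_coef n rho0) gPS => z zr.
  by apply: dg; exact: ltW.
by rewrite -E in gPS Hc; split.
Qed.

Lemma tcoef_le n (g : C -> C) x (rho M : R) : 0 < rho ->
  (forall z, mod (z - x) <= rho -> derivable g z 1) ->
  (forall z, mod (z - x) = rho -> mod (g z) <= M) ->
  mod (tcoef n g x) <= M / rho ^+ n.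
Proof. by move=> r0 dg gM; have [[]] := taylor r0 dg gM. Qed.

Lemma tcoef_local n (g h : C -> C) x (rho : R) : 0 < rho -> hol g x rho ->
  (forall z, mod (z - x) < rho -> g z = h z) -> hol h x rho /\ tcoef n g x = tcoef n h x.
Proof.
move=> rho0 Hg gh.
have Hh : hol h x rho.
  move=> z zr; have /derivable_has[l Hl] := Hg z zr; apply/derivable_has; exists l.
  move=> e e0; have [d d0 Hd] := Hl e e0.
  exists (Num.min d (rho - mod (z - x))) => [|k].
    by rewrite lt_min d0 subr_gt0.
  rewrite lt_min => /andP[kd kr]; rewrite -!gh//; first exact: Hd.
  have -> : z + k - x = k + (z - x) by ring.
  by apply: le_lt_trans (modulusD _ _) _; lra.
have [r [M [c [r0 r1 gPS]]]] := hol_PS rho0 Hg.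
split=> //; rewrite (PS_coef n r0 _ gPS); last first.
  by apply: (hol_sub Hg); rewrite subrr modulus0; lra.
rewrite (PS_coef n r0 _ (c := c) (M := M)) //.
  by apply: (hol_sub Hh); rewrite subrr modulus0; lra.
case: gPS => cM gPS; split => // w N wr; rewrite -gh; first exact: gPS.
by rewrite addrAC subrr add0r; lra.
Qed.

Lemma PS_sub (g : C -> C) x (rho r M : R) c : 0 < r -> r <= rho -> PS g x rho M c -> PS g x r M c.
Proof.
move=> r0 rr gPS; have M0 := PS_ge0 gPS; case: gPS => cM gPS; split=> [n|w N wr].
  apply: le_trans (cM n) _; apply: ler_wpM2l => //.
  rewrite lef_pV2 ?posrE ?exprn_gt0//; last by lra.
  by apply: lerXn2r; rewrite ?nnegrE; lra.
have w1 : mod w < rho by lra.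
have ww : mod w / rho <= mod w / r.
  by apply: ler_wpM2l; [exact: modulus_ge0|rewrite lef_pV2 ?posrE; lra].
have q0 : 0 <= mod w / rho by apply: ratio_ge0; lra.
apply: (@le_trans _ _ (mod (g (x + w) - psum c N w) * (1 - mod w / rho))).
  by apply: ler_wpM2l; [exact: modulus_ge0|lra].
apply: le_trans (gPS w N w1) _; apply: ler_wpM2l => //.
by apply: lerXn2r => //; rewrite nnegrE; lra.
Qed.

Lemma PSD (g1 g2 : C -> C) x (rho M1 M2 : R) c1 c2 : 0 < rho -> PS g1 x rho M1 c1 -> PS g2 x rho M2 c2 ->
  PS (fun z => g1 z + g2 z) x rho (M1 + M2) (fun n => c1 n + c2 n).
Proof.
move=> rho0 [cM1 PS1] [cM2 PS2]; split=> [n|w N wr].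
  by apply: le_trans (modulusD _ _) _; rewrite mulrDl; exact: lerD.
have -> : psum (fun n => c1 n + c2 n) N w = psum c1 N w + psum c2 N w.
  by rewrite /psum -big_split; apply: eq_bigr => n _; rewrite mulrDl.
rewrite opprD addrACA mulrDl.
apply: le_trans (lerD (PS1 w N wr) (PS2 w N wr)).
rewrite -mulrDl; apply: ler_wpM2r; last exact: modulusD.
by rewrite subr_ge0; apply: ltW; exact: ratio_lt1.
Qed.

Lemma PSZ k (g : C -> C) x (rho M : R) c : PS g x rho M c ->
  PS (fun z => k * g z) x rho (mod k * M) (fun n => k * c n).
Proof.
move=> [cM gPS]; split=> [n|w N wr].
  by rewrite modulusM -mulrA; apply: ler_wpM2l; [exact: modulus_ge0|exact: cM].
have -> : psum (fun n => k * c n) N w = k * psum c N w.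
  by rewrite /psum mulr_sumr; apply: eq_bigr => n _; rewrite mulrA.
rewrite -mulrBr modulusM -!mulrA; apply: ler_wpM2l; [exact: modulus_ge0|exact: gPS].
Qed.

Lemma holD (g h : C -> C) x (rho : R) : hol g x rho -> hol h x rho -> hol (fun z => g z + h z) x rho.
Proof. by move=> Hg Hh z zr; apply: derivableD; [exact: Hg|exact: Hh]. Qed.

Lemma holM (g h : C -> C) x (rho : R) : hol g x rho -> hol h x rho -> hol (fun z => g z * h z) x rho.
Proof. by move=> Hg Hh z zr; apply: derivableM; [exact: Hg|exact: Hh]. Qed.

Lemma hol_cst k x (rho : R) : hol (fun=> k) x rho.
Proof. by move=> z _; exact: derivable_cst. Qed.

Lemma tcoefD n (g h : C -> C) x (rho : R) : 0 < rho -> hol g x rho -> hol h x rho ->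
  tcoef n (fun z => g z + h z) x = tcoef n g x + tcoef n h x.
Proof.
move=> rho0 Hg Hh.
have [r1 [M1 [c1 [r10 r1r PS1]]]] := hol_PS rho0 Hg.
have [r2 [M2 [c2 [r20 r2r PS2]]]] := hol_PS rho0 Hh.
pose r := Num.min r1 r2.
have r0 : 0 < r by rewrite lt_min r10.
have ra : r <= r1 by rewrite ge_min lexx.
have rb : r <= r2 by rewrite ge_min lexx orbT.
have {PS1}PS1 := PS_sub r0 ra PS1; have {PS2}PS2 := PS_sub r0 rb PS2.
have S k : hol k x rho -> hol k x r.
  by move=> Hk; apply: (hol_sub Hk); rewrite subrr modulus0; lra.
rewrite (PS_coef n r0 (S _ Hg) PS1) (PS_coef n r0 (S _ Hh) PS2).
by rewrite (PS_coef n r0 (S _ (holD Hg Hh)) (PSD r0 PS1 PS2)).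
Qed.

Lemma tcoefZ n k (g : C -> C) x (rho : R) : 0 < rho -> hol g x rho ->
  tcoef n (fun z => k * g z) x = k * tcoef n g x.
Proof.
move=> rho0 Hg; have [r [M [c [r0 rr gPS]]]] := hol_PS rho0 Hg.
have Hr : hol g x r by apply: (hol_sub Hg); rewrite subrr modulus0; lra.
rewrite (PS_coef n r0 Hr gPS).
by rewrite (PS_coef n r0 (holM (@hol_cst k x r) Hr) (PSZ k gPS)).
Qed.

Lemma tcoefB n (g h : C -> C) x (rho : R) : 0 < rho -> hol g x rho -> hol h x rho ->
  tcoef n (fun z => g z - h z) x = tcoef n g x - tcoef n h x.
Proof.
move=> rho0 Hg Hh; have Hh' : hol (fun z => -1 * h z) x rho.
  exact: (@holM (fun=> -1) h x rho (@hol_cst (-1) x rho) Hh).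
have E : (fun z => g z - h z) = (fun z => g z + -1 * h z).
  by apply/funext => z; rewrite mulN1r.
by rewrite E (tcoefD n rho0 Hg Hh') (tcoefZ n (-1) rho0 Hh) mulN1r.
Qed.

Lemma tcoef_sum n k (h : 'I_k -> C -> C) x (rho : R) : 0 < rho -> (forall i, hol (h i) x rho) ->
  hol (fun z => \sum_(i < k) h i z) x rho /\
  tcoef n (fun z => \sum_(i < k) h i z) x = \sum_(i < k) tcoef n (h i) x.
Proof.
move=> rho0; elim: k h => [|k IH] h Hh.
  have -> : (fun z => \sum_(i < 0) h i z) = (fun=> 0).
    by apply/funext => z; rewrite big_ord0.
  split; first exact: hol_cst.
  rewrite big_ord0; have := tcoefZ n 0 rho0 (@hol_cst 1 x rho).
  by rewrite (_ : (fun=> 0 * 1) = (fun=> 0 : C)) ?mul0r//; apply/funext => z; rewrite mul0r.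
have -> : (fun z => \sum_(i < k.+1) h i z) =
    (fun z => h ord0 z + \sum_(i < k) h (lift ord0 i) z).
  by apply/funext => z; rewrite big_ord_recl.
have [H1 H2] := IH (fun i => h (lift ord0 i)) (fun i => Hh _).
split; first exact: (@holD (h ord0) _ x rho (Hh _) H1).
rewrite big_ord_recl -H2.
exact: (@tcoefD n (h ord0) _ x rho rho0 (Hh _) H1).
Qed.

(** Cauchy's inequality on a circle of radius r gives B r^(m - n), and r is arbitrarily small. *)
Lemma tcoef_bigO n (g : C -> C) (rho B : R) m : 0 < rho -> hol g 0 rho ->
  (forall z, mod z < rho -> mod (g z) <= B * mod z ^+ m) -> (n < m)%N ->
  tcoef n g 0 = 0.
Proof.
move=> rho0 Hg gB nm; apply/eqP; rewrite -modulus_eq0 eq_le modulus_ge0 andbT.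
apply/ler_addgt0Pr => e e0; rewrite add0r.
have B0 : 0 <= B.
  have := gB ((rho / 2)%:C)%C; rewrite modulusR gtr0_norm; last by lra.
  have p : 0 < (rho / 2) ^+ m by rewrite exprn_gt0//; lra.
  move=> H; rewrite -(ler_pM2r p) mul0r; apply: le_trans (H _); last by lra.
  exact: modulus_ge0.
pose r := Num.min (Num.min 1 (rho / 2)) (e / (B + 1)).
have r0 : 0 < r.
  rewrite !lt_min; apply/andP; split; last by apply: divr_gt0 => //; lra.
  by apply/andP; split; lra.
have r1 : r <= 1 by rewrite !ge_min lexx.
have r2 : r <= rho / 2 by rewrite !ge_min lexx orbT.
have : r <= e / (B + 1) by rewrite !ge_min lexx !orbT.
rewrite ler_pdivlMr; last by lra.
clearbody r => re.
have gr z : mod (z - 0) = r -> mod (g z) <= B * r ^+ m.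
  by rewrite subr0 => zr; rewrite -[in leRHS]zr; apply: gB; lra.
have dg z : mod (z - 0) <= r -> derivable g z 1 by move=> zr; apply: Hg; lra.
apply: le_trans (tcoef_le n r0 dg gr) _.
rewrite -mulrA -expfB// ; last first.
have : r ^+ (m - n) <= r.
  by rewrite -[leRHS]expr1; apply: ler_wiXn2l; rewrite ?subn_gt0//; lra.
by move=> H; have := ler_wpM2l B0 H; nra.
Qed.

End Coef.

(** * Holomorphic dependence on a parameter and mean squares on circles *)

Section Param.
Variable R : realType.
Local Notation C := (Cx R).
Local Notation mod := (@modulus R).

Lemma derivable_avg m (h : C -> C -> C) (e : C) :
  (forall u, mod u = 1 -> derivable (fun e => h e u) e 1) ->
  derivable (fun e => avg m (h e)) e 1.
Proof.
move=> dh; rewrite /avg; apply: derivableM; first exact: derivable_cst.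
have -> : (fun e => \sum_(k < dysize m) h e (dyroot R m ^+ k)) =
    \sum_(k < dysize m) (fun e => h e (dyroot R m ^+ k)).
  by apply/funext => e'; rewrite fct_sumE.
by apply: derivable_sum => k; apply: dh; exact: dyrootX_mod.
Qed.

(** The coefficient is the pointwise limit of finite averages, each derivable in e, with uniform
    bounds; [vitali] gives an expansion of the limit. Derivability in z and in e is needed only
    separately, and in e only on the circle |z| = r. *)
Lemma tcoef_param n (g : C -> C -> C) (e0 : C) (s r M : R) : 0 < s -> 0 < r ->
  (forall e z, mod (e - e0) <= s -> mod z <= r -> derivable (g e) z 1) ->
  (forall e z, mod (e - e0) <= s -> mod z = r -> derivable (g ^~ z) e 1) ->
  (forall e z, mod (e - e0) <= s -> mod z = r -> mod (g e z) <= M) ->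
  derivable (fun e => tcoef n (g e) 0) e0 1.
Proof.
move=> s0 r0 dz de gM; set rC := (r%:C)%C.
have rm u : mod u = 1 -> mod (rC * u) = r.
  by move=> u1; rewrite modulusM u1 mulr1 modulusR gtr0_norm.
pose h m e := avg m (fun u => g e (0 + rC * u) * (rC * u) ^- n).
have hPS m : PS (h m) e0 s (M / r ^+ n) (fun k => tcoef k (h m) e0).
  have [//|||] := @taylor _ (h m) e0 s (M / r ^+ n).
  - move=> e es; apply: derivable_avg => u u1; apply: derivableM.
      by apply: de => //; rewrite add0r rm.
    exact: derivable_cst.
  - move=> e es; apply: avg_le => u u1.
    rewrite modulusM modulusV modulusX rm//; apply: ler_wpM2r.
      by rewrite invr_ge0 exprn_ge0// ltW.
    by apply: gM; rewrite ?add0r ?rm// es.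
  by [].
have [|c cPS _] := @vitali _ e0 s (M / r ^+ n) h (fun m k => tcoef k (h m) e0)
   (fun e => tcoef n (g e) 0) s0 hPS.
  move=> w ws; have wle : mod (e0 + w - e0) <= s by rewrite addrAC subrr add0r ltW.
  have [||_] := @taylor _ (g (e0 + w)) 0 r M r0.
  - by move=> z; rewrite subr0; exact: dz.
  - by move=> z; rewrite subr0; exact: gM.
  exact.
by apply/derivable_has; exists (c 1%N); exact: PS_has_deriv cPS.
Qed.

Definition avgR m (H : C -> R) : R := (dysize m)%:R^-1 * \sum_(k < dysize m) H (dyroot R m ^+ k).

Lemma avgRE m H : ((avgR m H)%:C)%C = avg m (fun u => ((H u)%:C)%C) :> C.
Proof. by rewrite /avgR rmorphM fmorphV rmorph_nat rmorph_sum. Qed.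

Lemma avgR_le m H1 H2 : (forall u, mod u = 1 -> H1 u <= H2 u) -> avgR m H1 <= avgR m H2.
Proof.
move=> H; apply: ler_wpM2l; first by rewrite invr_ge0.
by apply: ler_sum => k _; apply: H; exact: dyrootX_mod.
Qed.

Lemma avgRD m H1 H2 : avgR m (fun u => H1 u + H2 u) = avgR m H1 + avgR m H2.
Proof. by rewrite /avgR big_split mulrDr. Qed.

Lemma avgRZ m k H : avgR m (fun u => k * H u) = k * avgR m H.
Proof. by rewrite /avgR -mulr_sumr mulrCA. Qed.

Lemma avgR_cst m k : avgR m (fun=> k) = k.
Proof.
rewrite /avgR sumr_const card_ord -[k *+ _]mulr_natl mulKf//.
by rewrite pnatr_eq0 -lt0n dysize_gt0.
Qed.

Lemma avgR_sum m n (h : 'I_n -> C -> R) :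
  avgR m (fun u => \sum_(i < n) h i u) = \sum_(i < n) avgR m (h i).
Proof. by rewrite /avgR exchange_big /= mulr_sumr. Qed.

Lemma conj_unit (u : C) : mod u = 1 -> (u^*)%C = u^-1.
Proof.
move=> u1; have := mulCJ u; rewrite u1 expr1n => E.
have u0 : u != 0 by rewrite -modulus_gt0 u1.
by apply: (mulfI u0); rewrite divff.
Qed.

Lemma avg_orth m i j : (i < dysize m)%N -> (j < dysize m)%N ->
  avg m (fun u : C => u ^+ i * u ^- j) = (i == j)%:R.
Proof.
move=> iN jN; have E (u : C) a b : mod u = 1 -> u ^+ (a + b) * u ^- b = u ^+ a.
  by move=> u1; rewrite exprD mulfK// expf_neq0// -modulus_gt0 u1.
have E' (u : C) a b : mod u = 1 -> u ^+ b * u ^- (a + b) = u ^- a.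
  move=> u1; rewrite exprD invfM mulrCA mulrV ?mulr1//.
  by rewrite unitfE expf_neq0// -modulus_gt0 u1.
have [ij|ij|->] := ltngtP i j.
- rewrite (avg_ext _ (h2 := fun u => u ^- (j - i))); last first.
    by move=> u u1; have := E' u (j - i)%N i u1; rewrite (subnK (ltnW ij)).
  by rewrite avg_expV// subn_gt0 ij (leq_ltn_trans (leq_subr _ _)).
- rewrite (avg_ext _ (h2 := fun u => u ^+ (i - j))); last first.
    by move=> u u1; have := E u (i - j)%N j u1; rewrite (subnK (ltnW ij)).
  by rewrite avg_exp// subn_gt0 ij (leq_ltn_trans (leq_subr _ _)).
rewrite -[RHS](avg_cst m); apply: avg_ext => u u1.
by rewrite divff// expf_neq0// -modulus_gt0 u1.
Qed.

Lemma conjM (x y : C) : ((x * y)^*)%C = (x^*)%C * (y^*)%C.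
Proof. exact: rmorphM. Qed.

Lemma conj_sum n (h : 'I_n -> C) : ((\sum_(i < n) h i)^*)%C = \sum_(i < n) ((h i)^*)%C :> C.
Proof. exact: rmorph_sum. Qed.

Lemma conj_poly (b : nat -> C) L (u : C) : mod u = 1 ->
  ((\sum_(i < L) b i * u ^+ i)^*)%C = \sum_(i < L) ((b i)^*)%C * u ^- i.
Proof.
move=> u1; rewrite conj_sum; apply: eq_bigr => i _.
have -> : ((b i * u ^+ i)^*)%C = ((b i)^*)%C * ((u^*)%C) ^+ i.
  by rewrite rmorphM rmorphXn.
by congr (_ * _); rewrite -exprVn; congr (_ ^+ _); exact: conj_unit.
Qed.

(** Exact for every such m: monomials of distinct degrees below the number of nodes are orthogonal
    for the discrete average. *)
Lemma parseval m (b : nat -> C) L : (L <= dysize m)%N ->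
  avgR m (fun u => mod (\sum_(i < L) b i * u ^+ i) ^+ 2) = \sum_(i < L) mod (b i) ^+ 2.
Proof.
move=> LN; apply: complexI; rewrite avgRE rmorph_sum.
rewrite (avg_ext _ (h2 := fun u => \sum_(i < L) b i * \sum_(j < L)
    ((b j)^*)%C * (u ^+ i * u ^- j))).
  rewrite avg_sum; apply: eq_bigr => i _; rewrite avgZ avg_sum (bigD1 i)//= big1.
    have iN : (i < dysize m)%N by exact: leq_trans LN.
    by rewrite addr0 avgZ avg_orth// eqxx mulr1 mulCJ.
  move=> j ji; have iN : (i < dysize m)%N by exact: leq_trans LN.
  have jN : (j < dysize m)%N by exact: leq_trans LN.
  rewrite avgZ avg_orth//.
  by rewrite (_ : (i == j :> nat) = false) ?mulr0//; rewrite eq_sym; apply: negbTE.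
move=> u u1; rewrite -mulCJ conj_poly// mulr_suml; apply: eq_bigr => i _.
rewrite -mulrA; congr (_ * _); rewrite mulr_sumr; apply: eq_bigr => j _.
by rewrite mulrCA.
Qed.

(** The mean of |h - p|^2 is nonnegative, p being the projection of h on the monomials of degree
    below L; no regularity of h is involved. *)
Lemma bessel m (h : C -> C) L : (L <= dysize m)%N ->
  \sum_(i < L) mod (avg m (fun u => h u * u ^- i)) ^+ 2 <= avgR m (fun u => mod (h u) ^+ 2).
Proof.
move=> LN; pose d i := avg m (fun u => h u * u ^- i).
pose p u := \sum_(i < L) d i * u ^+ i.
set S := \sum_(i < L) _.
suff E : avgR m (fun u => mod (h u - p u) ^+ 2) = avgR m (fun u => mod (h u) ^+ 2) - S.
  rewrite -subr_ge0 -E mulr_ge0 ?invr_ge0// sumr_ge0// => i _; exact: sqr_ge0.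
have P : avgR m (fun u => mod (p u) ^+ 2) = S by rewrite parseval.
have X : avg m (fun u => h u * ((p u)^*)%C) = (S%:C)%C.
  rewrite (avg_ext _ (h2 := fun u => \sum_(i < L) ((d i)^*)%C * (h u * u ^- i))).
    rewrite avg_sum rmorph_sum; apply: eq_bigr => i _.
    by rewrite avgZ -/(d i) -[RHS]/((mod (d i) ^+ 2)%:C)%C -mulCJ mulrC.
  move=> u u1; rewrite conj_poly// mulr_sumr; apply: eq_bigr => i _.
  by rewrite mulrCA.
have Y : avg m (fun u => p u * ((h u)^*)%C) = (S%:C)%C.
  rewrite -[RHS]conjc_real -X /avg rmorphM fmorphV rmorph_nat rmorph_sum.
  congr (_ * _); apply: eq_bigr => k _.
  rewrite -[RHS]/((h (dyroot R m ^+ k) * ((p (dyroot R m ^+ k))^*)%C)^*)%C.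
  by rewrite conjM conjcK mulrC.
apply: complexI; rewrite rmorphB /= !avgRE.
rewrite (avg_ext _ (h2 := fun u => (((mod (h u) ^+ 2)%:C)%C + ((mod (p u) ^+ 2)%:C)%C) -
    (h u * ((p u)^*)%C + p u * ((h u)^*)%C))); last first.
  by move=> u u1; rewrite -!mulCJ [X in _ * X]rmorphB /=; ring.
by rewrite avgB !avgD X Y -(avgRE _ (fun u => mod (p u) ^+ 2)) P; ring.
Qed.

Lemma PS_mulX (g : C -> C) (rho M : R) c : 0 < rho -> PS g 0 rho M c ->
  PS (fun z => z * g z) 0 rho (M * rho) (fun n => if n is n'.+1 then c n' else 0).
Proof.
move=> rho0 gPS; have M0 := PS_ge0 gPS; case: gPS => cM gPS; split=> [[|n]|w N wr].
- by rewrite modulus0 divr_ge0 ?exprn_ge0 ?mulr_ge0// ltW.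
- apply: le_trans (cM n) _; rewrite exprS invfM mulrA mulfK//; exact: lt0r_neq0.
have w0 := modulus_ge0 w.
have q0 := ratio_ge0 w rho0; have q1 := ratio_lt1 rho0 wr.
have E : M * rho * (mod w / rho) = mod w * M by field; exact: lt0r_neq0.
have q2 : 0 <= 1 - mod w / rho by rewrite subr_ge0 ltW.
have K N' : mod (w * (g (0 + w) - psum c N' w)) * (1 - mod w / rho) <=
    M * rho * (mod w / rho) ^+ N'.+1.
  have -> : M * rho * (mod w / rho) ^+ N'.+1 = mod w * (M * (mod w / rho) ^+ N').
    by rewrite exprS mulrA E -mulrA.
  by rewrite modulusM -mulrA; apply: ler_wpM2l => //; exact: gPS.
case: N => [|N].
  have := gPS w 0%N wr; rewrite /psum !big_ord0 !subr0 !expr0 !mulr1 add0r => H.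
  rewrite modulusM -mulrA mulrC; apply: ler_pM => //; last exact: ltW.
  by rewrite mulr_ge0// modulus_ge0.
have -> : psum (fun n => if n is n'.+1 then c n' else 0) N.+1 w = w * psum c N w.
  rewrite /psum big_ord_recl mul0r add0r mulr_sumr; apply: eq_bigr => n _ /=.
  by rewrite exprS mulrCA.
have -> : (0 + w) * g (0 + w) - w * psum c N w = w * (g (0 + w) - psum c N w).
  by rewrite add0r mulrBr.
exact: K.
Qed.

(** The Euler operator is diagonal on monomials: this is the source of the factor n e in the
    recursion. *)
Lemma tcoef_zderiv n (g : C -> C) (rho : R) : 0 < rho -> hol g 0 rho ->
  hol (fun z => z * derive1 g z) 0 rho /\
  tcoef n (fun z => z * derive1 g z) 0 = n%:R * tcoef n g 0.
Proof.
move=> rho0 Hg.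
have Hz : hol (fun z => z * derive1 g z) 0 rho.
  move=> z zr; apply: derivableM; first exact: derivable_id.
  exact: (hol_derive1 Hg).
split=> //; have [r [M [c [r0 rr gPS]]]] := hol_PS rho0 Hg.
have Hr : hol g 0 r by apply: (hol_sub Hg); rewrite subrr modulus0; lra.
have r20 : 0 < r / 2 by lra.
have [|M' dPS] := @PS_derive1 _ g 0 r (r / 2) M c r20 _ Hr gPS; first by lra.
have Hz2 : hol (fun z => z * derive1 g z) 0 (r / 2).
  by apply: (hol_sub Hz); rewrite subrr modulus0; lra.
rewrite (PS_coef n r20 Hz2 (PS_mulX r20 dPS)) (PS_coef n r0 Hr gPS).
by case: n => [|n]; rewrite ?mul0r.
Qed.

Lemma cvg_modulus (T : Type) (F : set_system T) {FF : Filter F} (u : T -> C) (l : C) :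
  u @ F --> l -> (fun t => mod (u t)) @ F --> mod l.
Proof.
move=> /cvgC_P H; apply/cvgrPdist_le => e /H; apply: filterS => t ut.
rewrite ler_norml; have := modulusDB l (u t); have := modulusDB (u t) l.
by rewrite (modulusBC l); move=> *; apply/andP; split; lra.
Qed.

(** Bessel's inequality for z g' on |z| = r, in the limit of many nodes. The pointwise bound [B']
    makes Cauchy's formula available for z g'; the mean square bound [B] gives the estimate. *)
Lemma tcoef_sq_sum (g : C -> C) (r B B' : R) L : 0 < r ->
  (forall z, mod z <= r -> exists2 rho, 0 < rho & hol g z rho) ->
  (forall z, mod z = r -> mod (z * derive1 g z) <= B') ->
  (\forall m \near \oo, avgR m (fun u => mod ((r%:C)%C * u * derive1 g ((r%:C)%C * u)) ^+ 2) <= B) ->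
  \sum_(i < L) (i%:R * mod (tcoef i g 0) * r ^+ i) ^+ 2 <= B.
Proof.
move=> r0 Hg kB' kB; pose k z := z * derive1 g z; set rC : C := (r%:C)%C in kB *.
have rCn : mod rC = r by rewrite modulusR gtr0_norm.
have rC0 : rC != 0 by rewrite -modulus_gt0 rCn.
have dk z : mod (z - 0) <= r -> derivable k z 1.
  rewrite subr0 => /Hg[rho rho0 Hz].
  apply: derivableM; first exact: derivable_id.
  by apply: (hol_derive1 Hz); rewrite subrr modulus0.
have kb z : mod (z - 0) = r -> mod (k z) <= B' by rewrite subr0; exact: kB'.
have [_ Hk] := taylor r0 dk kb.
have cE i : tcoef i k 0 = i%:R * tcoef i g 0.
  have [|rho rho0 H0] := Hg 0; first by rewrite modulus0 ltW.
  by have [] := tcoef_zderiv i rho0 H0.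
pose X m := \sum_(i < L) mod (avg m (fun u => k (rC * u) * u ^- i)) ^+ 2.
have Xc : X m @[m --> \oo] --> \sum_(i < L) (i%:R * mod (tcoef i g 0) * r ^+ i) ^+ 2.
  have H i : mod (avg m (fun u => k (rC * u) * u ^- i)) ^+ 2 @[m --> \oo] -->
      (i%:R * mod (tcoef i g 0) * r ^+ i) ^+ 2.
    have : avg m (fun u => k (rC * u) * u ^- i) @[m --> \oo] --> rC ^+ i * tcoef i k 0.
      have -> : (fun m => avg m (fun u => k (rC * u) * u ^- i)) =
          (fun m => rC ^+ i * avg m (fun u => k (0 + rC * u) * (rC * u) ^- i)).
        apply/funext => m; rewrite -avgZ; apply: avg_ext => u u1; rewrite add0r.
        by rewrite exprMn invfM [k _ * (_ * _)]mulrCA mulVKf// expf_neq0.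
      by apply: cvgM; [exact: cvg_cst|exact: Hk].
    move=> /cvg_modulus; rewrite cE modulusM modulusX rCn modulusM modulus_nat.
    rewrite (mulrC (r ^+ i)) => Hm; rewrite expr2; under eq_fun do rewrite expr2.
    exact: cvgM.
  rewrite /X; elim: L {X} => [|n IH].
    rewrite big_ord0; under eq_fun do rewrite big_ord0; exact: cvg_cst.
  rewrite big_ord_recr; under eq_fun do rewrite big_ord_recr /=.
  exact: cvgD.
have XB : \forall m \near \oo, X m <= B.
  have LN : \forall m \near \oo, (L <= m)%N by exists L.
  apply: filterS2 LN kB => m LN kB; apply: le_trans kB.
  apply: bessel; exact: leq_trans LN (ltnW (dysize_gt m)).
rewrite leNgt; apply/negP => lt.
have e0 : 0 < (\sum_(i < L) (i%:R * mod (tcoef i g 0) * r ^+ i) ^+ 2 - B) / 2.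
  by rewrite divr_gt0// subr_gt0.
move/cvgrPdist_le : Xc => /(_ _ e0) Xc.
have /filter_ex[m [Hm1 Hm2]] : \forall m \near \oo,
   `|\sum_(i < L) (i%:R * mod (tcoef i g 0) * r ^+ i) ^+ 2 - X m| <=
     (\sum_(i < L) (i%:R * mod (tcoef i g 0) * r ^+ i) ^+ 2 - B) / 2 /\ X m <= B.
  by apply: filterS2 Xc XB.
move: Hm1 Hm2 lt; set S := \sum_(i < L) _; set x := X m.
by rewrite ler_norml => /andP[_ H1] H2 H3; lra.
Qed.

End Param.

(** * Resolvent bounds *)

Section LinearAlgebra.
Variable R : realType.
Local Notation C := (Cx R).
Local Notation mod := (@modulus R).

Definition l1 nu (v : 'rV[C]_nu) : R := \sum_j mod (v ord0 j).

Lemma l1_ge0 nu (v : 'rV[C]_nu) : 0 <= l1 v.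
Proof. by apply: sumr_ge0 => j _; exact: modulus_ge0. Qed.

Lemma l1_0 nu : l1 (0 : 'rV[C]_nu) = 0.
Proof. by apply: big1 => j _; rewrite mxE modulus0. Qed.

Lemma l1D nu (v w : 'rV[C]_nu) : l1 (v + w) <= l1 v + l1 w.
Proof.
by rewrite /l1 -big_split; apply: ler_sum => j _; rewrite mxE; exact: modulusD.
Qed.

Lemma l1Z nu a (v : 'rV[C]_nu) : l1 (a *: v) = mod a * l1 v.
Proof. by rewrite /l1 mulr_sumr; apply: eq_bigr => j _; rewrite mxE modulusM. Qed.

Lemma l1N nu (v : 'rV[C]_nu) : l1 (- v) = l1 v.
Proof. by rewrite /l1; apply: eq_bigr => j _; rewrite mxE modulusN. Qed.

Lemma l1B nu (v w : 'rV[C]_nu) : l1 (v - w) <= l1 v + l1 w.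
Proof. by rewrite -(l1N w) l1D. Qed.

Lemma l1DB nu (v w : 'rV[C]_nu) : l1 v - l1 w <= l1 (v + w).
Proof.
have := l1B (v + w) w; rewrite addrK; lra.
Qed.

Lemma l1_comp nu (v : 'rV[C]_nu) j : mod (v ord0 j) <= l1 v.
Proof.
by rewrite /l1 (bigD1 j) //= lerDl sumr_ge0// => i _; exact: modulus_ge0.
Qed.

Lemma l1_eq0 nu (v : 'rV[C]_nu) : l1 v <= 0 -> v = 0.
Proof.
move=> v0; apply/rowP => j; rewrite mxE; apply/eqP; rewrite -modulus_eq0 eq_le.
by rewrite modulus_ge0 andbT (le_trans (l1_comp v j)).
Qed.

Lemma l1_sum nu n (h : 'I_n -> 'rV[C]_nu) : l1 (\sum_(i < n) h i) <= \sum_(i < n) l1 (h i).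
Proof.
elim/big_rec2: _ => [|i x y _ IH]; first by rewrite l1_0.
by apply: le_trans (l1D _ _) _; rewrite lerD2l.
Qed.

Lemma l1_mul nu (v : 'rV[C]_nu) (A : 'M[C]_nu) (b : R) :
  (forall i j, mod (A i j) <= b) -> l1 (v *m A) <= nu%:R * b * l1 v.
Proof.
move=> Ab; rewrite mulrAC -mulrA mulr_natl /l1.
have -> : (\sum_j mod (v ord0 j)) * b *+ nu = \sum_(j < nu) ((\sum_i mod (v ord0 i)) * b).
  by rewrite sumr_const card_ord.
apply: ler_sum => j _; rewrite mxE mulr_suml; apply: le_trans (ler_modulus_sum _ _ _) _.
by apply: ler_sum => i _; rewrite modulusM; apply: ler_wpM2l => //; exact: modulus_ge0.
Qed.

Lemma Arg_acos (z : C) : z != 0 -> `|Arg z| = acos (complex.Re z / mod z).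
Proof.
rewrite -modulus_gt0 => z0; have := Re_modulus z; rewrite ler_norml => /andP[z1 z2].
have B : -1 <= complex.Re z / mod z <= 1.
  by rewrite ler_pdivlMr// ler_pdivrMr// mulN1r mul1r z1.
by rewrite /Arg; case: ifP => _; rewrite ?normrN ger0_norm// acos_ge0.
Qed.

(** The cosine is decreasing on [0, pi], so a condition on the argument becomes an inequality
    between Lipschitz functions of z. *)
Lemma Arg_lt (z : C) (th : R) : z != 0 -> 0 <= th <= pi ->
  (`|Arg z| < th) = (cos th * mod z < complex.Re z).
Proof.
move=> z0 th0; rewrite Arg_acos//; rewrite -modulus_gt0 in z0.
have := Re_modulus z; rewrite ler_norml => /andP[z1 z2].
have B : -1 <= complex.Re z / mod z <= 1.
  by rewrite ler_pdivlMr// ler_pdivrMr// mulN1r mul1r z1.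
have [ac1 ac2] := acos_def B.
by rewrite -(@ltr_cos _ (acos _) th) ?in_itv//= ac2 ltr_pdivlMr.
Qed.

Lemma lt_Arg (z : C) (th : R) : z != 0 -> 0 <= th <= pi ->
  (th < `|Arg z|) = (complex.Re z < cos th * mod z).
Proof.
move=> z0 th0; rewrite Arg_acos//; rewrite -modulus_gt0 in z0.
have := Re_modulus z; rewrite ler_norml => /andP[z1 z2].
have B : -1 <= complex.Re z / mod z <= 1.
  by rewrite ler_pdivlMr// ler_pdivrMr// mulN1r mul1r z1.
have [ac1 ac2] := acos_def B.
by rewrite -ltr_cos ?in_itv//= ac2 ltr_pdivrMr.
Qed.

Lemma Arg_le_pi (z : C) : z != 0 -> `|Arg z| <= pi.
Proof.
move=> z0; rewrite Arg_acos//; rewrite -modulus_gt0 in z0.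
have := Re_modulus z; rewrite ler_norml => /andP[z1 z2]; apply: acos_lepi.
by rewrite ler_pdivlMr// ler_pdivrMr// mulN1r mul1r z1.
Qed.

Lemma Arg_scale (z : C) (x : R) : 0 < x -> z != 0 -> `|Arg ((x%:C)%C * z)| = `|Arg z|.
Proof.
move=> x0 z0; have x0' : (x%:C)%C != 0 :> C by rewrite -modulus_gt0 modulusR gtr0_norm.
rewrite !Arg_acos ?mulf_neq0// modulusM modulusR gtr0_norm//.
have -> : complex.Re ((x%:C)%C * z) = x * complex.Re z by case: z {z0} => a b /=; ring.
by rewrite -mulf_div divff ?mul1r// lt0r_neq0.
Qed.

(** The function Re t - cos th |t| is positive on the sector, negative at lam, and Lipschitz with
    constant 2; half of its gap at lam is a lower bound valid for all t of the infinite sector. *)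
Lemma sector_dist (lam : C) (th : R) : lam != 0 -> 0 < th -> th < `|Arg lam| ->
  exists2 d : R, 0 < d & forall t : C, t != 0 -> `|Arg t| < th -> d <= mod (t - lam).
Proof.
move=> l0 th0 thl; have th1 : 0 <= th <= pi.
  by apply/andP; split; [exact: ltW|apply: ltW; exact: lt_le_trans (Arg_le_pi l0)].
move: thl; rewrite lt_Arg// => H.
exists ((cos th * mod lam - complex.Re lam) / 2) => [|t t0]; first by lra.
rewrite Arg_lt// => Ht.
have := Re_modulus (t - lam); rewrite ler_norml => /andP[_].
have -> : complex.Re (t - lam) = complex.Re t - complex.Re lam by case: (t) => ? ?; case: (lam).
have m1 := modulusDB t lam; have m2 := modulusDB lam t.
rewrite (modulusBC lam) in m2.
have := cos_max th; rewrite ler_norml => /andP[c1 c2].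
set m := mod (t - lam) in m1 m2 *; set a := mod t in Ht m1 m2; set b := mod lam in H m1 m2 *.
by move=> HR; have : - m <= cos th * (a - b) by [nra]; lra.
Qed.

Lemma det_bound nu (A : 'M[C]_nu) (b : R) : 0 <= b -> (forall i j, mod (A i j) <= b) ->
  mod (\det A) <= #|{: {perm 'I_nu}}|%:R * b ^+ nu.
Proof.
move=> b0 Ab; apply: le_trans (ler_modulus_sum _ _ _) _.
have -> : #|{: {perm 'I_nu}}|%:R * b ^+ nu = \sum_(s : {perm 'I_nu}) b ^+ nu.
  by rewrite sumr_const mulr_natl.
apply: ler_sum => s _; rewrite modulusM modulusX modulusN modulus1 expr1n mul1r.
have -> : b ^+ nu = \prod_(i < nu) b by rewrite prodr_const card_ord.
elim/big_rec2: _ => [|i x y _ IH]; first by rewrite modulus1.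
by rewrite modulusM; apply: ler_pM => //; exact: modulus_ge0.
Qed.

Lemma adj_bound nu (b : R) : 0 <= b -> exists2 B : R, 0 <= B &
  forall A : 'M[C]_nu, (forall i j, mod (A i j) <= b) -> forall i j, mod ((\adj A) i j) <= B.
Proof.
move=> b0; exists (#|{: {perm 'I_nu.-1}}|%:R * b ^+ nu.-1).
  by rewrite mulr_ge0// exprn_ge0.
move=> A Ab i j; rewrite mxE /cofactor modulusM modulusX modulusN modulus1 expr1n mul1r.
by apply: det_bound => // k l; rewrite !mxE.
Qed.

(** For |t| >= T the term t v exceeds v J by at least the norm of v. For |t| < T the adjugate is
    bounded, and the determinant, a product of factors t - lambda over the eigenvalues, is bounded
    below by [sector_dist]. *)
Lemma resolvent nu (J : 'M[C]_nu) (th : R) : 0 < th -> J \in unitmx ->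
  (forall lam : C, eigenvalue J^T lam -> th < `|Arg lam|) ->
  exists2 kap : R, 0 < kap & forall t : C, t != 0 -> `|Arg t| < th ->
    forall v : 'rV[C]_nu, kap * l1 v <= l1 (v *m (t%:M - J)).
Proof.
move=> th0 Ju Hev.
have [rs Hrs] := closed_field_poly_normal (char_poly J).
rewrite (monicP (char_poly_monic J)) scale1r in Hrs.
have [del del0 Hdel] : exists2 del : R, 0 < del & forall t : C, t != 0 -> `|Arg t| < th ->
    del <= mod (\prod_(z <- rs) (t - z)).
  have : forall z, z \in rs -> z != 0 /\ th < `|Arg z|.
    move=> z zr; have zroot : root (char_poly J) z.
      by rewrite Hrs root_prod_XsubC.
    have ze : eigenvalue J^T z.
      rewrite eigenvalue_root_char; suff -> : char_poly J^T = char_poly J by [].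
      rewrite /char_poly -det_tr; congr (\det _); apply/matrixP => i j.
      by rewrite !mxE eq_sym.
    split; last exact: Hev.
    apply/eqP => z0; move: ze; rewrite z0 => /eigenvalueP[v /eqP].
    rewrite scale0r => /eqP vJ /negP; apply; apply/eqP.
    by rewrite -(mulmxK (_ : J^T \in unitmx) v) ?unitmx_tr// vJ mul0mx.
  elim: rs {Hrs} => [|z rs IH] H.
    by exists 1 => // t _ _; rewrite big_nil modulus1.
  have [|d1 d10 H1] := IH; first by move=> y yr; apply: H; rewrite inE yr orbT.
  have [z0 zA] := H z (mem_head _ _); have [d2 d20 H2] := sector_dist z0 th0 zA.
  exists (d2 * d1) => [|t t0 tA]; first exact: mulr_gt0.
  rewrite big_cons modulusM; apply: ler_pM; [exact: ltW|exact: ltW|exact: H2|exact: H1].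
pose b := \sum_i \sum_j mod (J i j).
have b0 : 0 <= b by apply: sumr_ge0 => i _; apply: sumr_ge0 => j _; exact: modulus_ge0.
have Jb i j : mod (J i j) <= b.
  rewrite /b (bigD1 i)//= (bigD1 j)//= -addrA lerDl addr_ge0// sumr_ge0// => k _.
    exact: modulus_ge0.
  by apply: sumr_ge0 => l _; exact: modulus_ge0.
clearbody b; pose T := nu%:R * b + 1.
have nb0 : 0 <= nu%:R * b by rewrite mulr_ge0.
have Tb0 : 0 <= T + b by rewrite /T; lra.
have [B B0 HB] := @adj_bound nu _ Tb0.
pose kap := Num.min 1 (del / (nu%:R * B + 1)).
have nB0 : 0 <= nu%:R * B by rewrite mulr_ge0.
have kap0 : 0 < kap by rewrite lt_min ltr01 divr_gt0//; lra.
exists kap => // t t0 tA v.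
have [Tt|tT] := leP T (mod t).
  apply: (@le_trans _ _ (l1 v)).
    by rewrite ler_piMl ?l1_ge0// ge_min lexx.
  rewrite mulmxBr mul_mx_scalar; have := l1DB (t *: v) (- (v *m J)).
  rewrite l1N l1Z; have := l1_mul v Jb; have := ler_wpM2r (l1_ge0 v) Tt.
  by rewrite /T; lra.
have detE : \det (t%:M - J) = \prod_(z <- rs) (t - z).
  have -> : \det (t%:M - J) = (char_poly J).[t].
    rewrite /char_poly -horner_evalE -det_map_mx; congr (\det _).
    by apply/matrixP => i j; rewrite !mxE /= horner_evalE !hornerE hornerMn hornerX.
  by rewrite Hrs horner_prod; apply: eq_bigr => z _; rewrite !hornerE.
have dd := Hdel t t0 tA; rewrite -detE in dd.
have adjB i j : mod ((\adj (t%:M - J)) i j) <= B.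
  apply: HB => k l; rewrite !mxE; apply: le_trans (modulusB _ _) _; apply: lerD => //.
  case: (k == l); rewrite ?mulr1n ?mulr0n ?modulus0; [exact: ltW|rewrite /T; lra].
have := l1_mul (v *m (t%:M - J)) adjB.
rewrite -mulmxA mul_mx_adj mul_mx_scalar l1Z => H.
set L := l1 (v *m _) in H *; have L0 : 0 <= L by exact: l1_ge0.
have v0 := l1_ge0 v; have H2 := ler_wpM2r v0 dd.
apply: (@le_trans _ _ (del / (nu%:R * B + 1) * l1 v)).
  by apply: ler_wpM2r => //; rewrite ge_min lexx orbT.
rewrite mulrAC ler_pdivrMr; last by lra.
nra.
Qed.

Lemma lower_unit nu (A : 'M[C]_nu) (k : R) : 0 < k ->
  (forall v : 'rV[C]_nu, k * l1 v <= l1 (v *m A)) ->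
  A \in unitmx /\ forall v : 'rV[C]_nu, l1 (v *m invmx A) <= k^-1 * l1 v.
Proof.
move=> k0 H; have Au : A \in unitmx.
  rewrite -row_free_unit; apply: inj_row_free => v vA; apply: l1_eq0.
  by rewrite -(ler_pM2l k0) mulr0 (le_trans (H v))// vA l1_0.
split=> // v; rewrite mulrC ler_pdivlMr// mulrC.
by apply: le_trans (H _) _; rewrite mulmxKV.
Qed.

(** Moving t and moving J each cost at most a quarter of kap, so half of the lower bound remains. *)
Lemma resolvent_pert nu (J J' : 'M[C]_nu) (kap d : R) (t0 t : C) : 0 < kap ->
  (forall v : 'rV[C]_nu, kap * l1 v <= l1 (v *m (t0%:M - J))) ->
  mod (t - t0) <= kap / 4 -> (forall i j, mod (J' i j - J i j) <= d) ->
  nu%:R * d <= kap / 4 ->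
  forall v : 'rV[C]_nu, kap / 2 * l1 v <= l1 (v *m (t%:M - J')).
Proof.
move=> k0 H tk JJ dd v.
have -> : v *m (t%:M - J') = v *m (t0%:M - J) + ((t - t0) *: v - v *m (J' - J)).
  by rewrite !mulmxBr !mul_mx_scalar scalerBl; apply/rowP => j; rewrite !mxE; ring.
have JJ' i j : mod ((J' - J) i j) <= d by rewrite !mxE.
have := l1_mul v JJ'; have := H v; have v0 := l1_ge0 v.
have := l1DB (v *m (t0%:M - J)) ((t - t0) *: v - v *m (J' - J)).
have := l1B ((t - t0) *: v) (v *m (J' - J)); rewrite l1Z.
have := ler_wpM2r v0 tk; have := ler_wpM2r v0 dd; lra.
Qed.

Lemma derivable_bigsum (I : Type) (r : seq I) (P : pred I) (h : I -> C -> C) x :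
  (forall i, derivable (h i) x 1) -> derivable (fun e => \sum_(i <- r | P i) h i e) x 1.
Proof.
move=> dh; elim: r => [|i r IH].
  by under eq_fun do rewrite big_nil; exact: derivable_cst.
under eq_fun do rewrite big_cons; case: (P i); last exact: IH.
apply: derivableD; [exact: dh|exact: IH].
Qed.

Lemma derivable_bigprod (I : Type) (r : seq I) (P : pred I) (h : I -> C -> C) x :
  (forall i, derivable (h i) x 1) -> derivable (fun e => \prod_(i <- r | P i) h i e) x 1.
Proof.
move=> dh; elim: r => [|i r IH].
  by under eq_fun do rewrite big_nil; exact: derivable_cst.
under eq_fun do rewrite big_cons; case: (P i); last exact: IH.
apply: derivableM; [exact: dh|exact: IH].
Qed.

Lemma derivable_det nu (A : C -> 'M[C]_nu) x :
  (forall i j, derivable (fun e => A e i j) x 1) -> derivable (fun e => \det (A e)) x 1.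
Proof.
move=> dA; rewrite /determinant; apply: derivable_bigsum => s.
apply: derivableM; first exact: derivable_cst.
by apply: derivable_bigprod.
Qed.

(** Near x the inverse is given by Cramer's rule, hence by polynomials in the entries of A divided
    by its determinant. *)
Lemma derivable_invmx nu (A : C -> 'M[C]_nu) x (rho : R) : 0 < rho ->
  (forall e, mod (e - x) < rho -> A e \in unitmx) ->
  (forall i j, derivable (fun e => A e i j) x 1) ->
  forall i j, derivable (fun e => invmx (A e) i j) x 1.
Proof.
move=> rho0 Au dA i j.
apply: (@near_eq_derivable _ _ _ (fun e => (\det (A e))^-1 * (\adj (A e)) i j)).
  apply/nbhsC_P; exists rho => // e er.
  by rewrite /invmx (Au e er) [in RHS]mxE.
apply: derivableM.
  apply: derivableV; last exact: derivable_det.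
  have : A x \in unitmx by apply: Au; rewrite subrr modulus0.
  by rewrite unitmxE unitfE.
have -> : (fun e => (\adj (A e)) i j) = (fun e => (-1) ^+ (j + i) * \det (row' j (col' i (A e)))).
  by apply/funext => e; rewrite mxE.
apply: derivableM; first exact: derivable_cst.
apply: derivable_det => k l.
have -> : (fun e => row' j (col' i (A e)) k l) = (fun e => A e (lift j k) (lift i l)).
  by apply/funext => e; rewrite !mxE.
exact: dA.
Qed.

End LinearAlgebra.

Arguments modulus : simpl never.

(** * Estimates on the vector field *)

Section Curves.
Variables (R : realType) (nu : nat).
Local Notation C := (Cx R).
Local Notation mod := (@modulus R).
Local Notation V := (C * C * 'rV[C]_nu)%type.

Lemma differentiable_row (y : C -> 'rV[C]_nu) (t : C) :
  (forall i, derivable (fun t => y t ord0 i) t 1) -> differentiable y t.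
Proof.
move=> dy; have -> : y = fun t => \sum_(i < nu) y t ord0 i *: delta_mx ord0 i.
  by apply/funext => t'; exact: row_sum_delta.
have -> : (fun t => \sum_(i < nu) y t ord0 i *: delta_mx ord0 i) =
   \sum_(i < nu) (fun t => y t ord0 i *: delta_mx ord0 i : 'rV[C]_nu).
  by apply/funext => t'; rewrite fct_sumE.
apply: differentiable_sum => i; apply: differentiableZl.
by apply/derivable1_diffP.
Qed.

Lemma curve_derivable (F : V -> 'rV[C]_nu) (e z : C -> C) (y : C -> 'rV[C]_nu) t j :
  derivable e t 1 -> derivable z t 1 -> (forall i, derivable (fun t => y t ord0 i) t 1) ->
  differentiable F (e t, z t, y t) ->
  derivable (fun t => F (e t, z t, y t) ord0 j) t 1.
Proof.
move=> /derivable1_diffP de /derivable1_diffP dz /differentiable_row dy dF.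
apply/derivable1_diffP.
apply: (@differentiable_comp _ _ _ _ (fun t => F (e t, z t, y t)) (fun M : 'rV[C]_nu => M ord0 j)).
  apply: (@differentiable_comp _ _ _ _ (fun t => (e t, z t, y t)) F) => //.
  by apply: differentiable_pair => //; exact: differentiable_pair.
exact: differentiable_coord.
Qed.

Lemma derivable_jacobian (f : 'rV[C]_nu -> 'rV[C]_nu) (v : 'rV[C]_nu) j :
  differentiable f 0 ->
  derive1 (fun t : C => f (t *: v) ord0 j) 0 = (v *m jacobian f 0) ord0 j.
Proof.
move=> df; have sd : is_diff (0 : C) ( *:%R ^~ v) ( *:%R ^~ v) by exact: is_diff_scalel.
pose sc (t : C) : 'rV[C]_nu := t *: v.
have {}sd : is_diff (0 : C) sc sc by exact: sd.
have sv : differentiable sc (0 : C) by case: sd.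
have df' : differentiable f (sc 0) by rewrite /sc scale0r.
have dfs : differentiable (f \o sc) (0 : C) by exact: differentiable_comp.
have @cl : {linear 'rV[C]_nu -> C}.
  by exists (fun N : 'rV[C]_nu => N ord0 j); do 2![eexists]; do ?[constructor];
     rewrite ?mxE// => ? *; rewrite ?mxE//; move=> ?; rewrite !mxE.
have cc : continuous cl by exact: coord_continuous.
have dc x : differentiable cl x by exact: linear_differentiable.
have E : (fun t : C => f (t *: v) ord0 j) = cl \o (f \o sc) by [].
have dE : differentiable (cl \o (f \o sc)) (0 : C).
  by apply: differentiable_comp; [exact: dfs|exact: dc].
rewrite E (derive1E' dE) (diff_comp dfs (dc _)) /= (diff_lin _ cc) (diff_comp sv df') /=.
have -> : 'd sc (0 : C) 1 = v by case: sd => _ ->; rewrite /sc scale1r.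
have E0 : sc 0 = 0 by rewrite /sc scale0r.
by rewrite E0 -(deriveE v df) (deriveEjacobian v df).
Qed.

End Curves.

(** * Lipschitz estimates derived from Cauchy's inequalities *)

Section Segment.
Variable R : realType.
Local Notation C := (Cx R).
Local Notation mod := (@modulus R).

Lemma tcoef0 (h : C -> C) x : tcoef 0 h x = h x.
Proof. by rewrite /tcoef derive1n0 invr1 mul1r. Qed.

Lemma tcoef1 (h : C -> C) x : tcoef 1 h x = derive1 h x.
Proof. by rewrite /tcoef derive1n1 invr1 mul1r. Qed.

(** The Taylor expansion at 0 is evaluated at 1, after one and after two terms. The factor 2 comes
    from 1 - 1 / T >= 1 / 2. A sup bound on a large disc thus replaces the mean value inequality. *)
Lemma segment (h : C -> C) (T m : R) : 2 <= T ->
  (forall t, mod t <= T -> derivable h t 1) -> (forall t, mod t <= T -> mod (h t) <= m) ->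
  mod (h 1 - h 0) <= 2 * m / T /\ mod (h 1 - h 0 - derive1 h 0) <= 2 * m / T ^+ 2.
Proof.
move=> T2 dh hm; have T0 : 0 < T by lra.
have [||[_ H] _] := @taylor _ h 0 T m T0.
- by move=> z; rewrite subr0; exact: dh.
- by move=> z; rewrite subr0 => zT; apply: hm; rewrite zT.
have m0 : 0 <= m.
  by apply: le_trans (hm 0 _); [exact: modulus_ge0|rewrite modulus0 ltW].
have w1 : mod (1 : C) < T by rewrite modulus1; lra.
have T1 : 1 / T <= 1 / 2 by rewrite !div1r lef_pV2 ?posrE//; lra.
have p1 : 0 <= m / T by rewrite divr_ge0// ltW.
have p2 : 0 <= m / T ^+ 2 by rewrite divr_ge0// exprn_ge0// ltW.
have := H 1 1%N w1; have := H 1 2%N w1.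
rewrite /psum !big_ord_recl !big_ord0 /= !expr1n !mulr1 !addr0 add0r tcoef0 tcoef1 modulus1.
rewrite expr1 opprD addrA expr_div_n expr1n.
set A := mod _; set B := mod _; have A0 : 0 <= A by exact: modulus_ge0.
have B0 : 0 <= B by exact: modulus_ge0.
rewrite !div1r in T1 *.
by move=> HA HB; split; [|move: HA p2; set x := (T ^+ 2)^-1]; nra.
Qed.

End Segment.

Section FieldEstimates.
Variables (R : realType) (nu : nat).
Local Notation C := (Cx R).
Local Notation mod := (@modulus R).
Local Notation V := (C * C * 'rV[C]_nu)%type.

(** A real-valued norm on the triples (e, z, y); its triangle inequality shows how far a complex
    line p + t d stays in the domain of F. *)
Definition size3 (p : V) : R := mod p.1.1 + mod p.1.2 + l1 p.2.

Lemma size3D (p q : V) : size3 (p + q) <= size3 p + size3 q.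
Proof.
have := modulusD p.1.1 q.1.1; have := modulusD p.1.2 q.1.2; have := l1D p.2 q.2.
by rewrite /size3 /=; lra.
Qed.

Lemma size3Z (t : C) (p : V) : size3 (t *: p) = mod t * size3 p.
Proof. by rewrite /size3 /= l1Z !modulusM !mulrDr. Qed.

Lemma size3_ge0 (p : V) : 0 <= size3 p.
Proof. by rewrite /size3 addr_ge0 ?l1_ge0// addr_ge0 ?modulus_ge0. Qed.

Lemma size3_eq0 (p : V) : size3 p = 0 -> p = 0.
Proof.
case: p => [[e z] y]; rewrite /size3 /= => H.
have := modulus_ge0 e; have := modulus_ge0 z; have := l1_ge0 y => y0 z0 e0.
have ey : e = 0 by apply/eqP; rewrite -modulus_eq0; apply/eqP; lra.
have zy : z = 0 by apply/eqP; rewrite -modulus_eq0; apply/eqP; lra.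
by rewrite ey zy (@l1_eq0 _ _ y)//; lra.
Qed.

Variable F : V -> 'rV[C]_nu.
Variable s : R.
Hypothesis s0 : 0 < s.
Hypothesis dF : forall p, size3 p <= s -> differentiable F p.
Hypothesis bF : forall p j, size3 p <= s -> mod (F p ord0 j) <= 1.

Lemma line_derivable (p d : V) (t : C) (j : 'I_nu) : size3 (p + t *: d) <= s ->
  derivable (fun t : C => F (p + t *: d) ord0 j) t 1.
Proof.
move: p d => [[e z] y] [[e' z'] y'] ps.
apply: (@curve_derivable _ _ F (fun t => e + t * e') (fun t => z + t * z')
   (fun t : C => y + t *: y')); last exact: dF.
- by apply: derivableD; [exact: derivable_cst|apply: derivableM;
    [exact: derivable_id|exact: derivable_cst]].
- by apply: derivableD; [exact: derivable_cst|apply: derivableM;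
    [exact: derivable_id|exact: derivable_cst]].
move=> i; have -> : (fun t : C => (y + t *: y') ord0 i) = fun t => y ord0 i + t * y' ord0 i.
  by apply/funext => t'; rewrite !mxE.
by apply: derivableD; [exact: derivable_cst|apply: derivableM;
    [exact: derivable_id|exact: derivable_cst]].
Qed.

(** On the complex line p + t d the argument stays in the ball of radius s for |t| <= T = s / (2
    |d|), where F is bounded by 1; [segment] yields 2 / T. *)
Lemma F_lip (p d : V) j : size3 p <= s / 2 -> size3 d <= s / 4 ->
  mod (F (p + d) ord0 j - F p ord0 j) <= 4 / s * size3 d.
Proof.
move=> ps ds; have [d0|d0] := eqVneq (size3 d) 0.
  by rewrite (size3_eq0 d0) addr0 subrr modulus0 mulr_ge0 ?size3_ge0// divr_ge0// ltW.
have {}d0 : 0 < size3 d by rewrite lt0r d0 size3_ge0.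
pose T := s / 2 / size3 d.
have T2 : 2 <= T by rewrite /T ler_pdivlMr//; lra.
have pT (t : C) : mod t <= T -> size3 (p + t *: d) <= s.
  rewrite /T ler_pdivlMr// => tT; apply: le_trans (size3D _ _) _.
  by rewrite size3Z; lra.
have [||H _] := @segment _ (fun t : C => F (p + t *: d) ord0 j) T 1 T2.
- by move=> t /pT; exact: line_derivable.
- by move=> t /pT; exact: bF.
rewrite scale1r scale0r addr0 in H; apply: le_trans H _.
rewrite /T le_eqVlt; apply/orP; left; apply/eqP; field.
by rewrite !lt0r_neq0.
Qed.

(** It acts on row vectors from the right, hence is the transpose of [jacobian_f] at (e, 0, 0). *)
Definition Jmx (e : C) : 'M[C]_nu := jacobian (fun w => F (e, 0, w)) 0.

Lemma size3_e (e : C) : size3 (e, 0, 0) = mod e.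
Proof. by rewrite /size3 /= modulus0 l1_0 !addr0. Qed.

Lemma size3_ev (e t : C) (v : 'rV[C]_nu) : size3 (e, 0, t *: v) = mod e + mod t * l1 v.
Proof. by rewrite /size3 /= modulus0 l1Z !addr0. Qed.

Lemma Jmx_derive1 (e : C) (v : 'rV[C]_nu) j : mod e <= s ->
  derive1 (fun t : C => F (e, 0, t *: v) ord0 j) 0 = (v *m Jmx e) ord0 j.
Proof.
move=> es; apply: derivable_jacobian.
apply: (@differentiable_comp _ _ _ _ (fun w => (e, 0, w)) F).
  apply: differentiable_pair; first exact: differentiable_cst.
  by have [] := is_diff_id (0 : 'rV[C]_nu).
by apply: dF; rewrite size3_e.
Qed.

Lemma evline_derivable (e t : C) (v : 'rV[C]_nu) j : mod e + mod t * l1 v <= s ->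
  derivable (fun t : C => F (e, 0, t *: v) ord0 j) t 1.
Proof.
move=> H; have := @line_derivable (e, 0, 0) (0, 0, v) t j.
have E (t' : C) : (e, 0, 0) + t' *: (0, 0, v) = (e, 0, t' *: v) :> V.
  by congr (_, _, _) => /=; rewrite ?scaler0 ?addr0 ?add0r.
by under eq_fun do rewrite E; rewrite E size3_ev; exact.
Qed.

Definition Gfun (j : 'I_nu) (e z : C) (y : 'rV[C]_nu) : C :=
  F (e, z, y) ord0 j - (y *m Jmx e) ord0 j.

Lemma G_lip_z j (e z z' : C) (y : 'rV[C]_nu) : size3 (e, z, y) <= s / 2 ->
  mod (z' - z) <= s / 4 -> mod (Gfun j e z' y - Gfun j e z y) <= 4 / s * mod (z' - z).
Proof.
move=> ps zs; have -> : Gfun j e z' y - Gfun j e z y =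
   F ((e, z, y) + (0, z' - z, 0)) ord0 j - F (e, z, y) ord0 j.
  have -> : (e, z, y) + (0, z' - z, 0) = (e, z', y) :> V.
    by congr (_, _, _) => /=; rewrite ?addr0// addrC subrK.
  by rewrite /Gfun; ring.
have E : size3 (0, z' - z, 0) = mod (z' - z).
  by rewrite /size3 /= modulus0 l1_0 add0r addr0.
by rewrite -E; apply: F_lip => //; rewrite E.
Qed.

Lemma G_lip_y j (e z : C) (y v : 'rV[C]_nu) : mod e <= s / 8 -> mod z <= s / 8 ->
  l1 y <= s / 8 -> l1 v <= s / 8 ->
  mod (Gfun j e z (y + v) - Gfun j e z y) <= 32 / s ^+ 2 * (mod z + l1 y + l1 v) * l1 v.
Proof.
move=> es zs ys vs; have v0 := l1_ge0 v; have y0 := l1_ge0 y; have z0 := modulus_ge0 z.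
have e0 := modulus_ge0 e.
have [vz|vn] := eqVneq (l1 v) 0.
  by rewrite (@l1_eq0 _ _ v) ?vz// addr0 subrr modulus0 l1_0 mulr0.
have {}v0 : 0 < l1 v by rewrite lt0r vn.
pose h (t : C) := F (e, z, y + t *: v) ord0 j - F (e, 0, t *: v) ord0 j.
pose k (t : C) := F (e, 0, t *: v) ord0 j.
have T1 : 2 <= s / 4 / l1 v by rewrite ler_pdivlMr//; lra.
have T2 : 2 <= s / 2 / l1 v by rewrite ler_pdivlMr//; lra.
have dh t : mod t <= s / 4 / l1 v -> derivable h t 1.
  rewrite ler_pdivlMr// => tv; apply: derivableB.
    have := @line_derivable (e, z, y) (0, 0, v) t j.
    have E (t' : C) : (e, z, y) + t' *: (0, 0, v) = (e, z, y + t' *: v) :> V.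
      by congr (_, _, _) => /=; rewrite ?scaler0 ?addr0.
    under eq_fun do rewrite E; rewrite E; apply.
    by rewrite /size3 /=; have := l1D y (t *: v); rewrite l1Z; lra.
  by apply: evline_derivable; lra.
have hb t : mod t <= s / 4 / l1 v -> mod (h t) <= 4 / s * (mod z + l1 y).
  rewrite ler_pdivlMr// => tv.
  have E : (e, 0, t *: v) + (0, z, y) = (e, z, y + t *: v) :> V.
    by congr (_, _, _) => /=; rewrite ?addr0 ?add0r// addrC.
  have E2 : size3 (0, z, y) = mod z + l1 y by rewrite /size3 /= modulus0 add0r.
  by rewrite /h -E -E2; apply: F_lip; rewrite ?size3_ev ?E2; lra.
have dk t : mod t <= s / 2 / l1 v -> derivable k t 1.
  by rewrite ler_pdivlMr// => tv; apply: evline_derivable; lra.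
have kb t : mod t <= s / 2 / l1 v -> mod (k t) <= 1.
  by rewrite ler_pdivlMr// => tv; apply: bF; rewrite size3_ev; lra.
have [H1 _] := segment T1 dh hb; have [_ H2] := segment T2 dk kb.
rewrite Jmx_derive1 in H2; last by lra.
have -> : Gfun j e z (y + v) - Gfun j e z y =
   (h 1 - h 0) + (k 1 - k 0 - (v *m Jmx e) ord0 j).
  by rewrite /Gfun /h /k mulmxDl mxE !scale1r !scale0r !addr0; ring.
apply: le_trans (modulusD _ _) _; apply: le_trans (lerD H1 H2) _.
have -> : 2 * (4 / s * (mod z + l1 y)) / (s / 4 / l1 v) =
   32 / s ^+ 2 * (mod z + l1 y) * l1 v by field; rewrite !lt0r_neq0.
have -> : 2 * 1 / (s / 2 / l1 v) ^+ 2 = 8 / s ^+ 2 * l1 v * l1 v.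
  by field; rewrite !lt0r_neq0.
have p : 0 <= 24 / s ^+ 2 * l1 v * l1 v.
  by rewrite mulr_ge0 ?ltW// mulr_gt0// divr_gt0// exprn_gt0.
lra.
Qed.

Lemma Jmx_delta (e : C) i j : mod e <= s ->
  Jmx e i j = tcoef 1 (fun t : C => F (e, 0, t *: delta_mx ord0 i) ord0 j) 0.
Proof.
move=> es; rewrite tcoef1 (Jmx_derive1 _ _ es) -rowE.
by rewrite [RHS]mxE.
Qed.

Lemma l1_delta i : l1 (delta_mx ord0 i : 'rV[C]_nu) = 1.
Proof.
rewrite /l1 (bigD1 i)//= mxE !eqxx modulus1 big1 ?addr0// => k ki.
by rewrite mxE (negbTE ki) andbF modulus0.
Qed.

(** An entry of J is a first Taylor coefficient in t, so Cauchy's inequality on |t| = s / 2 applies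
    to a difference that [F_lip] bounds by 4 |e| / s. *)
Lemma Jmx_lip (e : C) i j : mod e <= s / 4 ->
  mod (Jmx e i j - Jmx 0 i j) <= 8 / s ^+ 2 * mod e.
Proof.
move=> es; have ss := s0; have e0 := modulus_ge0 e; have s20 : 0 < s / 2 by lra.
have es' : mod e <= s by lra.
have z' : mod (0 : C) <= s by rewrite modulus0; lra.
set d := delta_mx ord0 i : 'rV[C]_nu.
have -> : Jmx e i j - Jmx 0 i j = tcoef 1 (fun t : C => F (e, 0, t *: d) ord0 j) 0 -
    tcoef 1 (fun t : C => F (0, 0, t *: d) ord0 j) 0.
  by congr (_ - _); [exact: (Jmx_delta i j es')|exact: (Jmx_delta i j z')].
have dt e' t : mod e' <= s / 4 -> mod (t - 0) <= s / 2 ->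
    derivable (fun t : C => F (e', 0, t *: d) ord0 j) t 1.
  rewrite subr0 => e's ts; apply: evline_derivable; rewrite l1_delta; lra.
have z0 : mod (0 : C) <= s / 4 by rewrite modulus0; lra.
rewrite -(@tcoefB _ 1 _ _ 0 (s / 2) s20); first last.
- by move=> t ts; apply: dt => //; exact: ltW.
- by move=> t ts; apply: dt => //; exact: ltW.
have -> : 8 / s ^+ 2 * mod e = 4 / s * mod e / (s / 2) ^+ 1.
  by rewrite expr1; field; rewrite !lt0r_neq0.
apply: tcoef_le => // t ts; first by apply: derivableB; exact: dt.
have E : (e, 0, t *: d) = (0, 0, t *: d) + (e, 0, 0) :> V.
  by congr (_, _, _) => /=; rewrite ?addr0 ?add0r.
rewrite E -(size3_e e); apply: F_lip; rewrite ?size3_e// size3_ev modulus0 add0r l1_delta.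
by rewrite subr0 in ts; lra.
Qed.

Lemma derivable_Jmx (e : C) i j : mod e <= s / 4 -> derivable (fun e => Jmx e i j) e 1.
Proof.
move=> es; have ss := s0; have s40 : 0 < s / 4 by lra.
have s20 : 0 < s / 2 by lra.
set d := delta_mx ord0 i : 'rV[C]_nu.
apply: (@near_eq_derivable _ _ _ (fun e => tcoef 1 (fun t : C => F (e, 0, t *: d) ord0 j) 0)).
  apply/nbhsC_P; exists (s / 4) => // e' ee; rewrite Jmx_delta//.
  by have -> : e' = (e' - e) + e by [ring]; apply: le_trans (modulusD _ _) _; lra.
have B e' : mod (e' - e) <= s / 4 -> mod e' <= s / 2.
  by move=> H; have -> : e' = (e' - e) + e by [ring]; apply: le_trans (modulusD _ _) _; lra.
apply: (@tcoef_param _ 1 (fun e t => F (e, 0, t *: d) ord0 j) e (s / 4) (s / 2) 1) => //.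
- move=> e' z /B e's zs; apply: evline_derivable; rewrite l1_delta; lra.
- move=> e' z /B e's zs; apply: (@curve_derivable _ _ F id (fun=> 0) (fun=> z *: d)).
  + exact: derivable_id.
  + exact: derivable_cst.
  + by move=> k; exact: derivable_cst.
  + by apply: dF; rewrite size3_ev l1_delta; lra.
- by move=> e' z /B e's zs; apply: bF; rewrite size3_ev l1_delta; lra.
Qed.

End FieldEstimates.

(** * Vector polynomials without constant term, and their norms *)

Section VectorPoly.
Variables (R : realType) (nu : nat).
Local Notation C := (Cx R).
Local Notation mod := (@modulus R).

Lemma monomial_sum_deriv n (b : nat -> C) (z : C) :
  is_derive z 1 (fun z : C => \sum_(k < n) z ^+ k.+1 * b k)
    (\sum_(k < n) k.+1%:R * z ^+ k * b k).
Proof.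
elim: n => [|n IH].
  rewrite big_ord0; have -> : (fun z : C => \sum_(k < 0) z ^+ k.+1 * b k) = cst 0.
    by apply/funext => z'; rewrite big_ord0.
  exact: is_derive_cst.
have -> : (fun z : C => \sum_(k < n.+1) z ^+ k.+1 * b k) =
    (fun z : C => \sum_(k < n) z ^+ k.+1 * b k) + (fun z => z ^+ n.+1 * b n).
  by apply/funext => z'; rewrite big_ord_recr.
rewrite big_ord_recr; apply: is_deriveD.
have dX : is_derive z 1 (fun z : C => z ^+ n.+1) (n.+1%:R * z ^+ n).
  apply: DeriveDef; first exact: exprn_derivable.
  by rewrite exp_derive /= /GRing.scale /= mulr1.
have := @is_deriveM _ _ (fun z : C => z ^+ n.+1) (fun=> b n) z 1 _ _ dX (is_derive_cst (b n) z 1).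
rewrite scaler0 add0r => H; apply: is_derive_eq H _.
by rewrite /GRing.scale /= mulrC.
Qed.

(** The index k stands for degree k + 1: there is no constant term, and [a 0] never enters. *)
Definition vpoly (a : nat -> 'rV[C]_nu) n (z : C) : 'rV[C]_nu :=
  \sum_(k < n) z ^+ k.+1 *: a k.+1.

Lemma vpolyE a n z i : vpoly a n z ord0 i = \sum_(k < n) z ^+ k.+1 * a k.+1 ord0 i.
Proof. by rewrite /vpoly summxE; apply: eq_bigr => k _; rewrite mxE. Qed.

Lemma vpoly_deriv a n z i :
  has_deriv (fun z => vpoly a n z ord0 i) z (\sum_(k < n) k.+1%:R * z ^+ k * a k.+1 ord0 i).
Proof.
apply/has_derivP; have := monomial_sum_deriv n (fun k => a k.+1 ord0 i) z.
by under eq_fun do rewrite -vpolyE.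
Qed.

Lemma vpoly_derivable a n z i : derivable (fun z => vpoly a n z ord0 i) z 1.
Proof. by apply/derivable_has; eexists; exact: vpoly_deriv. Qed.

Lemma row_near (w : C -> 'rV[C]_nu) (z : C) (eta : R) : 0 < eta ->
  (forall i, derivable (fun z => w z ord0 i) z 1) ->
  exists2 d : R, 0 < d & forall z', mod (z' - z) < d -> l1 (w z' - w z) <= eta.
Proof.
move=> eta0 dw; have e0 : 0 < eta / (nu%:R + 1) by rewrite divr_gt0// ltr_wpDl.
have : nbhs z (fun z' => forall i, mod (w z' ord0 i - w z ord0 i) <= eta / (nu%:R + 1)).
  apply: (@filter_forall _ _ (fun i z' => mod (w z' ord0 i - w z ord0 i) <= eta / (nu%:R + 1)) (nbhs z)) => i.
  apply/nbhsC_P.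
  exact: ((contC_P _ _).1 (derivable_cont (dw i)) _ e0).
move=> /nbhsC_P[d d0 Hd]; exists d => // z' /Hd H; rewrite /l1.
apply: (@le_trans _ _ (\sum_(i < nu) eta / (nu%:R + 1))).
  by apply: ler_sum => i _; rewrite !mxE; exact: H.
rewrite sumr_const card_ord -[_ *+ nu]mulr_natl mulrA ler_pdivrMr ?ltr_wpDl//.
by rewrite mulrDr mulr1 mulrC lerDl ltW.
Qed.

Lemma l1_sqr (v : 'rV[C]_nu) : l1 v ^+ 2 <= nu%:R * \sum_j mod (v ord0 j) ^+ 2.
Proof.
rewrite /l1 expr2 mulr_suml.
have -> : nu%:R * \sum_(j < nu) mod (v ord0 j) ^+ 2 =
   \sum_(i < nu) \sum_(j < nu) (mod (v ord0 i) ^+ 2 + mod (v ord0 j) ^+ 2) / 2.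
  have -> : \sum_(i < nu) \sum_(j < nu) (mod (v ord0 i) ^+ 2 + mod (v ord0 j) ^+ 2) / 2 =
     (\sum_(i < nu) \sum_(j < nu) mod (v ord0 i) ^+ 2 / 2) +
     \sum_(i < nu) \sum_(j < nu) mod (v ord0 j) ^+ 2 / 2.
    rewrite -big_split; apply: eq_bigr => i _; rewrite -big_split.
    by apply: eq_bigr => j _; rewrite mulrDl.
  rewrite [X in X + _]exchange_big /= sumr_const card_ord -mulr_suml -[_ *+ nu]mulr_natl.
  by field.
apply: ler_sum => i _; rewrite mulr_sumr; apply: ler_sum => j _.
have := sqr_ge0 (mod (v ord0 i) - mod (v ord0 j)); rewrite sqrrB; lra.
Qed.

Lemma sqr_l1 (v : 'rV[C]_nu) : \sum_j mod (v ord0 j) ^+ 2 <= l1 v ^+ 2.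
Proof.
rewrite /l1 [leRHS]expr2 mulr_suml; apply: ler_sum => i _; rewrite expr2.
apply: ler_wpM2l; [exact: modulus_ge0|exact: l1_comp].
Qed.

(** Telescoping, through the stronger bound 2 - 1 / n for the sum of n terms. *)
Lemma inv_sq_sum n : \sum_(k < n) (k.+1%:R ^+ 2)^-1 <= 2 :> R.
Proof.
suff : \sum_(k < n.+1) (k.+1%:R ^+ 2)^-1 <= 2 - n.+1%:R^-1 :> R.
  move=> H; apply: le_trans (_ : 2 - n.+1%:R^-1 <= 2); last first.
    by rewrite lerBlDr lerDl invr_ge0.
  apply: le_trans H; rewrite big_ord_recr /= lerDl invr_ge0; exact: exprn_ge0.
elim: n => [|n IH]; first by rewrite big_ord1 expr1n invr1; lra.
rewrite big_ord_recr /=; apply: le_trans (lerD IH (lexx _)) _.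
have x0 : 0 < n.+1%:R :> R by [].
rewrite -[n.+2%:R]natr1; set x : R := n.+1%:R in x0 *.
have -> : 2 - x^-1 + ((x + 1) ^+ 2)^-1 = 2 - (x + 1)^-1 - (x * (x + 1) ^+ 2)^-1.
  by field; rewrite !lt0r_neq0//; lra.
by rewrite lerBlDr lerDl invr_ge0 mulr_ge0 ?exprn_ge0//; lra.
Qed.

(** The embedding into the sup norm. Each term |a_k| r^k is at most (k |a_k| r^k)^2 / (2 del) + del
    / (2 k^2) by the inequality of the means; the two sums contribute del / 2 and del. *)
Lemma vpoly_bound a n (r del : R) z : 0 < r -> 0 < del -> mod z <= r ->
  \sum_(k < n) (k.+1%:R * l1 (a k.+1) * r ^+ k.+1) ^+ 2 <= del ^+ 2 ->
  l1 (vpoly a n z) <= 3 / 2 * del.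
Proof.
move=> r0 d0 zr H; apply: le_trans (l1_sum _) _.
apply: (@le_trans _ _ (\sum_(k < n) ((k.+1%:R * l1 (a k.+1) * r ^+ k.+1) ^+ 2 / (2 * del) +
    del / 2 * (k.+1%:R ^+ 2)^-1))).
  apply: ler_sum => k _; rewrite l1Z modulusX.
  have zk : mod z ^+ k.+1 <= r ^+ k.+1.
    by apply: lerXn2r => //; rewrite nnegrE ?modulus_ge0 ?ltW.
  have l0 := l1_ge0 (a k.+1).
  apply: le_trans (ler_wpM2r l0 zk) _.
  have n0 : 0 < k.+1%:R :> R by [].
  set x : R := k.+1%:R in n0 *; set y := r ^+ k.+1; set l := l1 _.
  have := sqr_ge0 (x * l * y - del / x).
  have -> : (x * l * y - del / x) ^+ 2 =
    2 * del * ((x * l * y) ^+ 2 / (2 * del) + del / 2 * (x ^+ 2)^-1 - y * l).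
    by field; rewrite !lt0r_neq0.
  by rewrite pmulr_rge0 ?mulr_gt0// subr_ge0.
rewrite big_split -mulr_suml -mulr_sumr.
have A : (\sum_(i < n) (i.+1%:R * l1 (a i.+1) * r ^+ i.+1) ^+ 2) / (2 * del) <= del / 2.
  by rewrite ler_pdivrMr ?mulr_gt0//; apply: le_trans H _; rewrite expr2; lra.
have B : del / 2 * \sum_(i < n) (i.+1%:R ^+ 2)^-1 <= del / 2 * 2.
  by apply: ler_wpM2l; [lra|exact: inv_sq_sum].
apply: le_trans (lerD A B) _; lra.
Qed.

End VectorPoly.

(** * The recursion for the coefficients *)

Section Recursion.
Variables (R : realType) (nu : nat).
Local Notation C := (Cx R).
Local Notation mod := (@modulus R).
Local Notation V := (C * C * 'rV[C]_nu)%type.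
Variable F : V -> 'rV[C]_nu.
Variable s : R.
Hypothesis s0 : 0 < s.
Hypothesis dF : forall p, size3 p <= s -> differentiable F p.
Hypothesis bF : forall p j, size3 p <= s -> mod (F p ord0 j) <= 1.

Local Notation G := (Gfun F).
Local Notation J := (Jmx F).

Lemma derivable_mulJ (w : C -> 'rV[C]_nu) (A : 'M[C]_nu) z j :
  (forall i, derivable (fun z => w z ord0 i) z 1) ->
  derivable (fun z => (w z *m A) ord0 j) z 1.
Proof.
move=> dw; have -> : (fun z => (w z *m A) ord0 j) = (fun z => \sum_i w z ord0 i * A i j).
  by apply/funext => z'; rewrite mxE.
by apply: derivable_bigsum => i; apply: derivableM; [exact: dw|exact: derivable_cst].
Qed.

Lemma G_derivable j e (w : C -> 'rV[C]_nu) z : size3 (e, z, w z) <= s ->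
  (forall i, derivable (fun z => w z ord0 i) z 1) ->
  derivable (fun z => G j e z (w z)) z 1.
Proof.
move=> ps dw; apply: derivableB; last exact: derivable_mulJ.
apply: (@curve_derivable _ _ F (fun=> e) id w) => //.
exact: dF.
Qed.

Lemma G_hol j e (w : C -> 'rV[C]_nu) z : size3 (e, z, w z) <= s / 2 ->
  (forall z i, derivable (fun z => w z ord0 i) z 1) ->
  exists2 rho : R, 0 < rho & hol (fun z => G j e z (w z)) z rho.
Proof.
move=> ps dw; have ss := s0.
have s40 : 0 < s / 4 by lra.
have [d d0 Hd] := row_near s40 (dw z).
exists (Num.min d (s / 4)) => [|z']; first by rewrite lt_min d0.
rewrite lt_min => /andP[zd zs]; apply: G_derivable => //.
have := Hd z' zd; move: ps; rewrite /size3 /=.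
have := l1D (w z' - w z) (w z); rewrite subrK.
have := modulusD (z' - z) z; rewrite subrK; lra.
Qed.

(** Difference quotients and the Lipschitz bounds on G replace the chain rule. The two summands 1
    absorb the errors of the first-order approximations of g and of w. The strict inequality with q
    leaves room for the increment of w, which enters the factor |z| + |y| + |v| of [G_lip_y]. *)
Lemma G_deriv_bound j e (w : C -> 'rV[C]_nu) z (w' : 'rV[C]_nu) (q : R) :
  mod e <= s / 8 -> mod z <= s / 16 -> l1 (w z) <= s / 16 ->
  (forall i, has_deriv (fun z => w z ord0 i) z (w' ord0 i)) ->
  mod z + l1 (w z) < q ->
  mod (derive1 (fun z => G j e z (w z)) z) <=
    4 / s + 1 + 32 / s ^+ 2 * q * (l1 w' + 1).
Proof.
move=> es zs ws dw zq; have ss := s0.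
have z0 := modulus_ge0 z; have w0 := l1_ge0 (w z); have w'0 := l1_ge0 w'.
set g := fun z => _.
have dg : derivable g z 1.
  apply: G_derivable; first by rewrite /size3 /=; lra.
  by move=> i; apply/derivable_has; exists (w' ord0 i).
have [d1 d10 H1] := derive1_has dg ltr01.
have e10 : 0 < 1 / (nu%:R + 1) :> R by rewrite divr_gt0// ltr_wpDl.
have : nbhs (0 : C) (fun h => forall i, mod (w (z + h) ord0 i - w z ord0 i - h * w' ord0 i)
    <= 1 / (nu%:R + 1) * mod h).
  apply: (@filter_forall _ _ (fun i h => mod (w (z + h) ord0 i - w z ord0 i - h * w' ord0 i)
    <= 1 / (nu%:R + 1) * mod h) (nbhs (0 : C))) => i.
  have [d d0 Hd] := dw i _ e10; apply/nbhsC_P; exists d => // h; rewrite subr0; exact: Hd.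
move=> /nbhsC_P[d2 d20 H2].
pose K := l1 w' + 1; have K0 : 0 < K by rewrite /K; lra.
have [t [t0 td1 td2 ts tq]] : exists t : R, [/\ 0 < t, t < d1, t < d2, t * K <= s / 16 /\ t <= s / 16 &
   t * K <= q - (mod z + l1 (w z))].
  pose m := Num.min (Num.min d1 d2) (Num.min (Num.min (s / 16 / K) (s / 16))
     ((q - (mod z + l1 (w z))) / K)).
  have m0 : 0 < m.
    rewrite !lt_min; apply/andP; split; first by apply/andP.
    apply/andP; split; last by rewrite divr_gt0// subr_gt0.
    by apply/andP; split; [rewrite divr_gt0//|]; lra.
  have m1 : m <= d1 by rewrite !ge_min lexx.
  have m2 : m <= d2 by rewrite !ge_min lexx orbT.
  have m3 : m <= s / 16 / K by rewrite !ge_min lexx !orbT.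
  have m4 : m <= s / 16 by rewrite !ge_min lexx !orbT.
  have m5 : m <= (q - (mod z + l1 (w z))) / K by rewrite !ge_min lexx !orbT.
  clearbody m; move: m3 m5; rewrite !ler_pdivlMr// => m3 m5.
  by exists (m / 2); split; [| | |split|]; nra.
case: ts => ts1 ts2.
pose h : C := (t%:C)%C; have hm : mod h = t by rewrite modulusR gtr0_norm.
pose v := w (z + h) - w z.
have vb : l1 v <= t * K.
  have E : v = h *: w' + (v - h *: w') by rewrite addrC subrK.
  have : l1 (v - h *: w') <= t.
    rewrite /l1; apply: (@le_trans _ _ (\sum_(i < nu) 1 / (nu%:R + 1) * t)).
      apply: ler_sum => i _; rewrite -hm; have := H2 h; rewrite subr0 hm => /(_ td2 i).
      by rewrite !mxE.
    rewrite sumr_const card_ord -[_ *+ nu]mulr_natl mulrA mulrA mulr1.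
    apply: ler_piMl; first exact: ltW.
    by rewrite ler_pdivrMr ?ltr_wpDl// mul1r lerDl.
  have := l1D (h *: w') (v - h *: w'); rewrite -E l1Z hm /K; lra.
have v0 := l1_ge0 v.
have gb : mod (g (z + h) - g z) <= 4 / s * t + 32 / s ^+ 2 * q * (t * K).
  have -> : g (z + h) - g z = (G j e (z + h) (w z + v) - G j e z (w z + v)) +
      (G j e z (w z + v) - G j e z (w z)).
    have -> : w z + v = w (z + h) by rewrite /v addrC subrK.
    by rewrite /g addrA subrK.
  apply: le_trans (modulusD _ _) _; apply: lerD.
    have -> : t = mod (z + h - z) by rewrite addrAC subrr add0r.
    apply: (G_lip_z s0 dF bF); last by rewrite addrAC subrr add0r hm; lra.
    by rewrite /size3 /=; have := l1D (w z) v; lra.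
  apply: le_trans (G_lip_y s0 dF bF j es _ _ _) _; try lra.
  have c0 : 0 <= 32 / s ^+ 2 by rewrite divr_ge0// exprn_ge0// ltW.
  apply: ler_pM => //; last by apply: ler_wpM2l => //; lra.
  by apply: mulr_ge0 => //; lra.
have := H1 h; rewrite hm mul1r => /(_ td1).
set D := derive1 g z; set Q := g (z + h) - g z in gb * => HD.
have : mod (h * D) <= mod Q + t.
  have -> : h * D = Q - (Q - h * D) by ring.
  by apply: le_trans (modulusB _ _) _; lra.
rewrite modulusM hm => HD2; rewrite -(ler_pM2l t0).
apply: le_trans HD2 _; rewrite /K in gb; lra.
Qed.

(** With u the polynomial and g(z) = G(e, z, u(z)), one has |z g'| <= A + Bq |z u'| on |z| = r. In
    the mean square, Parseval bounds the last term by the hypothesis on a, and Bessel turns the left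
    side into the sum over coefficients. A is of order r and Bq of order q, so both can be made
    small. The value q = r + 2 del is strictly above |z| + |u| <= r + 3/2 del. *)
Lemma G_step j e (a : nat -> 'rV[C]_nu) n L (r del q : R) :
  0 < r -> 0 < del -> mod e <= s / 8 -> r <= s / 16 -> 3 / 2 * del <= s / 16 ->
  \sum_(k < n) (k.+1%:R * l1 (a k.+1) * r ^+ k.+1) ^+ 2 <= del ^+ 2 ->
  q = r + 2 * del ->
  \sum_(i < L) (i%:R * mod (tcoef i (fun z => G j e z (vpoly a n z)) 0) * r ^+ i) ^+ 2 <=
    2 * (r * (4 / s + 1 + 32 / s ^+ 2 * q)) ^+ 2 + 2 * (32 / s ^+ 2 * q) ^+ 2 * (nu%:R * del ^+ 2).
Proof.
move=> r0 d0 es rs ds aH qE; have ss := s0.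
pose g z := G j e z (vpoly a n z).
have ub z : mod z <= r -> l1 (vpoly a n z) <= 3 / 2 * del by move=> zr; exact: vpoly_bound aH.
pose w' z : 'rV[C]_nu := \row_i \sum_(k < n) k.+1%:R * z ^+ k * a k.+1 ord0 i.
have c0 : 0 <= 32 / s ^+ 2 by rewrite divr_ge0// exprn_ge0// ltW.
have c10 : 0 <= 4 / s by rewrite divr_ge0// ltW.
have q0 : 0 <= q by rewrite qE; lra.
have B1 z : mod z = r -> mod (z * derive1 g z) <=
   r * (4 / s + 1 + 32 / s ^+ 2 * q) + 32 / s ^+ 2 * q * l1 (z *: w' z).
  move=> zr; have uz := ub z; rewrite zr lexx in uz; have {}uz := uz isT.
  have h1 : mod z <= s / 16 by rewrite zr.
  have h2 : l1 (vpoly a n z) <= s / 16 by lra.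
  have h3 i : has_deriv (fun z => vpoly a n z ord0 i) z (w' z ord0 i).
    by rewrite mxE; exact: vpoly_deriv.
  have h4 : mod z + l1 (vpoly a n z) < q by rewrite zr qE; lra.
  have H := G_deriv_bound j es h1 h2 h3 h4.
  rewrite modulusM zr l1Z zr; have := ler_wpM2l (ltW r0) H; lra.
have w'E z : z *: w' z = \sum_(k < n) (k.+1%:R * z ^+ k.+1) *: a k.+1.
  apply/rowP => i; rewrite summxE !mxE mulr_sumr; apply: eq_bigr => k _.
  by rewrite mxE exprS; ring.
pose A := r * (4 / s + 1 + 32 / s ^+ 2 * q); pose Bq := 32 / s ^+ 2 * q.
have A0 : 0 <= A.
  apply: mulr_ge0; first exact: ltW.
  by apply: addr_ge0; [lra|exact: mulr_ge0].
have Bq0 : 0 <= Bq by rewrite /Bq mulr_ge0.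
rewrite -/A -/Bq in B1 *.
apply: (@tcoef_sq_sum _ g r _ (A + Bq * \sum_(k < n) k.+1%:R * r ^+ k.+1 * l1 (a k.+1)) L r0).
- move=> z zr; apply: G_hol; last by move=> z' i; exact: vpoly_derivable.
  by rewrite /size3 /=; have := ub z zr; lra.
- move=> z zr; apply: le_trans (B1 z zr) _; rewrite lerD2l; apply: ler_wpM2l => //.
  rewrite w'E; apply: le_trans (l1_sum _) _; apply: ler_sum => k _.
  by rewrite l1Z modulusM modulus_nat modulusX zr.
(* From m >= n on, there are more nodes than the degree of u, and Parseval is exact. *)
exists n => // m /= nm; set rC : C := (r%:C)%C.
have rm u : mod u = 1 -> mod (rC * u) = r.
  by move=> u1; rewrite modulusM u1 mulr1 modulusR gtr0_norm.
apply: (@le_trans _ _ (avgR m (fun u => 2 * A ^+ 2 + 2 * Bq ^+ 2 *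
    (nu%:R * \sum_(i < nu) mod (((rC * u) *: w' (rC * u)) ord0 i) ^+ 2)))).
  apply: avgR_le => u u1; set z := rC * u.
  have zr : mod z = r by exact: rm.
  have l0 := l1_ge0 (z *: w' z).
  apply: (@le_trans _ _ ((A + Bq * l1 (z *: w' z)) ^+ 2)).
    apply: lerXn2r; rewrite ?nnegrE ?modulus_ge0//; last exact: B1.
    by rewrite addr_ge0// mulr_ge0.
  have H1 := l1_sqr (z *: w' z).
  have H2 := sqr_ge0 (A - Bq * l1 (z *: w' z)).
  have H3 := ler_wpM2l (sqr_ge0 Bq) H1.
  apply: (@le_trans _ _ (2 * A ^+ 2 + 2 * (Bq ^+ 2 * l1 (z *: w' z) ^+ 2))).
    by move: H2; rewrite !sqrrD sqrrN !exprMn; lra.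
  by rewrite lerD2l -mulrA ler_pM2l.
rewrite avgRD avgR_cst avgRZ avgRZ lerD2l.
apply: ler_wpM2l; first by rewrite mulr_ge0// sqr_ge0.
apply: ler_wpM2l => //; rewrite avgR_sum; apply: le_trans _ aH.
apply: (@le_trans _ _ (\sum_(i < nu) \sum_(k < n)
   (k.+1%:R * r ^+ k.+1 * mod (a k.+1 ord0 i)) ^+ 2)).
  apply: ler_sum => i _.
  pose b l : C := if l is k.+1 then k.+1%:R * rC ^+ k.+1 * a k.+1 ord0 i else 0.
  have E u : ((rC * u) *: w' (rC * u)) ord0 i = \sum_(l < n.+1) b l * u ^+ l.
    rewrite big_ord_recl mul0r add0r w'E summxE; apply: eq_bigr => k _.
    by rewrite mxE /b /= exprMn; ring.
  under [X in avgR m X]funext do rewrite E.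
  rewrite parseval; last by rewrite (leq_trans _ (dysize_gt m)).
  rewrite big_ord_recl modulus0 expr0n add0r; apply: ler_sum => k _.
  by rewrite /b /= !modulusM modulus_nat modulusX modulusR gtr0_norm.
rewrite exchange_big; apply: ler_sum => k _.
have -> : \sum_(i < nu) (k.+1%:R * r ^+ k.+1 * mod (a k.+1 ord0 i)) ^+ 2 =
    (k.+1%:R * r ^+ k.+1) ^+ 2 * \sum_(i < nu) mod (a k.+1 ord0 i) ^+ 2.
  by rewrite mulr_sumr; apply: eq_bigr => i _; rewrite exprMn.
rewrite [X in _ <= X ^+ 2]mulrAC [leRHS]exprMn.
by apply: ler_wpM2l; [exact: sqr_ge0|exact: sqr_l1].
Qed.

(* Two arguments of [G] that agree to order [k - 1] give the same coefficient of
   order [k], because [G] has no linear term in its last argument at [z = 0]. *)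
Lemma G_congr j e k (w1 w2 : C -> 'rV[C]_nu) (rho B : R) : (0 < k)%N -> 0 < rho ->
  mod e <= s / 8 ->
  (forall z i, mod z < rho -> derivable (fun z => w1 z ord0 i) z 1) ->
  (forall z i, mod z < rho -> derivable (fun z => w2 z ord0 i) z 1) ->
  (forall z, mod z < rho -> l1 (w1 z) <= B * mod z) ->
  (forall z, mod z < rho -> l1 (w2 z - w1 z) <= B * mod z ^+ k) ->
  tcoef k (fun z => G j e z (w1 z)) 0 = tcoef k (fun z => G j e z (w2 z)) 0.
Proof.
move=> k0 rho0 es d1 d2 b1 b12; have ss := s0.
have B0 : 0 <= B.
  have p : mod ((rho / 2)%:C)%C = rho / 2 by rewrite modulusR gtr0_norm//; lra.
  have := b1 ((rho / 2)%:C)%C; rewrite p => H.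
  have := l1_ge0 (w1 ((rho / 2)%:C)%C); have : rho / 2 < rho by lra.
  by move=> /H; nra.
have [r [r0 r1 rr rs rB]] : exists r : R, [/\ 0 < r, r <= 1, r <= rho, r <= s / 8 & B * r <= s / 16].
  exists (Num.min (Num.min 1 rho) (Num.min (s / 8) (s / 16 / (B + 1)))).
  set m := Num.min _ _.
  have m0 : 0 < m.
    rewrite !lt_min ltr01 rho0 /=; apply/andP; split; first lra.
    by rewrite divr_gt0//; lra.
  have m5 : m <= s / 16 / (B + 1) by rewrite !ge_min lexx !orbT.
  split => //; try by rewrite !ge_min lexx ?orbT.
  by move: m5; rewrite ler_pdivlMr; [nra|lra].
have small z : mod z < r -> l1 (w1 z) <= s / 16 /\ l1 (w2 z - w1 z) <= s / 16.
  move=> zr; have z0 := modulus_ge0 z; have zrho : mod z < rho by lra.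
  have H1 := b1 z zrho; have H2 := b12 z zrho; split; first by nra.
  apply: le_trans H2 _; apply: (@le_trans _ _ (B * mod z)); last by nra.
  apply: ler_wpM2l => //; rewrite -[leRHS]expr1; apply: ler_wiXn2l => //; lra.
have h1 : hol (fun z => G j e z (w1 z)) 0 r.
  move=> z; rewrite subr0 => zr; apply: G_derivable.
    by have [] := small z zr; rewrite /size3 /=; lra.
  by move=> i; apply: d1; lra.
have h2 : hol (fun z => G j e z (w2 z)) 0 r.
  move=> z; rewrite subr0 => zr; apply: G_derivable.
    have [] := small z zr; rewrite /size3 /=; have := l1D (w2 z - w1 z) (w1 z).
    by rewrite subrK; lra.
  by move=> i; apply: d2; lra.
apply/eqP; rewrite -subr_eq0 -(tcoefB k r0 h1 h2); apply/eqP.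
(* In [G_lip_y] the factor |z| + |w1| + |w2 - w1| is O(|z|) and the other one O(|z|^k), so the
   difference is of order k + 1. *)
pose K := 32 / s ^+ 2 * (1 + B + B) * B.
apply: (@tcoef_bigO _ k _ r K k.+1 r0); last exact: ltnSn.
  by move=> z zr; apply: derivableB; [exact: h1|exact: h2].
move=> z zr; rewrite modulusBC; have [H1 H2] := small z zr.
have z0 := modulus_ge0 z.
have := @G_lip_y _ _ F s s0 dF bF j e z (w1 z) (w2 z - w1 z).
have E : w1 z + (w2 z - w1 z) = w2 z by rewrite addrC subrK.
rewrite E => H; apply: le_trans (H _ _ _ _) _ => {H}; try lra.
have zrho : mod z < rho by lra.
have H3 := b1 z zrho; have H4 := b12 z zrho.
have zk : mod z ^+ k <= mod z.
  by rewrite -[leRHS]expr1; apply: ler_wiXn2l => //; lra.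
have c0 : 0 <= 32 / s ^+ 2 by rewrite divr_ge0// exprn_ge0// ltW.
rewrite /K [mod z ^+ k.+1]exprS; set y := mod z ^+ k in H4 zk *.
have -> : 32 / s ^+ 2 * (1 + B + B) * B * (mod z * y) =
  32 / s ^+ 2 * ((1 + B + B) * mod z) * (B * y) by ring.
have v0 := l1_ge0 (w2 z - w1 z); have u0 := l1_ge0 (w1 z).
apply: ler_pM => //; first by rewrite mulr_ge0//; lra.
apply: ler_wpM2l => //; have := ler_wpM2l B0 zk; lra.
Qed.

End Recursion.

(** * The formal solution and its coefficients as functions of the parameter *)

Section Coefficients.
Variables (R : realType) (nu : nat).
Local Notation C := (Cx R).
Local Notation mod := (@modulus R).
Local Notation V := (C * C * 'rV[C]_nu)%type.
Variable F : V -> 'rV[C]_nu.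

Local Notation G := (Gfun F).
Local Notation J := (Jmx F).

Definition gcoef k (e : C) (w : C -> 'rV[C]_nu) : 'rV[C]_nu :=
  \row_j tcoef k (fun z => G j e z (w z)) 0.

Lemma gcoefE k e w j : gcoef k e w ord0 j = tcoef k (fun z => G j e z (w z)) 0.
Proof. by rewrite /gcoef mxE. Qed.

Lemma gcoef_eq k e w1 w2 :
  (forall j, tcoef k (fun z => G j e z (w1 z)) 0 = tcoef k (fun z => G j e z (w2 z)) 0) ->
  gcoef k e w1 = gcoef k e w2.
Proof.
move=> H; rewrite /gcoef; congr (matrix_of_fun _ _).
by apply/funext => i; apply/funext => j; exact: H.
Qed.

Definition resolv k (e : C) : 'M[C]_nu := (k%:R * e)%:M - J e.

(** Stage n is the whole sequence of coefficients computed so far, since order n requires all lower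
    orders at once; this makes the recursion structural. Orders above n are 0. *)
Fixpoint acoefs (n : nat) (e : C) (k : nat) : 'rV[C]_nu :=
  if n is n'.+1 then
    if k == n then gcoef n e (vpoly (acoefs n' e) n') *m invmx (resolv n e)
    else acoefs n' e k
  else 0.

Lemma acoefsS n e k : acoefs n.+1 e k =
  if k == n.+1 then gcoef n.+1 e (vpoly (acoefs n e) n) *m invmx (resolv n.+1 e)
  else acoefs n e k.
Proof. by []. Qed.

(* The coefficient [a_k(e)] of [z ^ k] in the formal solution. *)
Definition acf (e : C) (k : nat) := acoefs k e k.

Lemma acoefs_stable n e k : (k <= n)%N -> acoefs n e k = acf e k.
Proof.
elim: n => [|n IH]; first by rewrite leqn0 => /eqP ->.
rewrite leq_eqVlt => /orP[/eqP -> //|]; rewrite ltnS => kn.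
by rewrite acoefsS (_ : (k == n.+1) = false) ?IH//; apply/negbTE; rewrite neq_ltn ltnS kn.
Qed.

Lemma vpoly_ext (a b : nat -> 'rV[C]_nu) n z :
  (forall k, (0 < k <= n)%N -> a k = b k) -> vpoly a n z = vpoly b n z.
Proof. by move=> H; apply: eq_bigr => k _; rewrite H//= ltn_ord. Qed.

Lemma acfE n e : acf e n.+1 = gcoef n.+1 e (vpoly (acf e) n) *m invmx (resolv n.+1 e).
Proof.
have E : vpoly (acoefs n e) n = vpoly (acf e) n.
  apply/funext => z; apply: vpoly_ext => k /andP[_ kn]; exact: acoefs_stable.
by rewrite -E /acf acoefsS eqxx.
Qed.

Variable s : R.
Hypothesis s0 : 0 < s.
Hypothesis dF : forall p, size3 p <= s -> differentiable F p.
Hypothesis bF : forall p j, size3 p <= s -> mod (F p ord0 j) <= 1.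

(** It allows all coefficients up to order n + 1 to be read off from one and the same function of z,
    to which an L^2 estimate can be applied. *)
Lemma gcoef_stable (a : nat -> 'rV[C]_nu) k n e : mod e <= s / 8 -> (k <= n)%N ->
  gcoef k.+1 e (vpoly a k) = gcoef k.+1 e (vpoly a n).
Proof.
move=> es kn; apply: gcoef_eq => j.
pose B := \sum_(i < n) l1 (a i.+1).
have B0 : 0 <= B by apply: sumr_ge0 => i _; exact: l1_ge0.
have bnd p q z : mod z < 1 -> (p <= q)%N -> (q <= n)%N ->
    l1 (\sum_(p <= i < q) z ^+ i.+1 *: a i.+1) <= B * mod z ^+ p.+1.
  move=> z1 pq qn; have z0 := modulus_ge0 z.
  apply: (@le_trans _ _ (\sum_(p <= i < q) l1 (a i.+1) * mod z ^+ p.+1)).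
    elim: q pq {qn} => [|q IH] pq; first by rewrite !big_geq ?l1_0.
    move: pq; rewrite leq_eqVlt => /orP[/eqP <-|]; first by rewrite !big_geq ?l1_0.
    rewrite ltnS => pq; rewrite !big_nat_recr//=.
    apply: le_trans (l1D _ _) _; apply: lerD; first exact: IH.
    rewrite l1Z modulusX mulrC; apply: ler_wpM2l; first exact: l1_ge0.
    by apply: ler_wiXn2l; rewrite ?ltnS// ltW.
  rewrite -mulr_suml; apply: ler_wpM2r; first exact: exprn_ge0.
  rewrite /B -(big_mkord xpredT (fun i => l1 (a i.+1))).
  rewrite (big_cat_nat (leq0n p) (leq_trans pq qn))//= (big_cat_nat pq qn)//=.
  have P u v : 0 <= \sum_(u <= i < v) l1 (a i.+1).
    by apply: sumr_ge0 => i _; exact: l1_ge0.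
  by have := P 0%N p; have := P q n; lra.
have E m z : vpoly a m z = \sum_(0 <= i < m) z ^+ i.+1 *: a i.+1 by rewrite big_mkord.
apply: (G_congr s0 dF bF j (ltn0Sn k) ltr01 es).
- by move=> z i _; exact: vpoly_derivable.
- by move=> z i _; exact: vpoly_derivable.
- by move=> z z1; rewrite E -[mod z]expr1; exact: bnd.
move=> z z1; rewrite !E (big_cat_nat (leq0n k) kn)//= addrAC subrr add0r.
exact: bnd.
Qed.

(** Induction on the truncation degree. The coefficients 1, ..., n + 1 are those of G at the
    polynomial of degree n, multiplied by matrices of norm at most K; [G_step] bounds the former by
    the induction hypothesis, and the smallness assumption returns the same del. *)
Lemma acf_bound e N (K r del q : R) : 0 <= K -> 0 < r -> 0 < del -> mod e <= s / 8 ->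
  r <= s / 16 -> 3 / 2 * del <= s / 16 -> q = r + 2 * del ->
  (forall k v, (0 < k <= N)%N -> l1 (v *m invmx (resolv k e)) <= K * l1 v) ->
  K ^+ 2 * (nu%:R * (nu%:R * (2 * (r * (4 / s + 1 + 32 / s ^+ 2 * q)) ^+ 2 +
    2 * (32 / s ^+ 2 * q) ^+ 2 * (nu%:R * del ^+ 2)))) <= del ^+ 2 ->
  forall n, (n <= N)%N ->
  \sum_(k < n) (k.+1%:R * l1 (acf e k.+1) * r ^+ k.+1) ^+ 2 <= del ^+ 2.
Proof.
move=> K0 r0 d0 es rs ds qE HK Hsmall; pose B := 2 * (r * (4 / s + 1 + 32 / s ^+ 2 * q)) ^+ 2 +
    2 * (32 / s ^+ 2 * q) ^+ 2 * (nu%:R * del ^+ 2).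
rewrite -/B in Hsmall.
elim=> [|n IH] nN; first by rewrite big_ord0 sqr_ge0.
have {}IH := IH (ltnW nN); apply: le_trans Hsmall.
pose g j := fun z => G j e z (vpoly (acf e) n z).
(* One factor nu is the price of passing from the square of [l1] to a sum of squares, the other
   comes from summing over the components j. *)
apply: (@le_trans _ _ (\sum_(k < n.+1) K ^+ 2 * (nu%:R * \sum_(j < nu)
    (k.+1%:R * mod (tcoef k.+1 (g j) 0) * r ^+ k.+1) ^+ 2))).
  apply: ler_sum => k _; have kn : (k <= n)%N by rewrite -ltnS ltn_ord.
  rewrite acfE (gcoef_stable _ es kn); set v := gcoef _ _ _.
  have H1 : l1 (v *m invmx (resolv k.+1 e)) <= K * l1 v.
    by apply: HK; rewrite /= (leq_trans _ nN).
  have x0 : 0 <= k.+1%:R * r ^+ k.+1 by rewrite mulr_ge0// exprn_ge0// ltW.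
  apply: (@le_trans _ _ ((k.+1%:R * r ^+ k.+1 * (K * l1 v)) ^+ 2)).
    rewrite [X in X ^+ 2 <= _]mulrAC; apply: lerXn2r; rewrite ?nnegrE.
    - by rewrite mulr_ge0// l1_ge0.
    - by rewrite mulr_ge0// mulr_ge0// l1_ge0.
    - exact: ler_wpM2l.
  rewrite mulrCA exprMn; apply: ler_wpM2l; first exact: sqr_ge0.
  have -> : \sum_(j < nu) (k.+1%:R * mod (tcoef k.+1 (g j) 0) * r ^+ k.+1) ^+ 2 =
      (k.+1%:R * r ^+ k.+1) ^+ 2 * \sum_(j < nu) mod (v ord0 j) ^+ 2.
    rewrite mulr_sumr; apply: eq_bigr => j _.
    by rewrite [X in X ^+ 2 = _]mulrAC exprMn /v gcoefE.
  rewrite exprMn [leRHS]mulrCA; apply: ler_wpM2l; first exact: sqr_ge0.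
  exact: l1_sqr.
rewrite -mulr_sumr; apply: ler_wpM2l; first exact: sqr_ge0.
rewrite -mulr_sumr; apply: ler_wpM2l => //.
rewrite exchange_big /=.
have -> : nu%:R * B = \sum_(j < nu) B by rewrite sumr_const card_ord mulr_natl.
apply: ler_sum => j _.
(* The indices run from 0 to n + 1, and the term of index 0 vanishes because of its weight. *)
have := G_step s0 dF bF j n.+2 r0 d0 es rs ds IH qE.
by rewrite -/B big_ord_recl mul0r mul0r expr0n add0r.
Qed.

Lemma G_bound j e z (y : 'rV[C]_nu) : mod e <= s / 8 -> mod z <= s / 8 -> l1 y <= s / 8 ->
  mod (G j e z y) <= 2.
Proof.
move=> es zs ys; have ss := s0.
have l0 : l1 (0 : 'rV[C]_nu) <= s / 8 by rewrite l1_0; lra.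
have := G_lip_y s0 dF bF j es zs l0 ys; rewrite add0r l1_0 addr0 => H.
have y0 := l1_ge0 y; have z0 := modulus_ge0 z.
have H0 : mod (G j e z 0) <= 1.
  rewrite /Gfun mul0mx mxE subr0; apply: bF; rewrite /size3 /= l1_0; lra.
have H1 : 32 / s ^+ 2 * (mod z + l1 y) * l1 y <= 1.
  apply: (@le_trans _ _ (32 / s ^+ 2 * (s / 4) * (s / 8))); last first.
    by rewrite le_eqVlt; apply/orP; left; apply/eqP; field; rewrite lt0r_neq0.
  have c0 : 0 <= 32 / s ^+ 2 by rewrite divr_ge0// exprn_ge0// ltW.
  apply: ler_pM => //.
    by apply: mulr_ge0 => //; lra.
  by apply: ler_wpM2l => //; lra.
have -> : G j e z y = (G j e z y - G j e z 0) + G j e z 0 by ring.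
by apply: le_trans (modulusD _ _) _; lra.
Qed.

(** All orders up to N share the disc of radius rho: derivability is a pointwise matter, so
    [tcoef_param] may be applied on a smaller disc around each point without any loss in the
    induction. *)
Lemma acf_derivable (e0 : C) (rho r del : R) N : 0 < rho -> 0 < r -> 0 < del ->
  r <= s / 16 -> 3 / 2 * del <= s / 16 ->
  (forall e, mod (e - e0) < rho -> mod e <= s / 8) ->
  (forall e k, mod (e - e0) < rho -> (0 < k <= N)%N -> resolv k e \in unitmx) ->
  (forall e n, mod (e - e0) < rho -> (n <= N)%N ->
    \sum_(k < n) (k.+1%:R * l1 (acf e k.+1) * r ^+ k.+1) ^+ 2 <= del ^+ 2) ->
  forall k, (0 < k <= N)%N -> forall j, hol (fun e => acf e k ord0 j) e0 rho.
Proof.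
move=> rho0 r0 d0 rs ds He Hu Hb; have ss := s0.
suff H n : (n <= N)%N -> forall k, (0 < k <= n)%N -> forall j, hol (fun e => acf e k ord0 j) e0 rho.
  by move=> k /andP[k0 kN]; apply: (H k kN); rewrite k0 leqnn.
elim: n => [_ [|k]//|n IH nN k /andP[k0]].
rewrite leq_eqVlt => /orP[/eqP ->|kn]; last first.
  by apply: IH; [exact: ltnW|rewrite k0 -ltnS].
move=> j e1 e1r; have {}IH := IH (ltnW nN).
have Jd e i l : mod (e - e0) < rho -> derivable (fun e => J e i l) e 1.
  by move=> /He es; apply: (derivable_Jmx s0 dF bF); lra.
have -> : (fun e => acf e n.+1 ord0 j) = (fun e => \sum_i
    gcoef n.+1 e (vpoly (acf e) n) ord0 i * invmx (resolv n.+1 e) i j).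
  by apply/funext => e; rewrite acfE mxE.
pose rho' := rho - mod (e1 - e0); have rho'0 : 0 < rho' by rewrite subr_gt0.
have near1 e : mod (e - e1) < rho' -> mod (e - e0) < rho.
  move=> H; have -> : e - e0 = (e - e1) + (e1 - e0) by ring.
  by apply: le_lt_trans (modulusD _ _) _; rewrite /rho' in H; lra.
apply: derivable_bigsum => i; apply: derivableM; last first.
  apply: (derivable_invmx rho'0).
    by move=> e /near1 er; apply: Hu => //; rewrite nN.
  move=> p l; have -> : (fun e => resolv n.+1 e p l) = fun e => (n.+1%:R * e) *+ (p == l) - J e p l.
    by apply/funext => e; rewrite !mxE.
  apply: derivableB; last exact: Jd.
  case: (p == l); last exact: derivable_cst.
  by apply: derivableM; [exact: derivable_cst|exact: derivable_id].
have -> : (fun e => gcoef n.+1 e (vpoly (acf e) n) ord0 i) =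
    (fun e => tcoef n.+1 (fun z => G i e z (vpoly (acf e) n z)) 0).
  by apply/funext => e; rewrite gcoefE.
have rho20 : 0 < rho' / 2 by lra.
have near2 e : mod (e - e1) <= rho' / 2 -> mod (e - e0) < rho.
  by move=> H; apply: near1; lra.
have ub e z : mod (e - e0) < rho -> mod z <= r -> l1 (vpoly (acf e) n z) <= 3 / 2 * del.
  by move=> er zr; apply: (vpoly_bound r0 d0 zr); apply: Hb => //; exact: ltnW.
apply: (@tcoef_param _ n.+1 (fun e z => G i e z (vpoly (acf e) n z)) e1 (rho' / 2) r 2 rho20 r0).
- move=> e z /near2 er zr; apply: (G_derivable dF).
    by rewrite /size3 /=; have := ub e z er zr; have := He e er; lra.
  by move=> l; exact: vpoly_derivable.
- move=> e z /near2 er zr.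
  have dy l : derivable (fun e => vpoly (acf e) n z ord0 l) e 1.
    have -> : (fun e => vpoly (acf e) n z ord0 l) =
        (fun e => \sum_(k < n) z ^+ k.+1 * acf e k.+1 ord0 l).
      by apply/funext => e'; rewrite vpolyE.
    apply: derivable_bigsum => k'; apply: derivableM; first exact: derivable_cst.
    by apply: IH => //; rewrite /= ltn_ord.
  apply: derivableB.
    apply: (@curve_derivable _ _ F id (fun=> z) (fun e => vpoly (acf e) n z)).
    + exact: derivable_id.
    + exact: derivable_cst.
    + exact: dy.
    apply: dF; rewrite /size3 /=; have := He e er; have := ub e z er; rewrite zr lexx => /(_ isT).
    lra.
  have -> : (fun e => (vpoly (acf e) n z *m J e) ord0 i) =
     (fun e => \sum_l vpoly (acf e) n z ord0 l * J e l i).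
    by apply/funext => e'; rewrite mxE.
  by apply: derivable_bigsum => l; apply: derivableM; [exact: dy|exact: Jd].
move=> e z /near2 er zr; apply: G_bound; first exact: He.
  by rewrite zr; lra.
by have := ub e z er; rewrite zr lexx => /(_ isT); lra.
Qed.

End Coefficients.

(** * Derivatives with respect to the parameter *)

Section Coordinates.
Variables (R : realType) (nu : nat).
Local Notation C := (Cx R).
Local Notation mod := (@modulus R).

Lemma derive1_coord (w : C -> 'rV[C]_nu) z j :
  (forall i, derivable (fun z => w z ord0 i) z 1) ->
  (derive1 w z) ord0 j = derive1 (fun z => w z ord0 j) z.
Proof.
move=> /differentiable_row dw.
have @cl : {linear 'rV[C]_nu -> C}.
  by exists (fun N : 'rV[C]_nu => N ord0 j); do 2![eexists]; do ?[constructor];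
     rewrite ?mxE// => ? *; rewrite ?mxE//; move=> ?; rewrite !mxE.
have cc : continuous cl by exact: coord_continuous.
have dc x : differentiable cl x by exact: linear_differentiable.
have E : (fun z : C => w z ord0 j) = cl \o w by [].
have dE : differentiable (cl \o w) z by exact: differentiable_comp.
by rewrite E (derive1E' dE) (derive1E' dw) (diff_comp dw (dc _)) /= (diff_lin _ cc).
Qed.

Lemma derive1n_coord (w : C -> 'rV[C]_nu) x (rho : R) n :
  (forall j, hol (fun z => w z ord0 j) x rho) ->
  forall z, mod (z - x) < rho -> forall j,
    (derive1n n w z) ord0 j = derive1n n (fun z => w z ord0 j) z.
Proof.
move=> Hw; elim: n => [//|n IH] z zr j; rewrite !derive1nS.
have rho'0 : 0 < rho - mod (z - x) by rewrite subr_gt0.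
have near1 i z' : mod (z' - z) < rho - mod (z - x) ->
    derive1n n (fun z => w z ord0 i) z' = (derive1n n w z') ord0 i.
  move=> H; rewrite IH//; have -> : z' - x = (z' - z) + (z - x) by ring.
  by apply: le_lt_trans (modulusD _ _) _; lra.
have Hn i : hol (derive1n n (fun z => w z ord0 i)) z (rho - mod (z - x)).
  have H := @hol_derive1n _ n _ _ _ (Hw i); apply: (hol_sub H); lra.
have zz : mod (z - z) < rho - mod (z - x) by rewrite subrr modulus0.
rewrite derive1_coord.
  have [_ ET] := tcoef_local 1 rho'0 (Hn j) (near1 j).
  exact: (etrans (esym (tcoef1 (fun z => (derive1n n w z) ord0 j) z))
    (etrans (esym ET) (tcoef1 (derive1n n (fun z => w z ord0 j)) z))).
by move=> i; have [H _] := tcoef_local 1 rho'0 (Hn i) (near1 i); exact: H.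
Qed.

End Coordinates.

(** * Factorial growth of the derivatives *)

Section Growth.
Variable R : realType.
Local Notation C := (Cx R).
Local Notation mod := (@modulus R).

(** The power n^i is at most the falling factorial of n + i of length i, which equals i! times a
    binomial coefficient bounded by 2^(n+i). *)
Lemma exp_le_fact n i : (n ^ i <= i`! * 2 ^ (n + i))%N.
Proof.
have H1 : (n ^ i <= (n + i) ^_ i)%N.
  elim: i => [|i IH]; first by rewrite ffactn0.
  by rewrite expnS addnS ffactnS; apply: leq_mul => //=; rewrite (leq_trans (leq_addr i n)).
have H2 m k : ('C(m, k) <= 2 ^ m)%N.
  elim: m k => [|m IH] [|k]; rewrite ?bin0 ?expn_gt0// binS expnS mul2n -addnn.
  exact: leq_add.
by apply: leq_trans H1 _; rewrite -bin_ffact mulnC leq_mul2l H2 orbT.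
Qed.

Lemma le_of_geom (x S K : R) : (forall L, x <= S + K / 2 ^+ L.+1) -> x <= S.
Proof.
move=> H; apply/ler_addgt0Pr => e e0.
have [K0|K0] := leP K 0.
  have := H 0%N; have : K / 2 ^+ 1 <= 0 by rewrite expr1; lra.
  lra.
pose L := Num.truncn (K / e).
have HL : K / e < L.+1%:R by exact: truncnS_gt.
apply: le_trans (H L) _; rewrite lerD2l ler_pdivrMr ?exprn_gt0//.
move: HL; rewrite ltr_pdivrMr// => HL.
have : L.+1%:R <= 2 ^+ L.+1 :> R by rewrite -natrX ler_nat ltnW// ltn_expl.
nra.
Qed.

(* The discs on which the [a n] live shrink with [n], so the expansion of [h] cannot
   be differentiated term by term: the [L]-th partial sum is compared with [h] on a
   disc of radius of order [1 / L], where the remainder [q ^ L] beats [L ^ i]. *)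
Lemma tcoef_family (h : C -> C) (a : nat -> C -> C) (e0 z : C) (c r d del M q : R) i :
  0 < c -> 0 < r -> 0 < d -> 0 <= del -> 0 <= M -> mod z <= r / 4 -> 0 <= q <= 1 / 4 ->
  (forall n, (0 < n)%N -> hol (a n) e0 (c / n%:R)) ->
  (forall n e, (0 < n)%N -> mod (e - e0) < c / n%:R -> mod (a n e) <= del / r ^+ n) ->
  hol h e0 d ->
  (forall L e, mod (e - e0) < d ->
    mod (h e - \sum_(n < L) a n.+1 e * z ^+ n.+1) <= M * q ^+ L) ->
  mod (tcoef i h e0) <= del * i`!%:R * (4 / c) ^+ i.
Proof.
move=> c0 r0 d0 del0 M0 zr /andP[q0 q1] Ha Hab Hh Htail.
have z0 := modulus_ge0 z.
have half (x : R) : 0 < x -> x / 2 < x by lra.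
have fi : 0 <= i`!%:R :> R by [].
have powle n : n%:R ^+ i <= i`!%:R * (2 ^+ n * 2 ^+ i) :> R.
  by rewrite -exprD -!natrX -natrM ler_nat; exact: exp_le_fact.
pose d1 := Num.min d c / 2.
have d10 : 0 < d1 by rewrite divr_gt0// lt_min d0.
have d1d : d1 < d.
  have : Num.min d c <= d by rewrite ge_min lexx.
  by rewrite /d1; lra.
have d1c : d1 < c.
  have : Num.min d c <= c by rewrite ge_min lexx orbT.
  by rewrite /d1; lra.
clearbody d1.
apply: (@le_of_geom _ _ (M * (i`!%:R * 2 ^+ i) / d1 ^+ i)) => L.
have L0 : 0 < L.+1%:R :> R by [].
(* Below both d and c / (L + 1), so the circle of radius t lies in the domain of h and of the first
   L + 1 functions a_n. *)
pose t := d1 / L.+1%:R.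
have t0 : 0 < t by rewrite divr_gt0.
have td : t < d.
  apply: le_lt_trans d1d; rewrite /t ler_pdivrMr//.
  by apply: ler_peMr; [exact: ltW|rewrite ler1n].
have cL0 : 0 < c / L.+1%:R by rewrite divr_gt0.
pose T := Num.min d (c / L.+1%:R).
have tT : t < T by rewrite lt_min td /= /t ltr_pM2r ?invr_gt0.
have Td : T <= d by rewrite ge_min lexx.
have Tc n : (0 < n <= L.+1)%N -> T <= c / n%:R.
  move=> /andP[n0 nL]; apply: (@le_trans _ _ (c / L.+1%:R)); first by rewrite ge_min lexx orbT.
  by rewrite ler_pM2l// lef_pV2 ?posrE ?ltr0n// ler_nat.
have T0 : 0 < T by rewrite lt_min d0.
clearbody T.
pose b (k : 'I_L.+1) e := z ^+ k.+1 * a k.+1 e.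
have Hb k : hol (b k) e0 T.
  apply: holM; first exact: hol_cst.
  by apply: (hol_sub (Ha k.+1 isT)); rewrite subrr modulus0 add0r Tc//= ltn_ord.
have [HS ES] := tcoef_sum i T0 Hb.
have HhT : hol h e0 T by apply: (hol_sub Hh); rewrite subrr modulus0 add0r.
have -> : tcoef i h e0 = \sum_(k < L.+1) tcoef i (b k) e0 +
    tcoef i (fun e => h e - \sum_(k < L.+1) b k e) e0.
  by rewrite (tcoefB i T0 HhT HS) ES addrC subrK.
apply: le_trans (modulusD _ _) _; apply: lerD.
  apply: le_trans (ler_modulus_sum _ _ _) _.
  (* Cauchy's inequality at radius c / (2 n) gives (2 n / c)^i, and n^i costs i! 2^(n+i). The
     assumption |z| <= r / 4 supplies 4^-n, so 2^-n is left for the summation. *)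
  apply: (@le_trans _ _ (\sum_(k < L.+1) (del * i`!%:R * (4 / c) ^+ i) * 2^-1 ^+ k.+1)).
    apply: ler_sum => k _.
    have Hk := Ha k.+1 isT.
    have ck0 : 0 < c / k.+1%:R by rewrite divr_gt0.
    rewrite (tcoefZ i _ ck0 Hk) modulusM modulusX.
    have Tb : mod (tcoef i (a k.+1) e0) <= del / r ^+ k.+1 / (c / k.+1%:R / 2) ^+ i.
      apply: tcoef_le; first by rewrite divr_gt0.
        by move=> e He; apply: Hk; exact: le_lt_trans He (half _ ck0).
      by move=> e He; apply: Hab; rewrite ?He //; exact: half.
    have zk : mod z ^+ k.+1 <= (r / 4) ^+ k.+1.
      by apply: lerXn2r => //; rewrite nnegrE; lra.
    have Tb0 : 0 <= del / r ^+ k.+1 / (c / k.+1%:R / 2) ^+ i.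
      by rewrite !divr_ge0// exprn_ge0// ?ltW// divr_gt0.
    apply: (@le_trans _ _ ((r / 4) ^+ k.+1 * (del / r ^+ k.+1 / (c / k.+1%:R / 2) ^+ i))).
      by apply: ler_pM => //; [exact: exprn_ge0|exact: modulus_ge0].
    have -> : (r / 4) ^+ k.+1 * (del / r ^+ k.+1 / (c / k.+1%:R / 2) ^+ i) =
        del * (2 / c) ^+ i * 4^-1 ^+ k.+1 * k.+1%:R ^+ i.
      rewrite !exprMn !exprVn; field.
      by rewrite !expf_neq0 ?pnatr_eq0// lt0r_neq0.
    have -> : del * i`!%:R * (4 / c) ^+ i * 2^-1 ^+ k.+1 =
        del * (2 / c) ^+ i * 4^-1 ^+ k.+1 * (i`!%:R * (2 ^+ k.+1 * 2 ^+ i)).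
      have -> : (4 / c) ^+ i = (2 / c) ^+ i * 2 ^+ i by rewrite -exprMn; congr (_ ^+ _); field; rewrite lt0r_neq0.
      have -> : 2^-1 ^+ k.+1 = 4^-1 ^+ k.+1 * 2 ^+ k.+1 :> R by rewrite -exprMn; congr (_ ^+ _); field.
      by ring.
    apply: ler_wpM2l (powle _).
    by rewrite !mulr_ge0// exprn_ge0// ?invr_ge0// divr_ge0// ltW.
  rewrite -mulr_sumr; apply: ler_piMr.
    by rewrite !mulr_ge0// exprn_ge0// divr_ge0// ltW.
  have := @geom_le R (2^-1) L.+1; rewrite invr_ge0 => /(_ (ler0n _ _)).
  have -> : \sum_(k < L.+1) 2^-1 ^+ k.+1 = 2^-1 * \sum_(n < L.+1) 2^-1 ^+ n :> R.
    by rewrite mulr_sumr; apply: eq_bigr => k _; rewrite exprS.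
  by move=> H; have := H ltac:(lra); lra.
(* The remainder after L + 1 terms is M q^(L+1). At radius t it acquires (L + 1)^i <= i! 2^(L+1+i),
   which still leaves 2^-(L+1) because q <= 1 / 4. *)
have Tb : mod (tcoef i (fun e => h e - \sum_(k < L.+1) b k e) e0) <= M * q ^+ L.+1 / t ^+ i.
  apply: tcoef_le => //.
    by move=> e He; have eT := le_lt_trans He tT; apply: derivableB; [exact: HhT|exact: HS].
  move=> e He; have -> : \sum_(k < L.+1) b k e = \sum_(n < L.+1) a n.+1 e * z ^+ n.+1.
    by apply: eq_bigr => k _; rewrite /b mulrC.
  by apply: Htail; rewrite He.
apply: le_trans Tb _.
have -> : M * q ^+ L.+1 / t ^+ i = M / d1 ^+ i * q ^+ L.+1 * L.+1%:R ^+ i.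
  rewrite /t !exprMn !exprVn; field.
  by rewrite !expf_neq0 ?pnatr_eq0// lt0r_neq0.
have c1 : 0 <= M / d1 ^+ i by rewrite divr_ge0// exprn_ge0// ltW.
have qL : q ^+ L.+1 <= 4^-1 ^+ L.+1 by apply: lerXn2r => //; rewrite ?nnegrE; lra.
apply: (@le_trans _ _ (M / d1 ^+ i * 4^-1 ^+ L.+1 * (i`!%:R * (2 ^+ L.+1 * 2 ^+ i)))).
  apply: ler_pM (powle _); last by apply: ler_wpM2l.
    by rewrite mulr_ge0// exprn_ge0.
  by rewrite exprn_ge0.
rewrite le_eqVlt; apply/orP; left; apply/eqP.
have -> : 4^-1 ^+ L.+1 = 2^-1 ^+ L.+1 * 2^-1 ^+ L.+1 :> R by rewrite -exprMn; congr (_ ^+ _); field.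
rewrite !exprVn; field.
by rewrite !expf_neq0 ?pnatr_eq0// lt0r_neq0.
Qed.

End Growth.

(** * Identification with the Taylor coefficients of an actual solution *)

Section Uniqueness.
Variables (R : realType) (nu : nat).
Local Notation C := (Cx R).
Local Notation mod := (@modulus R).
Local Notation V := (C * C * 'rV[C]_nu)%type.

Lemma vpoly_taylor (w : C -> 'rV[C]_nu) (r M : R) : 0 < r -> 0 <= M -> w 0 = 0 ->
  (forall z j, mod z <= r -> derivable (fun z => w z ord0 j) z 1) ->
  (forall z j, mod z <= r -> mod (w z ord0 j) <= M) ->
  forall n z, mod z <= r / 2 ->
  l1 (w z - vpoly (fun k => \row_j tcoef k (fun z => w z ord0 j) 0) n z) <=
    2 * M * nu%:R * (mod z / r) ^+ n.+1.
Proof.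
move=> r0 M0 w0 dw bw n z zr; have z0 := modulus_ge0 z.
have zr0 : 0 <= mod z / r by rewrite divr_ge0// ltW.
have zr1 : mod z / r <= 1 / 2 by rewrite ler_pdivrMr//; lra.
rewrite /l1; apply: (@le_trans _ _ (\sum_(j < nu) 2 * M * (mod z / r) ^+ n.+1)); last first.
  rewrite sumr_const card_ord -[_ *+ nu]mulr_natl le_eqVlt; apply/orP; left.
  by apply/eqP; ring.
apply: ler_sum => j _.
have [||[_ H] _] := @taylor _ (fun z => w z ord0 j) 0 r M r0.
- by move=> x; rewrite subr0 => xr; exact: dw.
- by move=> x; rewrite subr0 => xr; apply: bw; rewrite xr.
have zr' : mod z < r by lra.
have := H z n.+1 zr'; rewrite add0r.
have -> : psum (fun k => tcoef k (fun z => w z ord0 j) 0) n.+1 z =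
    vpoly (fun k => \row_j tcoef k (fun z => w z ord0 j) 0) n z ord0 j.
  rewrite /psum big_ord_recl tcoef0 w0 mxE mul0r add0r vpolyE.
  by apply: eq_bigr => k _; rewrite mxE mulrC.
rewrite [(w z - _) ord0 j]mxE [(- vpoly _ _ _) ord0 j]mxE.
set y := mod _; have y0 : 0 <= y by exact: modulus_ge0.
set t := mod z / r in zr0 zr1 *; set p := M * t ^+ n.+1.
by rewrite -[2 * M * _]mulrA -/p; nra.
Qed.

Lemma vpoly_le (a : nat -> 'rV[C]_nu) n z : mod z <= 1 ->
  l1 (vpoly a n z) <= (\sum_(k < n) l1 (a k.+1)) * mod z.
Proof.
move=> z1; have z0 := modulus_ge0 z.
apply: le_trans (l1_sum _) _; rewrite mulr_suml; apply: ler_sum => k _.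
rewrite l1Z modulusX mulrC; apply: ler_wpM2l; first exact: l1_ge0.
by rewrite exprS; apply: ler_piMr => //; apply: exprn_ile1.
Qed.

Variable F : V -> 'rV[C]_nu.
Local Notation G := (Gfun F).
Local Notation J := (Jmx F).

Variable s : R.
Hypothesis s0 : 0 < s.
Hypothesis dF : forall p, size3 p <= s -> differentiable F p.
Hypothesis bF : forall p j, size3 p <= s -> mod (F p ord0 j) <= 1.

(** Comparison of the coefficients of z^k: the left side of the equation contributes k e, and the
    linear part J of F is moved to the same side. *)
Lemma ode_tcoef e (w : C -> 'rV[C]_nu) (rho : R) k : (0 < k)%N -> mod e <= s / 8 -> 0 < rho ->
  (forall j, hol (fun z => w z ord0 j) 0 rho) -> w 0 = 0 ->
  (forall z, mod z < rho -> l1 (w z) <= s / 8) -> rho <= s / 8 ->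
  (forall z, mod z < rho -> (e * z) *: derive1 w z = F (e, z, w z)) ->
  (\row_j tcoef k (fun z => w z ord0 j) 0) *m resolv F k e = gcoef F k e w.
Proof.
move=> k0 es rho0 hw w0 wb rs ode; have ss := s0.
have dw z j : mod z < rho -> derivable (fun z => w z ord0 j) z 1.
  by move=> zr; apply: hw; rewrite subr0.
apply/rowP => j.
have [hz Ez] := tcoef_zderiv k rho0 (hw j).
have hG : hol (fun z => G j e z (w z)) 0 rho.
  move=> z; rewrite subr0 => zr; apply: (G_derivable dF).
    by rewrite /size3 /=; have := wb z zr; lra.
  by move=> i; exact: dw.
have hJi (i : 'I_nu) : hol (fun z => J e i j * w z ord0 i) 0 rho.
  by apply: holM; [exact: hol_cst|exact: hw].
have [hJ EJ] := tcoef_sum k rho0 hJi.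
have h1 : hol (fun z => e * (z * derive1 (fun z => w z ord0 j) z)) 0 rho.
  by apply: holM; [exact: hol_cst|exact: hz].
have E z : mod (z - 0) < rho -> e * (z * derive1 (fun z => w z ord0 j) z) =
    G j e z (w z) + \sum_(i < nu) J e i j * w z ord0 i.
  rewrite subr0 => zr; rewrite -derive1_coord; last by move=> i; exact: dw.
  have := congr1 (fun v : 'rV[C]_nu => v ord0 j) (ode z zr); rewrite mxE mulrA => ->.
  rewrite /Gfun [(w z *m _) ord0 j]mxE.
  under [X in _ = _ + X]eq_bigr do rewrite mulrC.
  by rewrite subrK.
have [_] := tcoef_local k rho0 h1 E.
rewrite (tcoefZ k _ rho0 hz) Ez (tcoefD k rho0 hG hJ) EJ => Ek.
rewrite gcoefE /resolv mulmxBr mul_mx_scalar.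
have -> (A B : 'rV[C]_nu) : (A - B) ord0 j = A ord0 j - B ord0 j by rewrite !mxE.
rewrite [X in X - _]mxE [X in _ * X - _]mxE [X in _ - X]mxE.
apply/eqP; rewrite subr_eq -mulrA mulrCA Ek; apply/eqP; congr (_ + _).
apply: eq_bigr => i _; rewrite [RHS]mulrC [X in _ = _ * X]mxE.
exact: (tcoefZ k (J e i j) rho0 (hw i)).
Qed.

(** The solution w differs from its Taylor polynomial of degree n by O(z^(n+1)), so [G_congr] puts
    the polynomial in its place. The Taylor coefficients then satisfy the defining recursion, which
    determines them as all matrices are invertible. *)
Lemma acf_unique e (w : C -> 'rV[C]_nu) (rho : R) : mod e <= s / 8 -> 0 < rho ->
  (forall j, hol (fun z => w z ord0 j) 0 rho) -> w 0 = 0 ->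
  (forall z, mod z < rho -> (e * z) *: derive1 w z = F (e, z, w z)) ->
  (forall k, (0 < k)%N -> resolv F k e \in unitmx) ->
  forall k, (0 < k)%N -> \row_j tcoef k (fun z => w z ord0 j) 0 = acf F e k.
Proof.
move=> es rho0 hw w0 ode Hu; have ss := s0.
pose b k : 'rV[C]_nu := \row_j tcoef k (fun z => w z ord0 j) 0.
have s80 : 0 < s / 8 by lra.
have [d d0 Hd] : exists2 d : R, 0 < d & forall z', mod (z' - 0) < d -> l1 (w z' - w 0) <= s / 8.
  by apply: row_near => // i; apply: hw; rewrite subrr modulus0.
have [r [r0 rr rd rs r1]] : exists r : R, [/\ 0 < r, r < rho, r < d, r <= s / 8 & r <= 1].
  exists (Num.min (Num.min (rho / 2) (d / 2)) (Num.min (s / 8) 1)); set m := Num.min _ _.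
  have m0 : 0 < m by rewrite !lt_min ltr01 s80 !divr_gt0.
  have m1 : m <= rho / 2 by rewrite !ge_min lexx.
  have m2 : m <= d / 2 by rewrite !ge_min lexx orbT.
  by split; rewrite ?m0//; [lra|lra|rewrite !ge_min lexx !orbT|rewrite !ge_min lexx !orbT].
have wb z : mod z <= r -> l1 (w z) <= s / 8.
  by move=> zr; have := Hd z; rewrite w0 !subr0; apply; lra.
have dw z j : mod z <= r -> derivable (fun z => w z ord0 j) z 1.
  by move=> zr; apply: hw; rewrite subr0; lra.
have T := vpoly_taylor r0 (ltW s80) w0 dw.
have {}T := T (fun z j zr => le_trans (l1_comp _ _) (wb z zr)).
have r20 : 0 < r / 2 by lra.
have step k : (0 < k)%N -> b k *m resolv F k e = gcoef F k e w.
  move=> k0; apply: (@ode_tcoef e w r k) => //.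
  - by move=> j; apply: (hol_sub (hw j)); rewrite subrr modulus0; lra.
  - by move=> z zr; apply: wb; lra.
  - by move=> z zr; apply: ode; lra.
have main n : b n.+1 = gcoef F n.+1 e (vpoly b n) *m invmx (resolv F n.+1 e).
  have <- : gcoef F n.+1 e w = gcoef F n.+1 e (vpoly b n).
    apply: gcoef_eq => j; apply: esym.
    pose B1 := \sum_(k < n) l1 (b k.+1).
    pose B2 := 2 * (s / 8) * nu%:R / r ^+ n.+1.
    have B10 : 0 <= B1 by apply: sumr_ge0 => i _; exact: l1_ge0.
    have B20 : 0 <= B2 by rewrite divr_ge0 ?exprn_ge0 ?mulr_ge0//; lra.
    apply: (@G_congr _ _ F s s0 dF bF j e n.+1 (vpoly b n) w (r / 2) (B1 + B2) _ r20 es) => //.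
    - by move=> z i _; exact: vpoly_derivable.
    - by move=> z i zr; apply: dw; lra.
    - move=> z zr; apply: (@le_trans _ _ (B1 * mod z)); first by apply: vpoly_le; lra.
      by apply: ler_wpM2r; [exact: modulus_ge0|lra].
    move=> z zr; apply: le_trans (T n z (ltW zr)) _.
    apply: (@le_trans _ _ (B2 * mod z ^+ n.+1)).
      by rewrite exprMn exprVn /B2 [X in _ * X]mulrC !mulrA lexx.
    by apply: ler_wpM2r; [apply: exprn_ge0; exact: modulus_ge0|lra].
  by rewrite -step// mulmxK ?Hu.
suff H n : forall k, (0 < k <= n)%N -> b k = acf F e k.
  by move=> k k0; apply: (H k); rewrite k0 leqnn.
clear T step; clearbody b.
elim: n => [[|k]//|n IH k /andP[k0]]; rewrite leq_eqVlt => /orP[/eqP ->|kn].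
  have EV : vpoly b n = vpoly (acf F e) n by apply/funext => z; exact: vpoly_ext.
  exact: etrans (main n) (etrans (congr1 (fun p => gcoef F n.+1 e p *m
    invmx (resolv F n.+1 e)) EV) (esym (acfE F n e))).
by apply: IH; rewrite k0.
Qed.

End Uniqueness.

(** * Choice of neighbourhoods and radii *)

Section Localization.
Variables (R : realType) (nu : nat).
Local Notation C := (Cx R).
Local Notation mod := (@modulus R).
Local Notation V := (C * C * 'rV[C]_nu)%type.

Lemma nbhs_size3 (A : set V) : nbhs (0 : V) A ->
  exists2 s : R, 0 < s & forall p, size3 p <= s -> A p.
Proof.
move=> /nbhs_ballP[e /= /posC[e' e0 ->] He]; exists (e' / 2); first lra.
move=> [[p1 p2] p3]; rewrite /size3 /= => H; apply: He.
have h1 := modulus_ge0 p1; have h2 := modulus_ge0 p2; have h3 := l1_ge0 p3.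
split; first split.
- by apply/modulus_ball; rewrite /= sub0r modulusN; lra.
- by apply/modulus_ball; rewrite /= sub0r modulusN; lra.
split=> [|i j]; first by rewrite ltcR.
apply/modulus_ball; rewrite mxE sub0r modulusN.
by have := l1_comp p3 j; rewrite (ord1 i); lra.
Qed.

(** Since F(0) = 0, continuity gives the bound 1 near 0 without any rescaling. *)
Lemma local_bounds (F : V -> 'rV[C]_nu) (rho rho1 : R) : 0 < rho -> 0 < rho1 ->
  holomorphic_near (@cdisc R rho `*` @cdisc R rho1 `*` @cpolydisc R nu rho) F ->
  F 0 = 0 ->
  exists s : R, [/\ 0 < s, forall p, size3 p <= s -> differentiable F p &
    forall p j, size3 p <= s -> mod (F p ord0 j) <= 1].
Proof.
move=> rho0 rho10 [U [Uo KU HU]] F0.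
have U0 : U 0.
  apply: KU; split; first by split; rewrite /cdisc /= modulus0 ltW.
  by move=> j; rewrite /cdisc /= mxE modulus0 ltW.
have cF : {for (0 : V), continuous F} by apply: differentiable_continuous; exact: HU.
have H : nbhs (0 : V) (fun p => U p /\ forall j, mod (F p ord0 j) <= 1).
  apply: filterI; first exact: open_nbhs_nbhs.
  apply: (@filter_forall _ _ (fun j p => mod (F p ord0 j) <= 1) (nbhs (0 : V))) => j.
  have cj : {for (0 : V), continuous (fun p => F p ord0 j)}.
    apply: (@continuous_comp _ _ _ F (fun M : 'rV[C]_nu => M ord0 j)) => //.
    exact: coord_continuous.
  have /cvgC_P/(_ 1 ltr01) := cj.
  by rewrite F0 mxE; apply: filterS => p; rewrite subr0.
have [s s0 Hs] := nbhs_size3 H.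
exists s; split; first exact: s0.
  by move=> p /Hs[Up _]; exact: HU.
by move=> p j /Hs[_ H1]; exact: (H1 j).
Qed.

(** The discontinuity of [Arg] is avoided: for half-opening at most pi the sector is described by
    strict inequalities between Lipschitz functions, through [Arg_lt]. *)
Lemma sector_open (gamma E : R) (e0 : C) : 0 < gamma -> gamma / 2 <= pi ->
  sector gamma E e0 -> exists2 d : R, 0 < d & forall e, mod (e - e0) < d -> sector gamma E e.
Proof.
move=> g0 gpi [e00 e0E]; have th : 0 <= gamma / 2 <= pi by apply/andP; split; [lra|].
have ne0 : e0 != 0 by rewrite -modulus_gt0.
rewrite (Arg_lt ne0 th) => H.
pose co : R := cos (gamma / 2); rewrite -/co in H.
have c1 : co <= 1 by exact: cos_le1.
have c2 : -1 <= co by exact: cos_geN1.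
exists (Num.min ((complex.Re e0 - co * mod e0) / 2) (Num.min (mod e0) (E - mod e0))).
  by rewrite !lt_min e00 subr_gt0 e0E divr_gt0// subr_gt0.
move=> e; rewrite !lt_min => /andP[h1 /andP[h2 h3]].
have a1 : mod e0 - mod (e - e0) <= mod e.
  by have := modulusDB e0 (e0 - e); rewrite subKr modulusBC; lra.
have a2 : mod e <= mod e0 + mod (e - e0).
  by have := modulusD e0 (e - e0); rewrite addrC subrK.
have a3 : complex.Re e0 - mod (e - e0) <= complex.Re e.
  have := Re_modulus (e0 - e); rewrite modulusBC.
  have -> : complex.Re (e0 - e) = complex.Re e0 - complex.Re e by case: (e0) (e) => [a b] [a' b'].
  by rewrite ler_norml => /andP[_]; lra.
have m0 : 0 < mod e by lra.
split => //; first by lra.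
rewrite Arg_lt -?modulus_gt0// -/co.
have x0 := modulus_ge0 (e - e0).
have : co * (mod e - mod e0) <= mod (e - e0).
  have [c0|c0] := leP 0 co; nra.
by move: a1 a2 a3 h1; clearbody co; lra.
Qed.

(** First del, small enough for the term quadratic in q to have coefficient at most 1 / 2 in front
    of del^2; then r, small compared with del, so that the remaining term takes the other half.
    Since r <= del <= 1 / 3, q is at most both 3 del and 1. *)
Lemma choose_radii (n s K sigma : R) : 1 <= n -> 0 < s -> 0 < K -> 0 < sigma ->
  exists del r : R, [/\ 0 < del, 0 < r, r <= s / 16, 3 / 2 * del <= s / 16 & r <= sigma / 2] /\
  K ^+ 2 * (n * (n * (2 * (r * (4 / s + 1 + 32 / s ^+ 2 * (r + 2 * del))) ^+ 2 +
    2 * (32 / s ^+ 2 * (r + 2 * del)) ^+ 2 * (n * del ^+ 2)))) <= del ^+ 2.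
Proof.
move=> n1 s0 K0 sig0; have [P PE] : exists P, P = 32 / s ^+ 2 by eexists.
have P0 : 0 < P by rewrite PE divr_gt0// exprn_gt0.
pose A := 4 / s + 1 + P.
have A0 : 0 < A by rewrite !addr_gt0// divr_gt0.
have n0 : 0 < n by lra.
(* D del <= 1 amounts to K n^2 P (3 del) <= 1 / 2, and 3 del bounds q. *)
pose D := 6 * (K * n ^+ 2 * P).
have D0 : 0 < D by rewrite mulr_gt0// mulr_gt0// mulr_gt0// exprn_gt0.
have [del [d0 d1 d2 d3]] : exists del : R, [/\ 0 < del, del <= s / 24, del <= 1 / 3 & del <= D^-1].
  exists (Num.min (s / 24) (Num.min (1 / 3) D^-1)); split; rewrite ?ge_min ?lexx ?orbT//.
  by rewrite !lt_min invr_gt0 D0 !divr_gt0.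
(* B r <= del amounts to K n A r <= del / 2. *)
pose B := 2 * (K * n * A).
have B0 : 0 < B by rewrite !mulr_gt0.
have [r [r0 r1 r2 r3 r4]] : exists r : R, [/\ 0 < r, r <= del, r <= s / 16, r <= sigma / 2 & r <= del / B].
  exists (Num.min (Num.min del (s / 16)) (Num.min (sigma / 2) (del / B))).
  by split; rewrite ?ge_min ?lexx ?orbT// !lt_min d0 !divr_gt0.
exists del, r; split; first by split => //; lra.
rewrite -PE; set q := r + 2 * del.
have q0 : 0 < q by rewrite /q; lra.
have q1 : q <= 1 by rewrite /q; lra.
have q3 : q <= 3 * del by rewrite /q; lra.
clearbody q.
have DB : D * del <= 1 by rewrite mulrC -ler_pdivlMr// mul1r.
have rB : B * r <= del by rewrite mulrC -ler_pdivlMr.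
have X : K * n * (r * (4 / s + 1 + P * q)) <= del / 2.
  apply: (@le_trans _ _ (K * n * (r * A))); last by move: rB; rewrite /B; lra.
  apply: ler_wpM2l; first by rewrite mulr_ge0// ltW.
  apply: ler_wpM2l; first exact: ltW.
  by rewrite /A lerD2l; apply: ler_piMr; rewrite // ltW.
have Y : K * n ^+ 2 * (P * q) <= 1 / 2.
  apply: (@le_trans _ _ (K * n ^+ 2 * (P * (3 * del)))); last by move: DB; rewrite /D; lra.
  apply: ler_wpM2l; first by rewrite mulr_ge0// ?exprn_ge0// ltW.
  by apply: ler_wpM2l; first exact: ltW.
have X0 : 0 <= K * n * (r * (4 / s + 1 + P * q)).
  apply: mulr_ge0; first by rewrite mulr_ge0// ltW.
  by apply: mulr_ge0; [exact: ltW|rewrite ltW// !addr_gt0 ?divr_gt0 ?mulr_gt0].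
have Y0 : 0 <= K * n ^+ 2 * (P * q).
  apply: mulr_ge0; first by rewrite mulr_ge0// ?exprn_ge0// ltW.
  by rewrite mulr_ge0// ltW.
have X2 : (K * n * (r * (4 / s + 1 + P * q))) ^+ 2 <= (del / 2) ^+ 2.
  by apply: lerXn2r => //; rewrite nnegrE; lra.
have Y2 : (K * n ^+ 2 * (P * q)) ^+ 2 <= (1 / 2) ^+ 2.
  by apply: lerXn2r => //; rewrite nnegrE; lra.
set x := r * _ in X2 *; set y := P * q in Y2 *.
have Z : K ^+ 2 * n ^+ 3 * y ^+ 2 <= 1 / 4.
  have E : (1 / 2) ^+ 2 = 1 / 4 :> R by field.
  rewrite -E; apply: le_trans Y2.
  have -> : (K * n ^+ 2 * y) ^+ 2 = K ^+ 2 * n ^+ 3 * y ^+ 2 * n by ring.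
  apply: ler_peMr n1; apply: mulr_ge0; last exact: sqr_ge0.
  by apply: mulr_ge0; [exact: sqr_ge0|apply: exprn_ge0; exact: ltW].
have -> : K ^+ 2 * (n * (n * (2 * x ^+ 2 + 2 * y ^+ 2 * (n * del ^+ 2)))) =
  2 * (K * n * x) ^+ 2 + 2 * (K ^+ 2 * n ^+ 3 * y ^+ 2 * del ^+ 2) by ring.
have Z2 := ler_wpM2r (sqr_ge0 del) Z.
have E4 : (del / 2) ^+ 2 = del ^+ 2 / 4 by field.
by rewrite E4 in X2; lra.
Qed.

End Localization.

(** * Uniform bounds on the coefficients around the sector *)

Section Resolvents.
Variables (R : realType) (nu : nat).
Local Notation C := (Cx R).
Local Notation mod := (@modulus R).
Local Notation V := (C * C * 'rV[C]_nu)%type.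
Variable F : V -> 'rV[C]_nu.
Local Notation J := (Jmx F).
Variable s : R.
Hypothesis s0 : 0 < s.
Hypothesis dF : forall p, size3 p <= s -> differentiable F p.
Hypothesis bF : forall p j, size3 p <= s -> mod (F p ord0 j) <= 1.

(* [k * e0] stays in the sector, whatever [k]. *)
Lemma resolv_bound (kap th em c : R) e0 e k : 0 < kap -> em <= s / 4 ->
  nu%:R * (8 / s ^+ 2 * em) <= kap / 4 -> c <= kap / 4 ->
  (forall t : C, t != 0 -> `|Arg t| < th ->
    forall v : 'rV[C]_nu, kap * l1 v <= l1 (v *m (t%:M - J 0))) ->
  e0 != 0 -> `|Arg e0| < th -> (0 < k)%N -> mod (e - e0) <= c / k%:R -> mod e <= em ->
  resolv F k e \in unitmx /\
  forall v, l1 (v *m invmx (resolv F k e)) <= (kap / 2)^-1 * l1 v.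
Proof.
move=> kap0 ems emk ck Hres ne0 Ae0 k0 ee0 eem.
have kk : 0 < k%:R :> R by rewrite ltr0n.
apply: lower_unit; first by rewrite divr_gt0.
apply: (@resolvent_pert _ _ (J 0) (J e) kap (8 / s ^+ 2 * em) (k%:R * e0) (k%:R * e) kap0) => //.
- apply: Hres; first by rewrite mulf_neq0// pnatr_eq0 -lt0n.
  have -> : (k%:R : C) = ((k%:R : R)%:C)%C by rewrite rmorph_nat.
  by rewrite Arg_scale.
- rewrite -mulrBr modulusM modulus_nat; apply: le_trans ck.
  by rewrite mulrC -ler_pdivlMr.
move=> i j; apply: le_trans (Jmx_lip s0 dF bF _ _ _) _; first lra.
by apply: ler_wpM2l => //; rewrite divr_ge0// exprn_ge0// ltW.
Qed.

End Resolvents.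

Section GevreyBound.
Variables (R : realType) (nu : nat).
Local Notation C := (Cx R).
Local Notation mod := (@modulus R).
Local Notation V := (C * C * 'rV[C]_nu)%type.

(** The four constants depend neither on e0 nor on n. For e within c / n of e0, every k e with k <=
    n is within kap / 4 of k e0, which is all that the first n steps of the recursion require. *)
Lemma acf_gevrey_data (F : V -> 'rV[C]_nu) (s gamma sigma : R) : (0 < nu)%N ->
  0 < s -> (forall p, size3 p <= s -> differentiable F p) ->
  (forall p j, size3 p <= s -> mod (F p ord0 j) <= 1) ->
  0 < gamma -> 0 < sigma -> jacobian_f F 0 0 0 \in unitmx ->
  (forall lambda : C, eigenvalue (jacobian_f F 0 0 0) lambda -> gamma / 2 < `|Arg lambda|) ->
  exists E c del r : R, [/\ 0 < E <= s / 8, 0 < c, 0 < del, 0 < r <= sigma / 2 &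
    forall e0, sector gamma E e0 ->
    (forall k, (0 < k)%N -> resolv F k e0 \in unitmx) /\
    forall n, (0 < n)%N ->
      (forall j, hol (fun e => acf F e n ord0 j) e0 (c / n%:R)) /\
      forall e, mod (e - e0) < c / n%:R -> l1 (acf F e n) <= del / r ^+ n].
Proof.
move=> nu0 s0 dF bF g0 sig0 hA hl.
have [kap kap0 Hres] : exists2 kap : R, 0 < kap & forall t : C, t != 0 -> `|Arg t| < gamma / 2 ->
    forall v : 'rV[C]_nu, kap * l1 v <= l1 (v *m (t%:M - Jmx F 0)).
  apply: resolvent; first by rewrite divr_gt0.
    by rewrite -unitmx_tr; exact: hA.
  exact: hl.
have nR : 1 <= nu%:R :> R by rewrite ler1n.
pose D := nu%:R * (8 / s ^+ 2); have D0 : 0 < D by rewrite mulr_gt0 ?divr_gt0 ?exprn_gt0 ?ltr0n.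
have [em [em0 em1 em2]] : exists em : R, [/\ 0 < em, em <= s / 16 & nu%:R * (8 / s ^+ 2 * em) <= kap / 4].
  exists (Num.min (s / 16) (kap / 4 / D)); rewrite lt_min ge_min lexx !divr_gt0//; split => //.
  by rewrite mulrA -/D mulrC -ler_pdivlMr// ge_min lexx orbT.
(* As |e0| < em / 2, the first bound keeps |e| <= em; the second keeps k e close to the sector. *)
pose c := Num.min (em / 2) (kap / 4).
have c0 : 0 < c by rewrite lt_min !divr_gt0.
have c1 : c <= em / 2 by rewrite ge_min lexx.
have c2 : c <= kap / 4 by rewrite ge_min lexx orbT.
clearbody c.
have K0 : 0 < (kap / 2)^-1 by rewrite invr_gt0 divr_gt0.
have [del [r [[d0 r0 r1 d1 r2] small]]] := choose_radii nR s0 K0 sig0.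
exists (em / 2), c, del, r; split => //.
- by apply/andP; split; lra.
- by rewrite r0.
move=> e0 [e00 e0E Ae0].
have ne0 : e0 != 0 by rewrite -modulus_gt0.
have near_e k e : (0 < k)%N -> mod (e - e0) <= c / k%:R -> mod e <= em.
  move=> k0 H; have : c / k%:R <= c.
    by rewrite ler_pdivrMr ?ltr0n//; apply: ler_peMr; [exact: ltW|rewrite ler1n].
  by have := modulusD (e - e0) e0; rewrite subrK; lra.
have Hr k e : (0 < k)%N -> mod (e - e0) <= c / k%:R -> resolv F k e \in unitmx /\
    forall v, l1 (v *m invmx (resolv F k e)) <= (kap / 2)^-1 * l1 v.
  move=> k0 H; have em' : em <= s / 4 by lra.
  exact: (resolv_bound s0 dF bF kap0 em' em2 c2 Hres ne0 Ae0 k0 H (near_e k e k0 H)).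
have mono k n : (0 < k <= n)%N -> c / n%:R <= c / k%:R.
  move=> /andP[k0 kn]; have n0 := leq_trans k0 kn.
  by rewrite ler_pM2l// lef_pV2 ?posrE ?ltr0n// ler_nat.
have Hb N e : (0 < N)%N -> mod (e - e0) < c / N%:R -> forall n, (n <= N)%N ->
    \sum_(k < n) (k.+1%:R * l1 (acf F e k.+1) * r ^+ k.+1) ^+ 2 <= del ^+ 2.
  move=> N0 He.
  have es : mod e <= s / 8 by have := near_e N e N0 (ltW He); lra.
  apply: (acf_bound s0 dF bF (ltW K0) r0 d0 es r1 d1 (erefl _) _ small).
  move=> k v kN; have /andP[k0 _] := kN.
  by have [_] := Hr k e k0 (le_trans (ltW He) (mono k N kN)); exact.
split=> [k k0|n n0].
  have ee : mod (e0 - e0) <= c / k%:R by rewrite subrr modulus0 divr_ge0// ltW.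
  by have [] := Hr k e0 k0 ee.
have cn0 : 0 < c / n%:R by rewrite divr_gt0// ltr0n.
split.
  apply: (@acf_derivable _ _ F s s0 dF bF e0 (c / n%:R) r del n cn0 r0 d0 r1 d1).
  - by move=> e He; have := near_e n e n0 (ltW He); lra.
  - move=> e k He kn; have /andP[k0 _] := kn.
    by have [] := Hr k e k0 (le_trans (ltW He) (mono k n kn)).
  - by move=> e m He mn; exact: (Hb n e n0 He m mn).
  - by rewrite n0 leqnn.
(* Only the last term of the sum of squares is kept, and its weight n >= 1 is dropped. *)
move=> e He; have := Hb n e n0 He n (leqnn n).
case: n n0 {cn0 He} => [//|n] _; rewrite big_ord_recr /=.
set S := \sum_(i < n) _; have S0 : 0 <= S by apply: sumr_ge0 => i _; exact: sqr_ge0.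
rewrite ler_pdivlMr ?exprn_gt0//; set x := l1 _; set y := r ^+ _ => H.
have x0 : 0 <= x by exact: l1_ge0.
have y0 : 0 <= y by rewrite exprn_ge0// ltW.
have xy0 : 0 <= x * y by exact: mulr_ge0.
have H2 : n.+1%:R * x * y <= del.
  rewrite -(@ler_pXn2r _ 2) ?nnegrE//; first by lra.
    by rewrite -mulrA mulr_ge0.
  exact: ltW.
apply: le_trans H2; rewrite -mulrA; apply: ler_peMl => //.
by rewrite ler1n.
Qed.

End GevreyBound.

(** * The estimate for the derivatives of the solution *)

Section Slices.
Variables (R : realType) (nu : nat).
Local Notation C := (Cx R).

Lemma slice_z (f : C * C -> 'rV[C]_nu) (e z : C) j : differentiable f (e, z) ->
  derivable (fun z => f (e, z) ord0 j) z 1.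
Proof.
move=> df; apply/derivable1_diffP.
apply: (@differentiable_comp _ _ _ _ (fun z => f (e, z)) (fun M : 'rV[C]_nu => M ord0 j)).
  apply: (@differentiable_comp _ _ _ _ (fun z : C => (e, z)) f) => //.
exact: differentiable_coord.
Qed.

Lemma slice_e (f : C * C -> 'rV[C]_nu) (e z : C) j : differentiable f (e, z) ->
  derivable (fun e => f (e, z) ord0 j) e 1.
Proof.
move=> df; apply/derivable1_diffP.
apply: (@differentiable_comp _ _ _ _ (fun e => f (e, z)) (fun M : 'rV[C]_nu => M ord0 j)).
  apply: (@differentiable_comp _ _ _ _ (fun e : C => (e, z)) f) => //.
exact: differentiable_coord.
Qed.

Lemma euclidean_norm_le (v : 'rV[C]_nu) (b : R) : 0 <= b ->
  (forall j, modulus (v ord0 j) <= b) -> euclidean_norm v <= nu%:R * b.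
Proof.
move=> b0 H; have l0 := l1_ge0 v; apply: (@le_trans _ _ (l1 v)).
  by rewrite -[leRHS](ger0_norm l0) -sqrtr_sqr /euclidean_norm ler_sqrt ?sqr_ge0// sqr_l1.
rewrite /l1; apply: (@le_trans _ _ (\sum_(j < nu) b)); first exact: ler_sum.
by rewrite sumr_const card_ord -[_ *+ nu]mulr_natl.
Qed.

End Slices.

Theorem proposition1 (R : realType) (nu : nat) (hnu : (1 <= nu)%N)
  (rho rho1 : R) (hrho : 0 < rho) (hrho1 : rho < rho1)
  (F : Cx R * Cx R * 'rV[Cx R]_nu -> 'rV[Cx R]_nu)
  (hF : holomorphic_near (cdisc rho `*` cdisc rho1 `*` @cpolydisc R nu rho) F)
  (hF0 : forall e : Cx R, cdisc rho e -> F (e, 0, 0) = 0)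
  (gamma : R) (hgamma : 0 < gamma)
  (hA : jacobian_f F 0 0 0 \in unitmx)
  (hlambda : forall lambda : Cx R,
     eigenvalue (jacobian_f F 0 0 0) lambda -> gamma / 2 < `|Arg lambda|)
  (E : R) (hE0 : 0 < E) (hE : E <= rho)
  (sigma : R) (hsigma0 : 0 < sigma) (hsigma : sigma <= rho1)
  (f : Cx R * Cx R -> 'rV[Cx R]_nu)
  (hf : is_solution F rho gamma E sigma f)
  (hf_unique : forall g, is_solution F rho gamma E sigma g ->
     forall p, (sector gamma E `*` disc sigma) p -> g p = f p)
  (fstar : Cx R -> 'rV[Cx R]_nu)
  (hfstar : is_reduced_solution F rho sigma fstar)
  (hfstar_unique : forall g, is_reduced_solution F rho sigma g ->
     forall z, disc sigma z -> g z = fstar z)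
  (hlim : forall z, disc sigma z ->
     (fun e => f (e, z)) @ within (sector gamma E) (nbhs 0) --> fstar z) :
  exists sigma1 E1 K mu : R,
    [/\ 0 < sigma1 <= sigma, 0 < E1 <= E, 0 < K, 0 < mu &
        forall (i : nat) (e z : Cx R), sector gamma E1 e -> cdisc sigma1 z ->
          euclidean_norm (phi f i e z) <= K * i`!%:R * mu ^+ i].
Proof.
clear hf_unique fstar hfstar hfstar_unique hlim.
have F0 : F 0 = 0 by apply: hF0; rewrite /cdisc /= modulus0 ltW.
have rho10 : 0 < rho1 by lra.
have [s [s0 dF bF]] := local_bounds hrho rho10 hF F0.
have [E2 [c [del [r [/andP[E20 E2s] c0 d0 /andP[r0 r1] Hdata]]]]] :=
  acf_gevrey_data hnu s0 dF bF hgamma hsigma0 hA hlambda.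
(* As nu >= 1 there is an eigenvalue; it is nonzero by invertibility, and its argument lies between
   gamma / 2 and pi. *)
have gpi : gamma / 2 <= pi.
  have [lam Hlam] := @eigenvalue_closed (Cx R) nu (jacobian_f F 0 0 0) hnu.
  apply: le_trans (ltW (hlambda _ Hlam)) _; apply: Arg_le_pi.
  apply/eqP => lam0; have /eigenvalueP[v] := Hlam; rewrite lam0 scale0r => Hv /negP; apply.
  by rewrite -(mulmxK hA v) Hv mul0mx.
have [hol_f bnd_f f0 ode] := hf.
pose E1 := Num.min E E2.
have E1E : E1 <= E by rewrite ge_min lexx.
have E1E2 : E1 <= E2 by rewrite ge_min lexx orbT.
have E10 : 0 < E1 by rewrite lt_min hE0.
have nu0 : 0 < nu%:R :> R by rewrite ltr0n.
have sub1 e : sector gamma E1 e -> sector gamma E e.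
  by move=> [h1 h2 h3]; split => //; exact: lt_le_trans h2 E1E.
have sub2 e : sector gamma E1 e -> sector gamma E2 e.
  by move=> [h1 h2 h3]; split => //; exact: lt_le_trans h2 E1E2.
have coef e : sector gamma E1 e -> forall k, (0 < k)%N ->
    \row_j tcoef k (fun z => f (e, z) ord0 j) 0 = acf F e k.
  move=> Se; have [Hu _] := Hdata e (sub2 e Se).
  have es : modulus e <= s / 8 by case: Se => _ h _; lra.
  apply: (@acf_unique _ _ F s s0 dF bF e (fun z => f (e, z)) sigma es hsigma0 _ _ _ Hu).
  - move=> j z; rewrite subr0 => zs; apply: slice_z; apply: hol_f.
    by split; [exact: sub1|].
  - exact: f0 (sub1 e Se).
  - by move=> z zs; exact: (ode e z (sub1 e Se) zs).
have sig2 : 0 < sigma / 2 by lra.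
(* The solution takes values in the polydisc of radius rho, so Cauchy's inequalities on |z| = sigma
   / 2 bound the remainder uniformly in e. *)
have tail e z n : sector gamma E1 e -> modulus z <= sigma / 4 ->
    l1 (f (e, z) - vpoly (acf F e) n z) <= 2 * rho * nu%:R * (modulus z / (sigma / 2)) ^+ n.+1.
  move=> Se zs.
  have <- : vpoly (fun k => \row_j tcoef k (fun z => f (e, z) ord0 j) 0) n z = vpoly (acf F e) n z.
    by apply: vpoly_ext => k /andP[k0 _]; exact: coef.
  apply: (vpoly_taylor sig2 (ltW hrho) (f0 e (sub1 e Se))).
  - move=> z' j zs'; apply: slice_z; apply: hol_f; split; first exact: sub1.
    by rewrite /disc /=; lra.
  - by move=> z' j zs'; apply: (bnd_f e z' (sub1 e Se)); rewrite /disc /=; lra.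
  - by lra.
(* The quarter is what [tcoef_family] requires of |z| / r; as r <= sigma / 2, it also makes the
   ratio |z| / (sigma / 2) at most 1 / 4. The factor nu comes from passing from components to the
   Euclidean norm. *)
exists (r / 4), E1, (nu%:R * del), (4 / c); split => //.
- by apply/andP; split; lra.
- by rewrite E10.
- exact: mulr_gt0.
- by rewrite divr_gt0.
move=> i e0 z Se0 zr; rewrite /cdisc /= in zr.
have zs : modulus z < sigma by lra.
have [d dpos Hd] := sector_open hgamma gpi Se0.
have Hh j : hol (fun e => f (e, z) ord0 j) e0 d.
  move=> e /Hd Se; apply: slice_e; apply: hol_f.
  by split; [exact: sub1|].
have -> : nu%:R * del * i`!%:R * (4 / c) ^+ i = nu%:R * (del * i`!%:R * (4 / c) ^+ i) by ring.
apply: euclidean_norm_le => [|j].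
  by rewrite !mulr_ge0 ?exprn_ge0 ?divr_ge0 ?ltW.
have -> : phi f i e0 z ord0 j = tcoef i (fun e => f (e, z) ord0 j) e0.
  rewrite /phi mxE /tcoef; congr (_ * _).
  by apply: (derive1n_coord i Hh); rewrite subrr modulus0.
have [_ Hn] := Hdata e0 (sub2 e0 Se0).
have q01 : 0 <= modulus z / (sigma / 2) <= 1 / 4.
  apply/andP; split; first by rewrite divr_ge0 ?modulus_ge0// ltW.
  by rewrite ler_pdivrMr//; lra.
have M0 : 0 <= 2 * rho * nu%:R by rewrite mulr_ge0// mulr_ge0// ltW.
apply: (@tcoef_family _ (fun e => f (e, z) ord0 j) (fun n e => acf F e n ord0 j) e0 z c r d del
  _ _ i c0 r0 dpos (ltW d0) M0 zr q01 _ _ (Hh j)).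
- by move=> n n0; have [H _] := Hn n n0; exact: H.
- move=> n e n0 He; have [_ H] := Hn n n0.
  exact: le_trans (l1_comp _ _) (H e He).
move=> L e /Hd Se; have zs4 : modulus z <= sigma / 4 by lra.
have T := tail e z L Se zs4.
have -> : f (e, z) ord0 j - \sum_(n < L) acf F e n.+1 ord0 j * z ^+ n.+1 =
    (f (e, z) - vpoly (acf F e) L z) ord0 j.
  rewrite [RHS]mxE [X in _ = _ + X]mxE vpolyE; congr (_ - _).
  by apply: eq_bigr => k _; rewrite mulrC.
apply: le_trans (l1_comp _ _) _; apply: le_trans T _; apply: ler_wpM2l => //.
have /andP[q0 q1] := q01.
by rewrite exprS; apply: ler_piMl; [exact: exprn_ge0|lra].
Qed.
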